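(* Let $\beta>0$, $\beta'=\beta/2$, and let $(a_n)_n,(b_n)_n$ be positive parameters such that $$\frac{a_n}{n}\xrightarrow[n\to\infty]{}\infty,\qquad \frac{a_n}{b_n}\xrightarrow[n\to\infty]{}\sigma\in(0,\infty),\qquad \sqrt{\frac{b_n}{n}}\Big(\sigma-\frac{a_n}{b_n}\Big)\xrightarrow[n\to\infty]{}0 .$$ For each $n$ let $(\lambda_1,\dots,\lambda_n;w_1,\dots,w_n)\sim\mathcal{J}\beta\mathcal{E}(a_n,b_n)$ (all $n$ on one probability space), and consider the rescaled eigenvalues $$\tilde\lambda_i=(\sigma+1)\sqrt{\frac{b_n(1+\sigma)}{\sigma n\beta'}}\Big(\lambda_i-\frac{\sigma}{\sigma+1}\Big).$$ Then both the spectral measure $\sum_{i=1}^n w_i\delta_{\tilde\lambda_i}$ and the empirical measure $\frac1n\sum_{i=1}^n\delta_{\tilde\lambda_i}$ converge weakly, almost surely, to the semicircle law $\mathrm{SC}$, which has density $\frac{1}{2\pi}\sqrt{4-x^2}\,\mathbb{1}_{\{-2<x<2\}}$.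
   Context: Jacobi ensemble $\mathcal{J}\beta\mathcal{E}(a,b)$ in dimension $n$ (with $\beta>0$, $\beta'=\beta/2$, parameters $a,b>\beta'(n-1)$): the joint law of a random eigenvalue vector $(\lambda_1,\dots,\lambda_n)$ with Lebesgue density $$c_{a,b,\beta}\prod_{i<j}|\lambda_i-\lambda_j|^\beta\prod_{i=1}^n\lambda_i^{a-e_\beta}(1-\lambda_i)^{b-e_\beta}\mathbb{1}_{\{0<\lambda_i<1\}},\qquad e_\beta=\tfrac{\beta}{2}(n-1)+1,$$ ($c_{a,b,\beta}$ the normalising constant), together with an independent weight vector $(w_1,\dots,w_n)$ having the Dirichlet distribution with all $n$ parameters equal to $\beta'$. The spectral measure is $\mu_n=\sum_i w_i\delta_{\lambda_i}$ and the empirical eigenvalue distribution is $\hat\mu_n=\frac1n\sum_i\delta_{\lambda_i}$; when eigenvalues are rescaled the weights are kept. Weak convergence refers to probability measures on $\mathbb{R}$. *)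

(* Defs.v *)
From HB Require Import structures.
From mathcomp Require Import all_boot all_order all_algebra.
From mathcomp Require Import all_classical all_reals all_analysis.
Set Implicit Arguments. Unset Strict Implicit. Unset Printing Implicit Defensive.
Import Order.TTheory GRing.Theory Num.Theory.
Import numFieldNormedType.Exports.
Local Open Scope classical_set_scope.
Local Open Scope ring_scope.

Section JacobiDefs.
Variable R : realType.

(* Iterated Lebesgue integral over R^n of f : (nat -> R) -> \bar R,
   integrating the coordinates 0, ..., n-1 (other coordinates are 0).
   For nonnegative integrands (the only use below) this is the integral
   against Lebesgue measure on R^n (Tonelli). *)
Fixpoint iint (n : nat) (f : (nat -> R) -> \bar R) : \bar R :=
  match n with
  | 0%N => f (fun _ => 0)
  | k.+1 => (\int[@lebesgue_measure R]_(x in setT)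
               iint k (fun v => f (fun i => if i == k then x else v i)))%E
  end.

Definition e_beta (beta : R) (n : nat) : R := beta / 2 * (n%:R - 1) + 1.

Definition jacobi_dens (beta : R) (n : nat) (a b : R) (v : nat -> R) : R :=
  (\prod_(i < n) \prod_(j < n | (i < j)%N) `|v i - v j| `^ beta) *
  \prod_(i < n) (if (0 < v i) && (v i < 1)
                 then v i `^ (a - e_beta beta n) * (1 - v i) `^ (b - e_beta beta n)
                 else 0).

Definition jacobi_box (beta : R) (n : nat) (a b : R) (x : 'I_n -> R) : R :=
  fine (iint n (fun v => (jacobi_dens beta n a b v *
                           ([forall i : 'I_n, v i <= x i])%:R)%:E)) /
  fine (iint n (fun v => (jacobi_dens beta n a b v)%:E)).

(* Dirichlet(bp,...,bp) in dimension n >= 1: density with respect to Lebesgue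
   measure in the first n-1 coordinates, the last one being 1 - sum of others. *)
Definition dir_full (n : nat) (v : nat -> R) : nat -> R :=
  fun i => if (i < n.-1)%N then v i else 1 - \sum_(j < n.-1) v j.

Definition dir_dens (bp : R) (n : nat) (v : nat -> R) : R :=
  \prod_(i < n) (if 0 < dir_full n v i then dir_full n v i `^ (bp - 1) else 0).

Definition dir_box (bp : R) (n : nat) (y : 'I_n -> R) : R :=
  fine (iint n.-1 (fun v => (dir_dens bp n v *
                    ([forall i : 'I_n, dir_full n v i <= y i])%:R)%:E)) /
  fine (iint n.-1 (fun v => (dir_dens bp n v)%:E)).

Definition sc_dens (x : R) : R :=
  if (-2 < x) && (x < 2) then Num.sqrt (4 - x ^+ 2) / (2 * pi) else 0.

(* Weak convergence to SC of a sequence of probability measures mu_n on R,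
   each given through its integration functional f |-> \int f dmu_n. *)
Definition weak_conv_SC (mu_int : nat -> (R -> R) -> R) : Prop :=
  forall f : R -> R, continuous f -> (exists M : R, forall x, `|f x| <= M) ->
    mu_int n f @[n --> \oo] -->
      Rintegral (@lebesgue_measure R) setT (fun x => f x * sc_dens x).

Definition jrescale (beta sigma bn : R) (n : nat) (l : R) : R :=
  (sigma + 1) * Num.sqrt (bn * (1 + sigma) / (sigma * n%:R * (beta / 2))) *
  (l - sigma / (sigma + 1)).

Definition spectral_int (n : nat) (l w : 'I_n -> R) (f : R -> R) : R :=
  \sum_(i < n) w i * f (l i).
Definition empirical_int (n : nat) (l : 'I_n -> R) (f : R -> R) : R :=
  n%:R^-1 * \sum_(i < n) f (l i).

End JacobiDefs.

(* Main.v *)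
(** The Jacobi weight is a product of powers of affine forms, hence strongly
log-concave up to relabelling: its mass at squared distance at least [del] from
every permutation of a maximiser [y] is at most [2^n exp (- c (a + b) del)]. After
rescaling this is summable, so by Borel-Cantelli the eigenvalues are almost surely
within [o(n)] in squared distance from [y]. Stationarity of [y] gives a closed
recursion for the moments of its empirical measure whose limit is the
Schwinger-Dyson (Catalan) recursion of the semicircle law; Weierstrass
approximation turns convergence of moments into weak convergence. Finally, the
Dirichlet weights are normalised independent Gamma variables, independent of the
eigenvalues: a Chernoff bound shows that they put asymptotically the same mass as
the uniform weights on every half-line of a grid, so the spectral measure has the
same limit as the empirical one. *)
Require Import Defs.
From HB Require Import structures.
From mathcomp Require Import all_boot all_order all_algebra.
From mathcomp Require Import all_classical all_reals all_analysis.
From mathcomp Require Import fingroup perm measurable_realfun.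
From mathcomp Require Import ring lra.
Import Order.TTheory GRing.Theory Num.Theory.
Import numFieldNormedType.Exports.
Local Open Scope classical_set_scope.
Local Open Scope ring_scope.

(** The Vandermonde factor is log-concave only on each cone of ordered coordinates, and every
    relabelling of a maximiser is again one; hence the distance to all permutations. The
    concentration bound is a midpoint argument: sending [v] to the midpoint of [v] and the
    relabelled maximiser contracts volume by [2 ^ n], which is the only loss. A rescaled squared
    distance [eps n] costs an exponent of order [n ^ 2], far more than that loss. Working with a
    deterministic maximiser makes the moment recursion exact: stationarity is tested on
    [x ^ k * y * (1 - y)], where the factor [y * (1 - y)] removes the poles at 0 and 1. The laws are
    known only on boxes and as quotients of integrals. That the normalising integrals are finite and
    nonzero, and that independence holds on all measurable sets, has to be extracted from these box
    formulas. The Dirichlet estimate needs a fixed linear form in the weights, whereas the half-line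
    masses depend on the random eigenvalues; independence allows conditioning on which eigenvalues
    lie below the threshold. *)

Definition pushforward_measure {d d'} {T1 : measurableType d}
    {T2 : measurableType d'} {R : realFieldType} (m : {measure set T1 -> \bar R})
    {f : T1 -> T2} (mf : measurable_fun setT f) : {measure set T2 -> \bar R} :=
  measure_function_pushforward__canonical__measure_function_Measure m mf.

(** * Affine change of variable on the line *)

Section affine_change_of_variable.
Context {R : realType}.
Local Notation mu := (@lebesgue_measure R).

Definition affine (c z : R) : measurableTypeR R -> measurableTypeR R := fun x => c * x + z.

Lemma measurable_affine (c z : R) : measurable_fun setT (affine c z).
Proof. by apply: measurable_funD => //; exact: mulrl_measurable. Qed.

(** Lebesgue measure is determined by half-open intervals, and the preimage of []a, b]] under the
    affine map is an interval [c] times shorter. *)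
Lemma lebesgue_measure_affine (c z : R) (A : set R) : 0 < c -> measurable A ->
  mu A = (c%:E * pushforward mu (affine c z) A)%E.
Proof.
move=> c0 mA.
pose k : {nonneg R} := NngNum (ltW c0).
change (mu A = mscale k (pushforward_measure mu (measurable_affine c z)) A).
apply: lebesgue_measure_unique => //= _ [[a b]] _ <- /=; rewrite /mscale /pushforward_measure /= /pushforward.
have -> : affine c z @^-1` `]a, b]%classic = `](a - z) / c, (b - z) / c]%classic.
  apply/seteqP; split => x /=; rewrite /affine !in_itv/= => /andP[h1 h2].
    by rewrite ltr_pdivrMr// ler_pdivlMr// mulrC ltrBlDr lerBrDr h1 h2.
  by move: h1 h2; rewrite ltr_pdivrMr// ler_pdivlMr// mulrC ltrBlDr lerBrDr => -> ->.
rewrite !lebesgue_measure_itv/= !lte_fin ltr_pM2r ?invr_gt0// ltrD2r.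
case: ifPn => ab; last by rewrite mule0.
by rewrite -!EFinB -EFinM; congr EFin; field; rewrite gt_eqF.
Qed.

Lemma ge0_integral_affine (c z : R) (f : R -> \bar R) : 0 < c ->
  measurable_fun setT f -> (forall x, 0 <= f x)%E ->
  (\int[mu]_x f x = c%:E * \int[mu]_x f (c * x + z)%R)%E.
Proof.
move=> c0 mf f0.
pose k : {nonneg R} := NngNum (ltW c0).
transitivity (\int[mscale k (pushforward_measure mu (measurable_affine c z))]_x f x)%E.
  by apply: eq_measure_integral => A mA _; exact: lebesgue_measure_affine.
rewrite ge0_integral_mscale//=; congr (_ * _)%E.
by rewrite (ge0_integral_pushforward (measurable_affine c z)).
Qed.

End affine_change_of_variable.

(** * Real sequences as a measurable space *)

Section real_sequences.
Context {R : realType}.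

(** Boxes that constrain at least the first [m] coordinates. The generated sigma-algebra does not
    depend on [m]; choosing the dimension of a random vector for [m] makes every box of the
    pi-system constrain all its coordinates. *)
Definition boxes (m : nat) : set (set (nat -> R)) :=
  [set A | exists N (x : nat -> R), (m <= N)%N /\
    A = [set v | forall i, (i < N)%N -> v i <= x i]].

(** [iint] integrates functions of a whole sequence, so measurability is set up on sequences, once
    for all dimensions. *)
Definition rseq := g_sigma_algebraType (boxes 0).
HB.instance Definition _ := Measurable.on rseq.

Definition upd (k : nat) (x : R) (v : nat -> R) : nat -> R :=
  fun i => if i == k then x else v i.

(** A half-space [v i <= x] is the union over [m] of the boxes that moreover bound the earlier
    coordinates by [m]. *)
Lemma measurable_coord i : measurable_fun setT (fun v : rseq => v i).
Proof.
apply: (@measurability _ _ _ _ setT (fun v : rseq => v i) _ (RGenOInfty.measurableE R)).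
move=> _ [_ [x ->] <-]; rewrite setTI -[X in measurable X]setCK; apply: measurableC.
have -> : ~` ((fun v : rseq => v i) @^-1` `]x, +oo[) =
  \bigcup_m [set v : rseq | forall j, (j < i.+1)%N ->
                v j <= (fun j => if j == i then x else m%:R) j].
  apply/seteqP; split => v /=.
    rewrite in_itv/= andbT => /negP; rewrite -leNgt => vx.
    exists (Num.truncn (\sum_(j < i.+1) `|v j|)).+1 => //= j ji.
    case: eqP => [->//|_]; rewrite (le_trans (ler_norm _))//.
    apply: (@le_trans _ _ (\sum_(j < i.+1) `|v j|)); last exact/ltW/truncnS_gt.
    by rewrite (bigD1 (Ordinal ji))//= lerDl sumr_ge0.
  move=> [m _ /(_ i (ltnSn _))]; rewrite eqxx in_itv/= andbT => h.
  by apply/negP; rewrite -leNgt.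
apply: bigcupT_measurable => m; apply: sub_sigma_algebra.
by exists i.+1, (fun j => if j == i then x else m%:R).
Qed.

Lemma measurable_fun_rseq d (T : measurableType d) (f : T -> rseq) :
  (forall i, measurable_fun setT (fun t => f t i)) -> measurable_fun setT f.
Proof.
move=> mf; apply: (@measurability _ _ _ rseq setT f (boxes 0)) => // _ [_ [N [x [_ ->]]] <-].
rewrite setTI.
have -> : f @^-1` [set v | forall i, (i < N)%N -> v i <= x i] =
    \bigcap_(i in `I_N) [set t | f t i <= x i].
  by apply/seteqP; split => t /= h i /h.
apply: fin_bigcap_measurable => // i _.
rewrite [X in measurable X](_ : _ = setT `&` (fun t => f t i) @^-1` `]-oo, x i]).
  by apply: mf => //; exact: measurable_itv.
by rewrite setTI; apply/seteqP; split => t /=; rewrite in_itv.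
Qed.

(** A box with too few constraints is the union over [k] of the boxes that bound the missing
    coordinates by [k]. *)
Lemma measurable_boxes m : (@measurable _ rseq) = <<s boxes m >>.
Proof.
apply/seteqP; split; last first.
  apply: smallest_sub; first exact: sigma_algebra_measurable.
  by move=> A [N [x [_ ->]]]; apply: sub_sigma_algebra; exists N, x.
apply: smallest_sub; first exact: smallest_sigma_algebra.
move=> _ [N [x [_ ->]]].
pose T : measurableType _ := g_sigma_algebraType (boxes m).
have -> : [set v : nat -> R | forall i, (i < N)%N -> v i <= x i] =
    \bigcup_k [set v | forall i, (i < maxn m N)%N ->
      v i <= (fun i => if (i < N)%N then x i else k%:R) i].
  apply/seteqP; split => v /=.
    move=> vx; exists (Num.truncn (\sum_(j < maxn m N) `|v j|)).+1 => //= j ji.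
    case: ifPn => [/vx//|_]; rewrite (le_trans (ler_norm _))//.
    apply: (@le_trans _ _ (\sum_(j < maxn m N) `|v j|)); last exact/ltW/truncnS_gt.
    by rewrite (bigD1 (Ordinal ji))//= lerDl sumr_ge0.
  move=> [k _ h] i iN; have := h i; rewrite iN; apply.
  by rewrite leq_max iN orbT.
apply: (@bigcupT_measurable _ T) => k; apply: sub_sigma_algebra.
by exists (maxn m N), (fun i => if (i < N)%N then x i else k%:R); rewrite leq_maxl.
Qed.

Lemma setI_closed_boxes m : setI_closed (boxes m).
Proof.
move=> _ _ [N [x [mN ->]]] [M [y [mM ->]]].
exists (maxn N M), (fun i => if (i < N)%N then
   (if (i < M)%N then Num.min (x i) (y i) else x i) else y i); split.
  by rewrite leq_max mN.
apply/seteqP; split => v /=.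
  move=> [h1 h2] i; rewrite leq_max; case: (boolP (i < N)%N) => iN /=.
    by case: ifPn => iM _; rewrite ?le_min ?h1// h2.
  exact: h2.
move=> h; split => i iN; have := h i; rewrite leq_max iN ?orbT => /(_ isT).
  by case: ifPn => // _; rewrite le_min => /andP[].
by case: ifPn => // _; rewrite le_min => /andP[].
Qed.

Lemma measurable_upd d (T : measurableType d) k (f : T -> R) (g : T -> rseq) :
  measurable_fun setT f -> measurable_fun setT g ->
  measurable_fun setT (fun t => upd k (f t) (g t) : rseq).
Proof.
move=> mf mg; apply: measurable_fun_rseq => i; rewrite /upd; case: eqP => // _.
exact: (measurableT_comp (measurable_coord i) mg).
Qed.

End real_sequences.
Arguments rseq R : clear implicits.

(** * Calculus of the iterated integral: monotonicity, linearity, Tonelli *)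

Section iterated_integral.
Context {R : realType}.
Local Notation mu := (@lebesgue_measure R).
Local Open Scope ereal_scope.

Lemma iintS k (f : (nat -> R) -> \bar R) :
  iint k.+1 f = \int[mu]_x iint k (fun v => f (upd k x v)).
Proof. by []. Qed.

Lemma eq_iint k (f g : (nat -> R) -> \bar R) : f =1 g -> iint k f = iint k g.
Proof. by move=> /funext ->. Qed.

Lemma iint_ge0 k (f : (nat -> R) -> \bar R) : (forall v, 0 <= f v) -> 0 <= iint k f.
Proof.
elim: k f => [|k IH] f f0; first exact: f0.
by rewrite iintS; apply: integral_ge0 => x _; exact: IH.
Qed.

(** The parameter space is arbitrary because the induction adds the outermost variable to it;
    Tonelli then integrates that variable out. *)
Lemma measurable_iint k d (X : measurableType d) (F : X -> rseq R -> \bar R) :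
  measurable_fun setT (fun p : X * rseq R => F p.1 p.2) ->
  (forall x v, 0 <= F x v) -> measurable_fun setT (fun x => iint k (F x)).
Proof.
elim: k d X F => [|k IH] d X F mF F0.
  apply: (measurableT_comp mF (f := fun x => F x.1 x.2)
     (g := fun x => (x, (fun=> 0%R) : rseq R))).
  exact: measurable_fun_pair.
have h := @IH _ (X * R)%type (fun p v => F p.1 (upd k p.2 v)) _ _.
suff : measurable_fun setT (fubini_F mu
    (fun p : X * R => iint k (fun v => F p.1 (upd k p.2 v)))) by [].
apply: measurable_fun_fubini_tonelli_F.
  apply: h => //.
  apply: (measurableT_comp mF (g := fun p : (X * R) * rseq R =>
     (p.1.1, upd k p.1.2 p.2 : rseq R))).
  apply: measurable_fun_pair; first exact: measurableT_comp.
  by apply: measurable_upd => //; exact: measurableT_comp.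
by move=> x; exact: iint_ge0.
Qed.

Lemma measurable_updl k (f : rseq R -> \bar R) : measurable_fun setT f ->
  measurable_fun setT (fun p : R * rseq R => f (upd k p.1 p.2)).
Proof.
move=> mf; apply: (measurableT_comp mf (g := fun p : R * rseq R => (upd k p.1 p.2 : rseq R))).
exact: measurable_upd.
Qed.

Lemma measurable_updr k x (f : rseq R -> \bar R) : measurable_fun setT f ->
  measurable_fun setT ((fun v => f (upd k x v)) : rseq R -> \bar R).
Proof.
move=> mf; apply: (measurableT_comp mf (g := fun p : rseq R => (upd k x p : rseq R))).
exact: measurable_upd.
Qed.

Lemma measurable_iint_upd k j (f : rseq R -> \bar R) : measurable_fun setT f ->
  (forall v, 0 <= f v) ->
  measurable_fun setT (fun x : R => iint k (fun v => f (upd j x v))).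
Proof.
move=> mf f0; apply: (@measurable_iint _ _ R (fun x v => f (upd j x v))) => //.
exact: measurable_updl.
Qed.

Lemma le_iint k (f g : rseq R -> \bar R) : measurable_fun setT f ->
  measurable_fun setT g -> (forall v, 0 <= f v) -> (forall v, f v <= g v) ->
  iint k f <= iint k g.
Proof.
elim: k f g => [|k IH] f g mf mg f0 fg; first exact: fg.
have g0 v : 0 <= g v by exact: le_trans (f0 v) (fg v).
rewrite !iintS; apply: ge0_le_integral => //.
- by move=> x _; exact: iint_ge0.
- exact: measurable_iint_upd.
- exact: measurable_iint_upd.
- by move=> x _; apply: IH => //; exact: measurable_updr.
Qed.

Lemma iintD k (f g : rseq R -> \bar R) : measurable_fun setT f ->
  measurable_fun setT g -> (forall v, 0 <= f v) -> (forall v, 0 <= g v) ->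
  iint k (fun v => f v + g v) = iint k f + iint k g.
Proof.
elim: k f g => [//|k IH] f g mf mg f0 g0.
rewrite !iintS -ge0_integralD//.
- by apply: eq_integral => x _; apply: IH => //; exact: measurable_updr.
- by move=> x _; exact: iint_ge0.
- exact: measurable_iint_upd.
- by move=> x _; exact: iint_ge0.
- exact: measurable_iint_upd.
Qed.

Lemma iintZl k (c : \bar R) (f : rseq R -> \bar R) : measurable_fun setT f ->
  (forall v, 0 <= f v) -> 0 <= c -> iint k (fun v => c * f v) = c * iint k f.
Proof.
elim: k f => [//|k IH] f mf f0 c0.
rewrite !iintS -ge0_integralZl//.
- by apply: eq_integral => x _; apply: IH => //; exact: measurable_updr.
- exact: measurable_iint_upd.
- by move=> x _; exact: iint_ge0.
Qed.

Lemma iint0 k : iint k (fun _ : nat -> R => 0) = 0.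
Proof.
elim: k => [//|k IH]; rewrite iintS; under eq_integral do rewrite IH.
exact: integral0.
Qed.

Lemma iint_sum k (I : Type) (s : seq I) (f : I -> rseq R -> \bar R) :
  (forall i, measurable_fun setT (f i)) -> (forall i v, 0 <= f i v) ->
  iint k (fun v => \sum_(i <- s) f i v) = \sum_(i <- s) iint k (f i).
Proof.
move=> mf f0; elim: s => [|i s IH].
  by rewrite big_nil -[RHS](iint0 k); apply: eq_iint => v; rewrite big_nil.
rewrite big_cons -IH -iintD//; last 2 first.
- exact: emeasurable_sum.
- by move=> v; apply: sume_ge0.
by apply: eq_iint => v; rewrite big_cons.
Qed.

Lemma iint_nneseries k (f : nat -> rseq R -> \bar R) :
  (forall i, measurable_fun setT (f i)) -> (forall i v, 0 <= f i v) ->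
  iint k (fun v => \sum_(i <oo) f i v) = \sum_(i <oo) iint k (f i).
Proof.
elim: k f => [//|k IH] f mf f0.
rewrite iintS -[RHS]integral_nneseries//; last 2 first.
- by move=> i; exact: measurable_iint_upd.
- by move=> i x _; exact: iint_ge0.
by apply: eq_integral => x _; apply: IH => // i; exact: measurable_updr.
Qed.

(** [iint k] evaluates its integrand at sequences that vanish from [k] on, so the shift has to
    vanish there as well. *)
Lemma iint_affine k (c : R) (z : nat -> R) (f : rseq R -> \bar R) :
  (0 < c)%R -> (forall i, (k <= i)%N -> z i = 0%R) -> measurable_fun setT f ->
  (forall v, 0 <= f v) ->
  iint k f = (c ^+ k)%:E * iint k (fun v => f (fun i => c * v i + z i)%R).
Proof.
elim: k z f => [|k IH] z f c0 z0 mf f0.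
  by rewrite expr0 mul1e /=; congr f; apply/funext => i; rewrite mulr0 z0// addr0.
rewrite !iintS (ge0_integral_affine c (z k))//; last 2 first.
- exact: measurable_iint_upd.
- by move=> x; exact: iint_ge0.
(* The induction hypothesis wants a shift that is zero at [k]; nothing changes, since [upd]
   overwrites that coordinate. *)
pose z' i := if (i < k)%N then z i else 0%R.
have mF : measurable_fun setT (fun v : rseq R => f (fun i => c * v i + z i)%R).
  apply: (measurableT_comp mf (g := fun v : rseq R => (fun i => c * v i + z i)%R : rseq R)).
  apply: measurable_fun_rseq => i; apply: measurable_funD => //.
  by apply: measurable_funM => //; exact: measurable_coord.
rewrite exprS EFinM -muleA; congr (_ * _).
rewrite -ge0_integralZl//; last 3 first.
- exact: (measurable_iint_upd k k (fun v => f (fun i => c * v i + z i)%R)).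
- by move=> x _; exact: iint_ge0.
- by rewrite lee_fin exprn_ge0// ltW.
apply: eq_integral => x _; rewrite (IH z')//.
- congr (_ * _); apply: eq_iint => v; congr f; apply/funext => i.
  rewrite /upd /z'; case: (ltngtP i k) => // [ki|->]//.
  by rewrite (z0 i).
- by move=> i ki; rewrite /z' ltnNge ki.
- exact: measurable_updr.
Qed.

Lemma iint_integral_swap k (F : rseq R -> R -> \bar R) :
  measurable_fun setT (fun p : rseq R * R => F p.1 p.2) ->
  (forall v x, 0 <= F v x) ->
  iint k (fun v => \int[mu]_x F v x) = \int[mu]_x iint k (F ^~ x).
Proof.
elim: k F => [//|k IH] F mF F0.
rewrite iintS.
have mFk x : measurable_fun setT (fun p : rseq R * R => F (upd k x p.1) p.2).
  apply: (measurableT_comp mF (g := fun p : rseq R * R => (upd k x p.1 : rseq R, p.2))).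
  by apply: measurable_fun_pair => //; exact: measurable_upd.
transitivity (\int[mu]_x \int[mu]_y iint k (fun v => F (upd k x v) y)).
  by apply: eq_integral => x _; exact: (IH (fun v y => F (upd k x v) y)).
pose h (p : R * R) := iint k (fun v => F (upd k p.1 v) p.2).
rewrite (@fubini_tonelli _ _ _ _ R mu mu h)//; last first.
  by move=> p; exact: iint_ge0.
apply: (@measurable_iint _ _ (R * R)%type (fun p v => F (upd k p.1 v) p.2)) => //.
apply: (measurableT_comp mF (g := fun p : (R * R) * rseq R => (upd k p.1.1 p.2 : rseq R, p.1.2))).
apply: measurable_fun_pair; last exact: measurableT_comp.
by apply: measurable_upd => //; exact: measurableT_comp.
Qed.

Lemma iint_prod k (g : nat -> R -> R) : (forall i, measurable_fun setT (g i)) ->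
  (forall i x, 0 <= g i x)%R ->
  iint k (fun v => (\prod_(i < k) g i (v i))%:E) =
  \prod_(i < k) \int[mu]_x (g i x)%:E.
Proof.
move=> mg g0; elim: k => [|k IH]; first by rewrite /= !big_ord0.
have mgE i : measurable_fun setT (fun x : R => (g i x)%:E).
  by apply/measurable_EFinP; exact: mg.
rewrite [RHS]big_ord_recr/= -IH -ge0_integralZl//; last 3 first.
- exact: mgE.
- by move=> x _; rewrite lee_fin.
- by apply: iint_ge0 => v; rewrite lee_fin prodr_ge0.
apply: eq_integral => x _; rewrite muleC -iintZl//; last 3 first.
- apply/measurable_EFinP; apply: measurable_prod => i _.
  by apply: measurableT_comp => //; exact: measurable_coord.
- by move=> v; rewrite lee_fin prodr_ge0.
- by rewrite lee_fin.
apply: eq_iint => v; rewrite big_ord_recr/= eqxx EFinM muleC; congr (_ * _%:E).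
by apply: eq_bigr => i _; rewrite ltn_eqF.
Qed.

End iterated_integral.

(** * From distribution functions to laws *)

Section law.
Context {R : realType}.

(** Padding by 0 agrees with the base case of [iint], so random vectors and integration points live
    in the same space. *)
Definition emb {n : nat} (x : 'I_n -> R) : nat -> R :=
  fun i => if insub i is Some j then x j else 0.

Lemma emb_ord n (x : 'I_n -> R) (i : 'I_n) : emb x i = x i.
Proof. by rewrite /emb valK. Qed.

Lemma emb_ge n (x : 'I_n -> R) i : (n <= i)%N -> emb x i = 0.
Proof. by move=> ni; rewrite /emb insubF// ltnNge ni. Qed.

Lemma measurable_emb d (T : measurableType d) n (X : T -> 'I_n -> R) :
  (forall i, measurable_fun setT (fun t => X t i)) ->
  measurable_fun setT (fun t => emb (X t) : rseq R).
Proof.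
move=> mX; apply: measurable_fun_rseq => i; rewrite /emb.
by case: (insub i : option 'I_n).
Qed.

Section density_measure.
Local Open Scope ereal_scope.
Variables (k : nat) (f : rseq R -> R) (T : rseq R -> rseq R).
Hypotheses (mf : measurable_fun setT f) (f0 : forall v, (0 <= f v)%R).
Hypothesis mT : measurable_fun setT T.

(** The image under [T] of the measure with density [f]. The map is there for the Dirichlet law,
    whose density has one variable less than the vector; for the Jacobi law [T] is a truncation. *)
Definition dens_fun (A : set (rseq R)) : \bar R :=
  iint k (fun v => (f v)%:E * (\1_A (T v))%:E).

Let integrand_ge0 A v : 0 <= (f v)%:E * (\1_A (T v))%:E.
Proof. by rewrite mule_ge0// lee_fin. Qed.

Lemma measurable_dens_integrand A : measurable A ->
  measurable_fun setT (fun v : rseq R => (f v)%:E * (\1_A (T v))%:E).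
Proof.
move=> mA; apply: emeasurable_funM; apply/measurable_EFinP => //.
have mi : measurable_fun setT (\1_A : rseq R -> R) by exact: measurable_indic.
exact: (measurableT_comp mi mT).
Qed.

Let dens0 : dens_fun set0 = 0.
Proof.
rewrite -[RHS](iint0 k); apply: eq_iint => v; by rewrite indicE in_set0 mule0.
Qed.

Let dens_ge0 A : 0 <= dens_fun A.
Proof. exact: iint_ge0. Qed.

Let dens_sigma : semi_sigma_additive dens_fun.
Proof.
move=> F mF tF mUF.
rewrite [X in _ --> X](_ : _ = \sum_(i <oo) dens_fun (F i)).
  by apply: is_cvg_nneseries => n _ _; exact: dens_ge0.
rewrite -iint_nneseries//; last by move=> i; exact: measurable_dens_integrand.
apply: eq_iint => v; rewrite nneseriesZl//.
congr (_ * _); rewrite indicE.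
have [/set_mem [i _ Fi]|/negP nF] := boolP (T v \in \bigcup_n F n).
  rewrite (@nneseriesD1 _ _ i)//.
  rewrite indicE mem_set// eseries0 ?adde0// => j _ /eqP ji.
  rewrite indicE memNset// => Fj.
  have /trivIsetP/(_ j i Logic.I Logic.I) h := tF.
  by have : (F j `&` F i) (T v) by []; rewrite h//; exact/eqP.
rewrite eseries0// => i _ _; rewrite indicE memNset// => Fi.
by apply: nF; apply/mem_set; exists i.
Qed.

Definition dens_measure : {measure set (rseq R) -> \bar R} :=
  HB.pack dens_fun (isMeasure.Build _ _ _ dens_fun dens0 dens_ge0 dens_sigma).

End density_measure.

(** Two finite measures that agree on a pi-system coincide. A box with [N] beyond [n] constrains
    coordinates that are 0 on both sides: either these constraints hold automatically or both
    measures give it mass 0, which is the case distinction on the signs of the [x i]. *)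
Lemma law_unique n k (f : rseq R -> R) (T : rseq R -> rseq R)
    d (Om : measurableType d) (m : {measure set Om -> \bar R})
    (X : Om -> 'I_n -> R) :
  measurable_fun setT f -> (forall v, 0 <= f v) -> measurable_fun setT T ->
  (forall v i, (n <= i)%N -> T v i = 0) ->
  (forall i, measurable_fun setT (fun om => X om i)) -> (m setT < +oo)%E ->
  (forall x : 'I_n -> R, m [set om | forall i, X om i <= x i] =
     iint k (fun v => (f v)%:E * ([forall i : 'I_n, T v i <= x i])%:R%:E)%E) ->
  forall A : set (rseq R), measurable A ->
    m [set om | A (emb (X om))] = iint k (fun v => (f v)%:E * (\1_A (T v))%:E)%E.
Proof.
move=> mf f0 mT T0 mX moo mbox A mA.
pose g k := [set v : rseq R | forall i, (i < n)%N -> v i <= k%:R].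
have mE := measurable_emb _ _ _ X mX.
have := @measure_unique _ R (rseq R) (boxes n) g _ _ _ _
  (pushforward_measure m mE) (dens_measure k f T mf f0 mT) _ _ A mA; apply => //.
- exact: measurable_boxes.
- exact: setI_closed_boxes.
- by move=> j; exists n, (fun=> j%:R).
- apply/seteqP; split => // v _; exists (Num.truncn (\sum_(j < n) `|v j|)).+1 => //= j ji.
  rewrite (le_trans (ler_norm _))//.
  apply: (@le_trans _ _ (\sum_(j < n) `|v j|)); last exact/ltW/truncnS_gt.
  by rewrite (bigD1 (Ordinal ji))//= lerDl sumr_ge0.
- move=> _ [N [x [nN ->]]].
  rewrite /pushforward_measure/= /pushforward /dens_fun.
  have tailE v : (forall i, (n <= i)%N -> v i = 0) ->
     (forall i, (i < N)%N -> v i <= x i) <->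
     (forall i : 'I_n, v i <= x i) /\ (forall i, (n <= i < N)%N -> 0 <= x i).
    move=> v0; split => [h|[h1 h2] i iN].
      split => [i|i /andP[ni iN]]; first by apply: h; exact: leq_trans nN.
      by rewrite -(v0 i)// h.
    have [ni|ni] := leqP n i; first by rewrite v0// h2// ni.
    exact: (h1 (Ordinal ni)).
  have [xt|xt] := pselect (forall i, (n <= i < N)%N -> 0 <= x i).
    rewrite [X in m X](_ : _ = [set om | forall i, X om i <= x i]); last first.
      apply/seteqP; split => om /=.
        by move/tailE => [i ni|h _ i]; [rewrite emb_ge|rewrite -emb_ord].
      by move=> h; apply/tailE; [move=> i ni; rewrite emb_ge|split => // i; rewrite emb_ord].
    rewrite mbox; apply: eq_iint => v; congr (_ * _%:E)%E; rewrite indicE.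
    congr ((nat_of_bool _)%:R); apply/idP/idP.
      by move/forallP => h; apply/mem_set; apply/tailE => //; exact: T0.
    by move/set_mem/(tailE _ (T0 v)) => [h _]; apply/forallP.
  rewrite [X in m X](_ : _ = set0); last first.
    by rewrite -subset0 => om /= /tailE [i ni|_]; [rewrite emb_ge|].
  rewrite measure0 -[LHS](iint0 k); apply: eq_iint => v.
  by rewrite indicE memNset ?mule0// => /(tailE _ (T0 v))[].
- move=> j; apply: (le_lt_trans _ moo); rewrite /pushforward_measure/= /pushforward.
  apply: (le_measure m); [apply/mem_set|apply/mem_set; exact: measurableT|exact: subsetT].
  rewrite -[X in measurable X]setTI; apply: (mE measurableT).
  by apply: sub_sigma_algebra; exists n, (fun=> j%:R).
Qed.

End law.

(** * Measurability of Boolean predicates *)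

Section measurable_bool.
Context d (T : measurableType d).

Lemma measurable_forallb (I : finType) (f : I -> T -> bool) :
  (forall i, measurable_fun setT (f i)) ->
  measurable_fun setT (fun t => [forall i, f i t]).
Proof.
move=> mf; apply: (@measurable_fun_bool _ _ _ _ true).
rewrite setTI [X in measurable X](_ : _ = \bigcap_(i in [set: I]) (f i @^-1` [set true])).
  apply: fin_bigcap_measurable => // i _.
  by rewrite -[X in measurable X]setTI; exact: mf.
by apply/seteqP; split => t /= => [/forallP h i _|h]; [exact: h|apply/forallP => i; exact: h].
Qed.

Lemma measurable_set_bool (f : T -> bool) :
  measurable_fun setT f -> measurable [set t | f t].
Proof.
move=> mf; rewrite [X in measurable X](_ : _ = setT `&` (f @^-1` [set true])); first exact: mf.
by rewrite setTI.
Qed.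

Lemma measurable_bool_natmul (R : realType) (f : T -> bool) :
  measurable_fun setT f -> measurable_fun setT (fun t => (f t)%:R : R).
Proof.
move=> mf; rewrite (_ : (fun t => _) = (fun t => if f t then 1 else 0 : R)).
  by apply: measurable_fun_ifT.
by apply/funext => t; case: (f t).
Qed.

Lemma measurable_prod_cond (R : realType) (I : eqType) (s : seq I) (P : pred I)
    (h : I -> T -> R) : (forall i, P i -> measurable_fun setT (h i)) ->
  measurable_fun setT (fun x => \prod_(i <- s | P i) h i x).
Proof.
move=> mh; under eq_fun do rewrite -big_filter.
by apply: measurable_prod => i; rewrite mem_filter => /andP[/mh].
Qed.

End measurable_bool.

(** Stated for any commutative monoid, as it serves both the product of the pair weights and the sum
    of the divided differences. *)
Lemma big_lt_sym (S : Type) (idx : S) (op : Monoid.com_law idx) n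
    (F : 'I_n -> 'I_n -> S) : (forall i j, F i j = F j i) ->
  op (\big[op/idx]_(i < n) \big[op/idx]_(j < n | (i < j)%N) F i j)
     (\big[op/idx]_(i < n) \big[op/idx]_(j < n | (i < j)%N) F i j) =
  \big[op/idx]_(i < n) \big[op/idx]_(j < n | j != i) F i j.
Proof.
move=> Fsym.
rewrite [X in op _ X](exchange_big_dep predT)//= -big_split/=.
apply: eq_bigr => i _; rewrite [RHS](bigID (fun j : 'I_n => (i < j)%N))/=.
congr (op _ _).
  apply: eq_bigl => j; case: (ltngtP i j) => ij; rewrite ?andbF ?andbT//.
  by apply/esym/eqP => ji; rewrite ji ltnn in ij.
apply: eq_big => [j|j _]; last by rewrite Fsym.
case: (ltngtP i j) => ij; rewrite ?andbF ?andbT//.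
  by apply/esym/eqP => ji; rewrite ji ltnn in ij.
by apply/esym/negbTE; rewrite negbK; apply/eqP/val_inj.
Qed.

(** * Symmetry and strong log-concavity of the Jacobi weight *)

Section jacobi_weight.
Context {R : realType}.
Implicit Types (v z : nat -> R).

Definition pair_wt (beta : R) n v : R :=
  \prod_(i < n) \prod_(j < n | (i < j)%N) `|v i - v j| `^ beta.

Definition point_wt (A B x : R) : R :=
  if (0 < x) && (x < 1) then x `^ A * (1 - x) `^ B else 0.

Lemma jacobi_densE beta n a b v : jacobi_dens beta n a b v =
  pair_wt beta n v *
  \prod_(i < n) point_wt (a - e_beta beta n) (b - e_beta beta n) (v i).
Proof. by []. Qed.

Lemma pair_wt_ge0 beta n v : 0 <= pair_wt beta n v.
Proof. by apply: prodr_ge0 => i _; apply: prodr_ge0 => j _; exact: powR_ge0. Qed.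

Lemma point_wt_ge0 A B x : 0 <= point_wt A B x.
Proof. by rewrite /point_wt; case: ifP => // _; rewrite mulr_ge0 ?powR_ge0. Qed.

Lemma jacobi_dens_ge0 beta n a b v : 0 <= jacobi_dens beta n a b v.
Proof.
rewrite jacobi_densE mulr_ge0 ?pair_wt_ge0// prodr_ge0// => i _.
exact: point_wt_ge0.
Qed.

Lemma measurable_point_wt A B : measurable_fun setT (point_wt A B).
Proof.
apply: measurable_fun_ifT => //.
- by apply: measurable_and; apply: measurable_fun_ltr.
- apply: measurable_funM; first exact: measurable_powR.
  apply: (measurableT_comp (measurable_powR _)).
  exact: measurable_funB.
Qed.

Lemma measurable_jacobi_dens beta n a b :
  measurable_fun setT (jacobi_dens beta n a b : rseq R -> R).
Proof.
apply: measurable_funM.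
  apply: measurable_prod => i _; apply: measurable_prod_cond => j _.
  apply: (measurableT_comp (measurable_powR _)).
  apply: measurableT_comp => //.
  by apply: measurable_funB; exact: measurable_coord.
apply: measurable_prod => i _.
exact: (measurableT_comp (measurable_point_wt _ _) (measurable_coord i)).
Qed.

(** The square runs over all pairs of distinct indices, without the condition [i < j] that a
    permutation would not preserve. *)
Lemma pair_wt_sqr beta n v : pair_wt beta n v ^+ 2 =
  \prod_(i < n) \prod_(j < n | j != i) `|v i - v j| `^ beta.
Proof.
rewrite expr2; have := @big_lt_sym R 1 *%R n (fun i j => `|v i - v j| `^ beta).
by apply => i j; rewrite distrC.
Qed.

Lemma pair_wt_perm beta n v (p : {perm 'I_n}) z :
  (forall i : 'I_n, z i = v (p i)) -> pair_wt beta n z = pair_wt beta n v.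
Proof.
move=> zv; apply/eqP; rewrite -(eqrXn2 (n := 2))// ?pair_wt_ge0//; apply/eqP.
rewrite !pair_wt_sqr [RHS](reindex_inj (@perm_inj _ p))/=.
apply: eq_bigr => i _; rewrite [RHS](reindex_inj (@perm_inj _ p))/=.
apply: eq_big => [j|j _]; last by rewrite !zv.
by rewrite (inj_eq (@perm_inj _ p)).
Qed.

Lemma jacobi_dens_perm beta n a b v (p : {perm 'I_n}) z :
  (forall i : 'I_n, z i = v (p i)) ->
  jacobi_dens beta n a b z = jacobi_dens beta n a b v.
Proof.
move=> zv; rewrite !jacobi_densE (pair_wt_perm _ _ _ p _ zv); congr (_ * _).
by rewrite [RHS](reindex_inj (@perm_inj _ p))/=; apply: eq_bigr => i _; rewrite zv.
Qed.

Lemma jacobi_dens_neq0 beta n a b v : 0 < beta -> jacobi_dens beta n a b v != 0 ->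
  (forall i : 'I_n, 0 < v i < 1) /\ (forall i j : 'I_n, i != j -> v i != v j).
Proof.
move=> beta0; rewrite jacobi_densE mulf_eq0 negb_or => /andP[].
move=> h; have : pair_wt beta n v ^+ 2 != 0 by rewrite expf_eq0.
rewrite pair_wt_sqr => /prodf_neq0 h1 /prodf_neq0 h2; split => i.
  by have := h2 i isT; rewrite /point_wt; case: ifP => //; rewrite eqxx.
move=> j ij; have /prodf_neq0/(_ j) := h1 i isT; rewrite eq_sym ij => /(_ isT).
by rewrite powR_eq0 (gt_eqF beta0) andbT normr_eq0 subr_eq0.
Qed.

(* The logarithm is strongly concave on ]0, 1]: this is the midpoint version. *)
Lemma midpoint_le (x z : R) : 0 < x <= 1 -> 0 < z <= 1 ->
  x * z * expR ((x - z) ^+ 2 / 4) <= (2^-1 * x + 2^-1 * z) ^+ 2.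
Proof.
move=> /andP[x0 x1] /andP[z0 z1]; set u := (x - z) ^+ 2 / 4.
have -> : (2^-1 * x + 2^-1 * z) ^+ 2 = x * z + u by rewrite /u; field.
have u0 : 0 <= u by rewrite /u divr_ge0// sqr_ge0.
have pu : x * z + u <= 1.
  have -> : x * z + u = ((x + z) / 2) ^+ 2 by rewrite /u; field.
  by rewrite expr_le1//; lra.
have xz0 : 0 < x * z by rewrite mulr_gt0.
have u1 : 0 < 1 - u by lra.
have eu : expR u <= (1 - u)^-1.
  rewrite -[expR u]invrK lef_pV2 ?posrE ?invr_gt0 ?expR_gt0//.
  by rewrite -expRN; exact: expR_ge1Dx.
(* What remains is [x * z <= (x * z + u) * (1 - u)], that is [u * (x * z + u) <= u]. *)
apply: (le_trans (ler_wpM2l (ltW xz0) eu)).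
rewrite ler_pdivrMr//; nra.
Qed.

(** [midpoint_le] is used for [x, z] with power [A] and for [1 - x, 1 - z] with power [B]. Both
    pairs have the same squared difference, so the exponents add. *)
Lemma point_wt_mid (A B x z : R) : 0 <= A -> 0 <= B -> 0 < x < 1 -> 0 < z < 1 ->
  point_wt A B x * point_wt A B z * expR ((A + B) / 4 * (x - z) ^+ 2) <=
  point_wt A B (2^-1 * x + 2^-1 * z) ^+ 2.
Proof.
move=> A0 B0 /andP[x0 x1] /andP[z0 z1]; rewrite /point_wt x0 x1 z0 z1/=.
have -> : (0 < 2^-1 * x + 2^-1 * z) && (2^-1 * x + 2^-1 * z < 1).
  by apply/andP; split; lra.
set m := 2^-1 * x + 2^-1 * z; have m0 : 0 <= m by rewrite /m; lra.
have m1 : 0 <= 1 - m by rewrite /m; lra.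
have h1 := @midpoint_le x z; have h2 := @midpoint_le (1 - x) (1 - z).
have key C (p q r u : R) : 0 <= C -> 0 <= p -> 0 <= q -> 0 <= r ->
    p * q * expR u <= r ^+ 2 ->
    p `^ C * q `^ C * expR (C * u) <= r `^ C * r `^ C.
  move=> C0 p0 q0 r0 h.
  rewrite -!powRM// mulrC [C * u]mulrC expRM -powRM ?mulr_ge0 ?expR_ge0//.
  by rewrite ge0_ler_powR ?nnegrE ?mulr_ge0 ?expR_ge0// mulrC -expr2.
have k1 := key A x z m ((x - z) ^+ 2 / 4) A0 (ltW x0) (ltW z0) m0 (h1 _ _).
have k2 := key B (1 - x) (1 - z) (1 - m) ((x - z) ^+ 2 / 4) B0 _ _ m1 _.
rewrite (_ : _ / 4 * _ = A * ((x - z) ^+ 2 / 4) + B * ((x - z) ^+ 2 / 4)); last by ring.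
rewrite expRD.
set a1 := x `^ A; set a2 := z `^ A; set b1 := (1 - x) `^ B; set b2 := (1 - z) `^ B.
set eA := expR (A * _); set eB := expR (B * _).
rewrite (_ : a1 * b1 * _ * _ = (a1 * a2 * eA) * (b1 * b2 * eB)); last by ring.
rewrite (_ : _ ^+ 2 = (m `^ A * m `^ A) * ((1 - m) `^ B * (1 - m) `^ B)); last by ring.
apply: ler_pM.
- by rewrite !mulr_ge0 ?powR_ge0 ?expR_ge0.
- by rewrite !mulr_ge0 ?powR_ge0 ?expR_ge0.
- by apply: k1; apply/andP; split; lra.
- apply: k2; [lra|lra|].
  rewrite (_ : (x - z) ^+ 2 = ((1 - x) - (1 - z)) ^+ 2); last by ring.
  rewrite (_ : 1 - m = 2^-1 * (1 - x) + 2^-1 * (1 - z)); last by rewrite /m; field.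
  by apply: h2; apply/andP; split; lra.
Qed.

(** This is where the order matters: when [v i - v j] and [z i - z j] have the same sign, their
    product is at most the square of their mean; for opposite signs the mean may vanish. *)
Lemma pair_wt_mid beta n v z : 0 <= beta ->
  (forall i j : 'I_n, (v i < v j) = (z i < z j)) ->
  pair_wt beta n v * pair_wt beta n z <=
  pair_wt beta n (fun i => 2^-1 * v i + 2^-1 * z i) ^+ 2.
Proof.
move=> beta0 vz; rewrite /pair_wt expr2 -!big_split/=.
apply: ler_prod => i _; rewrite -!big_split/=; apply/andP; split.
  by apply: prodr_ge0 => j _; rewrite mulr_ge0 ?powR_ge0.
apply: ler_prod => j _; rewrite mulr_ge0 ?powR_ge0//= -!powRM//.
rewrite ge0_ler_powR ?nnegrE ?mulr_ge0// -!normrM.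
have h : 0 <= (v i - v j) * (z i - z j).
  have [vij|vji|vij] := ltgtP (v i) (v j); last by rewrite vij subrr mul0r.
    by rewrite nmulr_rge0 ?subr_lt0// subr_le0 ltW// -vz.
  by rewrite pmulr_rge0 ?subr_gt0// subr_ge0 ltW// -vz.
rewrite !ger0_norm//; last by rewrite -expr2 sqr_ge0.
have := sqr_ge0 ((v i - v j) - (z i - z j)); nra.
Qed.

(** The two midpoint bounds control the product of the weights of [v] and [z], and this product is
    at least the square of the weight of [v]. Taking the square root halves the constant 1/4 of
    [point_wt_mid] to 1/8. *)
Lemma jacobi_dens_mid beta n a b v z : 0 < beta ->
  0 <= a - e_beta beta n -> 0 <= b - e_beta beta n ->
  (forall i j : 'I_n, (v i < v j) = (z i < z j)) ->
  jacobi_dens beta n a b v != 0 ->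
  jacobi_dens beta n a b v <= jacobi_dens beta n a b z ->
  jacobi_dens beta n a b v * expR ((a + b - 2 * e_beta beta n) / 8 *
     \sum_(i < n) (v i - z i) ^+ 2) <=
  jacobi_dens beta n a b (fun i => 2^-1 * v i + 2^-1 * z i).
Proof.
move=> beta0 A0 B0 vz wv wvz.
have wv0 : 0 < jacobi_dens beta n a b v by rewrite lt_neqAle eq_sym wv jacobi_dens_ge0.
have wz : jacobi_dens beta n a b z != 0 by rewrite gt_eqF// (lt_le_trans wv0).
have [v01 _] := jacobi_dens_neq0 _ _ _ _ _ beta0 wv.
have [z01 _] := jacobi_dens_neq0 _ _ _ _ _ beta0 wz.
rewrite -(@ler_pXn2r _ 2)//; last 2 first.
- by rewrite nnegrE mulr_ge0 ?expR_ge0// jacobi_dens_ge0.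
- by rewrite nnegrE jacobi_dens_ge0.
set A := a - e_beta beta n in A0 *; set B := b - e_beta beta n in B0 *.
pose S := \sum_(i < n) (v i - z i) ^+ 2.
apply: (@le_trans _ _ (jacobi_dens beta n a b v * jacobi_dens beta n a b z *
   expR ((A + B) / 4 * S))).
  rewrite exprMn -expRM_natl expr2 (_ : 2 * _ = (A + B) / 4 * S); last first.
    by rewrite /A /B /S; field.
  by rewrite ler_wpM2r ?expR_ge0// ler_wpM2l// ltW.
rewrite !jacobi_densE -/A -/B exprMn.
set Pv := pair_wt _ _ v; set Pz := pair_wt _ _ z.
set Wv := \prod_(i < n) point_wt A B (v i); set Wz := \prod_(i < n) point_wt A B (z i).
rewrite (_ : Pv * Wv * _ * _ = (Pv * Pz) * (Wv * Wz * expR ((A + B) / 4 * S))); last by ring.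
apply: ler_pM.
- by rewrite mulr_ge0 ?pair_wt_ge0.
- by rewrite !mulr_ge0 ?expR_ge0 ?prodr_ge0// => i _; exact: point_wt_ge0.
- by apply: pair_wt_mid => //; exact: ltW.
rewrite mulr_sumr expR_sum -!big_split/= -prodrXl; apply: ler_prod => i _.
by rewrite !mulr_ge0 ?expR_ge0 ?point_wt_ge0//= point_wt_mid.
Qed.

(** With distinct coordinates the ranks are injective; [p] sends [i] to the index that has in [z]
    the rank of [i] in [v]. *)
Lemma same_order_perm n v z : (forall i j : 'I_n, i != j -> v i != v j) ->
  (forall i j : 'I_n, i != j -> z i != z j) ->
  exists p : {perm 'I_n}, forall i j : 'I_n, (v i < v j) = (z (p i) < z (p j)).
Proof.
pose below (u : nat -> R) (i : 'I_n) := [pred j : 'I_n | u j < u i].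
have rk_lt u (i : 'I_n) : (#|below u i| < n)%N.
  rewrite -[X in (_ < X)%N]card_ord; apply: proper_card.
  by apply/properP; split; [exact/fintype.subsetP|exists i; rewrite ?inE// ltxx].
pose rk u i : 'I_n := Ordinal (rk_lt u i).
have rkE u (i j : 'I_n) : (rk u i < rk u j)%N = (u i < u j).
  have [uij|uji] := ltP (u i) (u j).
    apply/esym; rewrite /=; apply/esym; apply: proper_card; apply/properP; split.
      by apply/fintype.subsetP => k; rewrite !inE => /lt_trans; exact.
    by exists i; rewrite !inE ?ltxx.
  apply/negbTE; rewrite -leqNgt; apply: subset_leq_card.
  by apply/fintype.subsetP => k; rewrite !inE => /lt_le_trans; exact.
have rk_inj (u : nat -> R) : (forall i j : 'I_n, i != j -> u i != u j) -> injective (rk u).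
  move=> ut i j ij; apply/eqP; apply: contraT => /ut; rewrite neq_lt -!rkE ij.
  by rewrite ltnn.
move=> vt zt; exists (perm (rk_inj v vt) * (perm (rk_inj z zt))^-1)%g => i j.
rewrite !permM -!rkE; congr (_ < _)%N.
  by rewrite -[in RHS](permE (rk_inj z zt)) permKV permE.
by rewrite -[in RHS](permE (rk_inj z zt)) permKV permE.
Qed.

End jacobi_weight.

(** * Existence and stationarity of a maximiser *)

Section maximizer.
Context {R : realType}.
Implicit Types (v y : nat -> R).

Lemma continuous_norm_powR (p : R) : 0 < p -> continuous (fun t : R => `|t| `^ p).
Proof.
move=> p0 t; have [->|t0] := eqVneq t 0.
  rewrite /continuous_at normr0 powR0 ?gt_eqF//.
  apply/cvgr0Pnorm_lt => e e0.
  have e1 : 0 < e `^ p^-1 by rewrite powR_gt0.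
  have := @nbhsx_ballx R R 0 _ e1; apply: filterS => s.
  rewrite /ball/= sub0r normrN => se; rewrite ger0_norm ?powR_ge0//.
  rewrite -[ltRHS](@powRr1 _ e (ltW e0)) -(mulVf (lt0r_neq0 p0)) powRrM.
  by apply: gt0_ltr_powR => //; rewrite ?nnegrE ?powR_ge0.
have t1 : 0 < `|t| by rewrite normr_gt0.
apply: (@continuous_comp _ _ _ (fun t : R => `|t|) (fun x : R => x `^ p)).
  exact: norm_continuous.
apply/differentiable_continuous/derivable1_diffP.
by apply: derivable_powR; rewrite in_itv/= t1.
Qed.

Lemma continuous_prod (T : topologicalType) (I : Type) (r : seq I) (P : pred I)
    (F : I -> T -> R) : (forall i, continuous (F i)) ->
  continuous (fun u => \prod_(i <- r | P i) F i u).
Proof.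
move=> cF; elim: r => [|i r IH] u.
  rewrite /continuous_at big_nil.
  by under eq_fun do rewrite big_nil; exact: cvg_cst.
rewrite /continuous_at big_cons; under eq_fun do rewrite big_cons.
case: (P i) => //; last exact: IH.
by apply: cvgM; [exact: cF|exact: IH].
Qed.

Lemma jacobi_dens_gt0 beta n a b v : (forall i : 'I_n, 0 < v i < 1) ->
  (forall i j : 'I_n, i != j -> v i != v j) -> 0 < jacobi_dens beta n a b v.
Proof.
move=> v01 vt; rewrite jacobi_densE mulr_gt0//; apply: prodr_gt0 => i _.
  apply: prodr_gt0 => j ij; rewrite powR_gt0// normr_gt0 subr_eq0 vt//.
  by apply/eqP => ji; rewrite ji ltnn in ij.
have /andP[v0 v1] := v01 i.
by rewrite /point_wt v0 v1/= mulr_gt0 ?powR_gt0// subr_gt0.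
Qed.

Lemma jacobi_dens_max beta n a b : 0 < beta ->
  0 < a - e_beta beta n -> 0 < b - e_beta beta n ->
  exists2 y, 0 < jacobi_dens beta n a b y &
    forall v, jacobi_dens beta n a b v <= jacobi_dens beta n a b y.
Proof.
move=> beta0; set A := a - _; set B := b - _ => A0 B0.
(* [W] is continuous on the whole space and agrees with the density on the open cube; absolute
   values replace the case distinction. *)
pose W (u : 'rV[R]_n) : R :=
  (\prod_(i < n) \prod_(j < n | (i < j)%N) `|u ord0 i - u ord0 j| `^ beta) *
  \prod_(i < n) (`|u ord0 i| `^ A * `|1 - u ord0 i| `^ B).
have ccoord i : continuous (fun u : 'rV[R]_n => u ord0 i) by exact: coord_continuous.
have c1 : continuous (fun u : 'rV[R]_n =>
    \prod_(i < n) \prod_(j < n | (i < j)%N) `|u ord0 i - u ord0 j| `^ beta).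
  apply: continuous_prod => i; apply: continuous_prod => j u.
  apply: (@continuous_comp _ _ _ (fun u : 'rV[R]_n => u ord0 i - u ord0 j)
    (fun t : R => `|t| `^ beta)); last exact: continuous_norm_powR.
  exact: (@cvgB _ _ _ (nbhs u) (nbhs_filter u) _ _ _ _ (ccoord i u) (ccoord j u)).
have cA i : continuous (fun u : 'rV[R]_n => `|u ord0 i| `^ A).
  move=> u; apply: (@continuous_comp _ _ _ (fun u : 'rV[R]_n => u ord0 i)
      (fun t : R => `|t| `^ A)); [exact: ccoord|exact: continuous_norm_powR].
have cB i : continuous (fun u : 'rV[R]_n => `|1 - u ord0 i| `^ B).
  move=> u; apply: (@continuous_comp _ _ _ (fun u : 'rV[R]_n => 1 - u ord0 i)
      (fun t : R => `|t| `^ B)); last exact: continuous_norm_powR.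
  by apply: (@cvgB _ _ _ (nbhs u) (nbhs_filter u)); [exact: cvg_cst|exact: ccoord].
have c2 : continuous (fun u : 'rV[R]_n =>
    \prod_(i < n) (`|u ord0 i| `^ A * `|1 - u ord0 i| `^ B)).
  apply: continuous_prod => i u.
  by apply: (@cvgM _ _ (nbhs u) (nbhs_filter u)); [exact: cA|exact: cB].
have cW : continuous W.
  by move=> u; apply: (@cvgM _ _ (nbhs u) (nbhs_filter u)); [exact: c1|exact: c2].
have WE v : (forall i : 'I_n, 0 < v i < 1) ->
    W (\row_i v i) = jacobi_dens beta n a b v.
  move=> v01; rewrite jacobi_densE /W; congr (_ * _); apply: eq_bigr => i _.
    by apply: eq_bigr => j _; rewrite !mxE.
  have /andP[v0 v1] := v01 i; rewrite !mxE /point_wt v0 v1/=.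
  by rewrite !ger0_norm ?ltW// subr_gt0.
pose cube := [set u : 'rV[R]_n | forall i, `[0, 1]%classic (u ord0 i)].
have ccube : compact cube.
  exact: (@rV_compact R n (fun=> `[0, 1]%classic) (fun=> @segment_compact R 0 1)).
(* An interior point with distinct coordinates makes the maximum of [W] positive, and so keeps it
   off the boundary of the cube, where [W] vanishes. *)
pose v0 (i : nat) : R := i.+1%:R / n.+1%:R.
have n1 : (0 : R) < n.+1%:R by [].
have v001 (i : 'I_n) : 0 < v0 i < 1.
  by rewrite divr_gt0//= ltr_pdivrMr// mul1r ltr_nat ltnS ltn_ord.
have v0t (i j : 'I_n) : i != j -> v0 i != v0 j.
  apply: contra => /eqP /(mulIf _) => /(_ (invr_neq0 (lt0r_neq0 n1))) /eqP.
  by rewrite eqr_nat eqSS => /eqP /val_inj ->.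
have cube0 : cube !=set0.
  exists (\row_i v0 i) => i /=; rewrite mxE in_itv/=.
  by have /andP[h1 h2] := v001 i; rewrite !ltW.
have [c /set_mem cc cM] := EVT_max_rV cube0 ccube (continuous_subspaceT cW).
have Wc0 : 0 < W c.
  apply: lt_le_trans (cM (\row_i v0 i) _); first by rewrite WE// jacobi_dens_gt0.
  apply/mem_set => i /=; rewrite mxE in_itv/=.
  by have /andP[h1 h2] := v001 i; rewrite !ltW.
have c01 (i : 'I_n) : 0 < c ord0 i < 1.
  have := cc i; rewrite /= in_itv/= => /andP[cge cle].
  move: Wc0; rewrite lt_neqAle eq_sym => /andP[+ _].
  rewrite /W mulf_eq0 negb_or => /andP[_ /prodf_neq0 /(_ i isT)].
  rewrite mulf_eq0 !powR_eq0 (gt_eqF A0) (gt_eqF B0) /= !andbT !normr_eq0 negb_or subr_eq0 => /andP[h1 h2].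
  by rewrite !lt_neqAle cge cle eq_sym h1 eq_sym h2.
pose y := emb (fun i => c ord0 i).
have yE (i : 'I_n) : y i = c ord0 i by rewrite /y emb_ord.
have y01 (i : 'I_n) : 0 < y i < 1 by rewrite yE.
have Wy : W c = jacobi_dens beta n a b y.
  by rewrite -WE//; congr W; apply/rowP => i; rewrite mxE yE.
exists y; first by rewrite -Wy.
move=> v; rewrite -Wy.
have [->|vn0] := eqVneq (jacobi_dens beta n a b v) 0; first exact: ltW.
have [v01 _] := jacobi_dens_neq0 _ _ _ _ _ beta0 vn0.
rewrite -WE//; apply: cM; apply/mem_set => i /=; rewrite mxE in_itv/=.
by have /andP[h1 h2] := v01 i; rewrite !ltW.
Qed.

(** From [ln (1 + u) >= u / (1 + u)], with a quadratic error. It serves twice: for stationarity and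
    for the Chernoff bound. *)
Lemma powR1D_ge (p u : R) : 0 <= p -> `|u| <= 2^-1 ->
  expR (p * (u - 2 * u ^+ 2)) <= (1 + u) `^ p.
Proof.
move=> p0; rewrite ler_norml => /andP[u1 u2].
have u0 : 0 < 1 + u by lra.
rewrite /powR gt_eqF// ler_expR ler_wpM2l//.
have h : ln (1 + (- u / (1 + u))) <= - u / (1 + u).
  apply: le_ln1Dx; rewrite ltr_pdivlMr//; lra.
have e1 : 1 + (- u / (1 + u)) = (1 + u)^-1 by field; rewrite gt_eqF.
rewrite e1 lnV ?posrE// in h.
have : u - 2 * u ^+ 2 <= u / (1 + u) by rewrite ler_pdivlMr//; nra.
rewrite mulNr in h; lra.
Qed.

(** The derivative at [y], in the direction [g], of the logarithm of the density. *)
Definition crit_sum (beta A B : R) n y (g : nat -> R) : R :=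
  beta * (\sum_(i < n) \sum_(j < n | (i < j)%N) (g i - g j) / (y i - y j)) +
  \sum_(i < n) g i * (A / y i - B / (1 - y i)).

(** No differentiation: for small [t] the density at [y + t g] is at least its value at [y] times
    [exp (t G - t^2 C)], with [G] the critical sum. Maximality gives [G <= t C]. *)
Let crit_sum_le0 beta n a b y g : 0 < beta ->
  0 <= a - e_beta beta n -> 0 <= b - e_beta beta n ->
  0 < jacobi_dens beta n a b y ->
  (forall v, jacobi_dens beta n a b v <= jacobi_dens beta n a b y) ->
  crit_sum beta (a - e_beta beta n) (b - e_beta beta n) n y g <= 0.
Proof.
move=> beta0; set A := a - _; set B := b - _ => A0 B0 wy ymax.
have [y01 yt] := jacobi_dens_neq0 _ _ _ _ _ beta0 (lt0r_neq0 wy).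
pose D (i j : 'I_n) : R := (g i - g j) / (y i - y j).
(* [D], [a1], [b1] are the relative variations of [y i - y j], [y i] and [1 - y i]. [K] bounds them
   all, so that [powR1D_ge] applies to each factor when [t * K <= 1/2]; [C] collects the quadratic
   errors. *)
pose a1 (i : 'I_n) := g i / y i; pose b1 (i : 'I_n) := - g i / (1 - y i).
pose K := 1 + (\sum_(i < n) \sum_(j < n | (i < j)%N) `|D i j| +
   \sum_(i < n) `|a1 i| + \sum_(i < n) `|b1 i|).
pose C := 2 * (beta * (\sum_(i < n) \sum_(j < n | (i < j)%N) D i j ^+ 2) +
   \sum_(i < n) (A * a1 i ^+ 2 + B * b1 i ^+ 2)).
have sD0 (i : 'I_n) : 0 <= \sum_(j < n | (i < j)%N) `|D i j| by exact: sumr_ge0.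
have S1 : 0 <= \sum_(i < n) \sum_(j < n | (i < j)%N) `|D i j| by exact: sumr_ge0.
have S2 : 0 <= \sum_(i < n) `|a1 i| by exact: sumr_ge0.
have S3 : 0 <= \sum_(i < n) `|b1 i| by exact: sumr_ge0.
have K0 : 0 < K by rewrite /K; lra.
have DK (i j : 'I_n) : (i < j)%N -> `|D i j| <= K.
  move=> ij; apply: (@le_trans _ _ (\sum_(i < n) \sum_(j < n | (i < j)%N) `|D i j|)); last by rewrite /K; lra.
  rewrite (bigD1 i)//= (bigD1 j)//= -addrA lerDl addr_ge0//; first exact: sumr_ge0.
  by apply: sumr_ge0 => k _.
have aK i : `|a1 i| <= K.
  apply: (@le_trans _ _ (\sum_(i < n) `|a1 i|)); last by rewrite /K; lra.
  by rewrite (bigD1 i)//= lerDl sumr_ge0.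
have bK i : `|b1 i| <= K.
  apply: (@le_trans _ _ (\sum_(i < n) `|b1 i|)); last by rewrite /K; lra.
  by rewrite (bigD1 i)//= lerDl sumr_ge0.
have C0 : 0 <= C.
  rewrite /C mulr_ge0// addr_ge0//.
    rewrite mulr_ge0 ?(ltW beta0)//; apply: sumr_ge0 => i _; apply: sumr_ge0 => j _.
    exact: sqr_ge0.
  by apply: sumr_ge0 => i _; rewrite addr_ge0// mulr_ge0// sqr_ge0.
set G := crit_sum _ _ _ _ _ _.
have GE : G = beta * (\sum_(i < n) \sum_(j < n | (i < j)%N) D i j) +
   \sum_(i < n) (A * a1 i + B * b1 i).
  rewrite /G /crit_sum; congr (_ + _); apply: eq_bigr => i _.
  by rewrite /a1 /b1; ring.
have key t : 0 < t -> t * K <= 2^-1 -> t * G <= t ^+ 2 * C.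
  move=> t0 tK.
  have small u : `|u| <= K -> `|t * u| <= 2^-1.
    move=> uK; by rewrite normrM (gtr0_norm t0) (le_trans _ tK)// ler_wpM2l// ltW.
  have := ymax (fun i => y i + t * g i).
  suff low : jacobi_dens beta n a b y * expR (t * G - t ^+ 2 * C) <=
      jacobi_dens beta n a b (fun i => y i + t * g i).
    move=> up; have : expR (t * G - t ^+ 2 * C) <= 1.
      by rewrite -(ler_pM2l wy) mulr1 (le_trans low).
    by rewrite -[X in _ <= X]expR0 ler_expR; lra.
  have -> : t * G - t ^+ 2 * C =
      \sum_(i < n) \sum_(j < n | (i < j)%N) beta * (t * D i j - 2 * (t * D i j) ^+ 2) +
      \sum_(i < n) (A * (t * a1 i - 2 * (t * a1 i) ^+ 2) + B * (t * b1 i - 2 * (t * b1 i) ^+ 2)).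
    have -> : \sum_(i < n) \sum_(j < n | (i < j)%N) beta * (t * D i j - 2 * (t * D i j) ^+ 2) =
       beta * t * (\sum_(i < n) \sum_(j < n | (i < j)%N) D i j) - 2 * beta * t ^+ 2 *
        (\sum_(i < n) \sum_(j < n | (i < j)%N) D i j ^+ 2).
      rewrite !mulr_sumr -sumrB; apply: eq_bigr => i _.
      by rewrite !mulr_sumr -sumrB; apply: eq_bigr => j _; ring.
    have -> : \sum_(i < n) (A * (t * a1 i - 2 * (t * a1 i) ^+ 2) + B * (t * b1 i - 2 * (t * b1 i) ^+ 2)) =
       t * (\sum_(i < n) (A * a1 i + B * b1 i)) - 2 * t ^+ 2 *
        (\sum_(i < n) (A * a1 i ^+ 2 + B * b1 i ^+ 2)).
      by rewrite !mulr_sumr -sumrB; apply: eq_bigr => i _; ring.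
    by rewrite GE /C; ring.
  rewrite expRD !jacobi_densE mulrACA; apply: ler_pM.
  - by rewrite mulr_ge0 ?expR_ge0// pair_wt_ge0.
  - by rewrite mulr_ge0 ?expR_ge0// prodr_ge0// => i _; exact: point_wt_ge0.
  - rewrite expR_sum -big_split/=; apply: ler_prod => i _.
    rewrite expR_sum -big_split/=; apply/andP; split.
      by apply: prodr_ge0 => j _; rewrite mulr_ge0 ?expR_ge0 ?powR_ge0.
    apply: ler_prod => j ij; rewrite mulr_ge0 ?expR_ge0 ?powR_ge0//=.
    have yij : y i - y j != 0.
      rewrite subr_eq0 yt//; by apply/eqP => ji; rewrite ji ltnn in ij.
    have tD := small _ (DK _ _ ij).
    have -> : y i + t * g i - (y j + t * g j) = (y i - y j) * (1 + t * D i j).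
      by rewrite /D; field.
    have pos : 0 <= 1 + t * D i j by move: tD; rewrite ler_norml => /andP[]; lra.
    rewrite normrM (ger0_norm pos) powRM// ler_wpM2l ?powR_ge0//.
    exact: powR1D_ge (ltW beta0) tD.
  - rewrite expR_sum -big_split/=; apply: ler_prod => i _.
    rewrite mulr_ge0 ?expR_ge0 ?point_wt_ge0//=.
    have /andP[y0 y1] := y01 i; rewrite /point_wt y0 y1/=.
    have ta := small _ (aK i); have tb := small _ (bK i).
    have pa : 0 < 1 + t * a1 i by move: ta; rewrite ler_norml => /andP[]; lra.
    have pb : 0 < 1 + t * b1 i by move: tb; rewrite ler_norml => /andP[]; lra.
    have e1 : y i + t * g i = y i * (1 + t * a1 i).
      by rewrite /a1; field; rewrite gt_eqF.
    have y1' : 0 < 1 - y i by rewrite subr_gt0.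
    have e2 : 1 - (y i + t * g i) = (1 - y i) * (1 + t * b1 i).
      by rewrite /b1; field; rewrite gt_eqF.
    have -> : (0 < y i + t * g i) && (y i + t * g i < 1).
      by rewrite e1 mulr_gt0//= -subr_gt0 -e1 e2 mulr_gt0.
    rewrite e2 e1 powRM ?(ltW y0) ?(ltW pa)// powRM ?(ltW y1') ?(ltW pb)// expRD.
    rewrite mulrACA; apply: ler_pM; rewrite ?mulr_ge0 ?powR_ge0 ?expR_ge0//.
      by rewrite ler_wpM2l ?powR_ge0// powR1D_ge.
    by rewrite ler_wpM2l ?powR_ge0// powR1D_ge.
rewrite leNgt; apply/negP => G0.
(* Small enough for [key], and for [t * C < G], which contradicts it. *)
pose t := Num.min (K^-1 / 2) (G / (2 * (C + 1))).
have C1 : 0 < 2 * (C + 1) by lra.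
have t0 : 0 < t by rewrite lt_min !divr_gt0// invr_gt0.
have tK : t * K <= 2^-1.
  by rewrite -ler_pdivlMr// mulrC ge_min lexx.
have tG : t * (2 * (C + 1)) <= G by rewrite -ler_pdivlMr// ge_min lexx orbT.
have := key t t0 tK; rewrite expr2 -mulrA ler_pM2l// => h.
nra.
Qed.

Lemma crit_sum_eq0 beta n a b y g : 0 < beta ->
  0 <= a - e_beta beta n -> 0 <= b - e_beta beta n ->
  0 < jacobi_dens beta n a b y ->
  (forall v, jacobi_dens beta n a b v <= jacobi_dens beta n a b y) ->
  crit_sum beta (a - e_beta beta n) (b - e_beta beta n) n y g = 0.
Proof.
move=> beta0 A0 B0 wy ymax; apply/eqP; rewrite eq_le crit_sum_le0//=.
set A := a - _; set B := b - _.
have N : crit_sum beta A B n y (fun i => - g i) = - crit_sum beta A B n y g.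
  rewrite /crit_sum opprD -mulrN -!sumrN; congr (_ * _ + _).
    apply: eq_bigr => i _; rewrite -sumrN; apply: eq_bigr => j _.
    by rewrite -opprD mulNr.
  by apply: eq_bigr => i _; rewrite mulNr.
by rewrite -oppr_le0 -N crit_sum_le0.
Qed.

End maximizer.

(** * The Dirichlet law: Gamma representation and Chernoff bound *)

Section dirichlet_density.
Context {R : realType}.

Definition dirT (n : nat) (v : rseq R) : rseq R :=
  fun i => if (i < n)%N then dir_full n v i else 0.

Lemma measurable_dir_full n i : measurable_fun setT (fun v : rseq R => dir_full n v i).
Proof.
rewrite /dir_full; case: (i < n.-1)%N; first exact: measurable_coord.
by apply: measurable_funB => //; apply: measurable_sum => j; exact: measurable_coord.
Qed.

Lemma measurable_dirT n : measurable_fun setT (dirT n).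
Proof.
apply: measurable_fun_rseq => i; rewrite /dirT; case: (i < n)%N => //.
exact: measurable_dir_full.
Qed.

Lemma dir_dens_ge0 bp n (v : nat -> R) : 0 <= dir_dens bp n v.
Proof. by apply: prodr_ge0 => i _; case: ifP => // _; exact: powR_ge0. Qed.

Lemma measurable_dir_dens bp n : measurable_fun setT (dir_dens bp n : rseq R -> R).
Proof.
apply: measurable_prod => i _; apply: measurable_fun_ifT => //.
  by apply: measurable_fun_ltr => //; exact: measurable_dir_full.
by apply: (measurableT_comp (measurable_powR _)); exact: measurable_dir_full.
Qed.

End dirichlet_density.

Section dirichlet.
Context {R : realType}.
Local Notation mu := (@lebesgue_measure R).

Lemma le_integral_EFin (f g : R -> R) : measurable_fun setT f ->
  measurable_fun setT g -> (forall x, 0 <= f x <= g x) ->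
  (\int[mu]_x (f x)%:E <= \int[mu]_x (g x)%:E)%E.
Proof.
move=> mf mg fg.
have mf' : measurable_fun setT (fun x : R => (f x)%:E) by apply/measurable_EFinP.
have mg' : measurable_fun setT (fun x : R => (g x)%:E) by apply/measurable_EFinP.
apply: ge0_le_integral; [exact: measurableT| |exact: mf'|exact: mg'|].
  by move=> x _; rewrite lee_fin; have /andP[] := fg x.
by move=> x _; rewrite lee_fin; have /andP[] := fg x.
Qed.

Lemma integralZ_EFin (c : R) (f : R -> R) : 0 <= c -> measurable_fun setT f ->
  (forall x, 0 <= f x) ->
  (\int[mu]_x (c * f x)%:E = c%:E * \int[mu]_x (f x)%:E)%E.
Proof.
move=> c0 mf f0.
have mf' : measurable_fun setT (fun x : R => (f x)%:E) by apply/measurable_EFinP.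
rewrite -ge0_integralZl_EFin//; by move=> x _; rewrite lee_fin.
Qed.

(** The Gamma density of shape [p] and rate [c], without its constant. *)
Definition gamma_kernel (p c x : R) : R :=
  if 0 < x then x `^ (p - 1) * expR (- (c * x)) else 0.

Lemma gamma_kernel_ge0 p c x : 0 <= gamma_kernel p c x.
Proof. by rewrite /gamma_kernel; case: ifP => // _; rewrite mulr_ge0 ?powR_ge0 ?expR_ge0. Qed.

Lemma measurable_gamma_kernel p c : measurable_fun setT (gamma_kernel p c).
Proof.
apply: measurable_fun_ifT => //; first by apply: measurable_fun_ltr.
apply: measurable_funM; first exact: measurable_powR.
apply: measurableT_comp => //.
by apply: measurable_funN; apply: measurable_funM.
Qed.

Lemma gamma_kernel_scale p (c : R) : 0 < c ->
  (\int[mu]_x (gamma_kernel p 1 x)%:E =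
   (c `^ p)%:E * \int[mu]_x (gamma_kernel p c x)%:E)%E.
Proof.
move=> c0; rewrite (ge0_integral_affine c 0)//; last 2 first.
- by apply/measurable_EFinP; exact: measurable_gamma_kernel.
- by move=> x; rewrite lee_fin gamma_kernel_ge0.
have cE : c `^ p = c * c `^ (p - 1).
  rewrite -{2}(powRr1 (ltW c0)) -powRD; first by congr (_ `^ _); ring.
  by rewrite (gt_eqF c0) implybT.
rewrite cE EFinM -muleA; congr (_ * _)%E.
rewrite -ge0_integralZl//; last 3 first.
- by apply/measurable_EFinP; exact: measurable_gamma_kernel.
- by move=> x _; rewrite lee_fin gamma_kernel_ge0.
- by rewrite lee_fin powR_ge0.
apply: eq_integral => x _; rewrite -EFinM; congr EFin.
rewrite /gamma_kernel addr0 pmulr_rgt0//; case: ifPn => [x0|_]; last by rewrite mulr0.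
by rewrite powRM ?ltW// mul1r mulrA.
Qed.

(** Applied to the sum of all the variables, whose shape [m.+1%:R * bp] is at least 1 in large
    dimension even if [bp] is small; there is then no singularity at 0. *)
Lemma gamma_kernel_gt0_lty p : 1 <= p ->
  (0 < \int[mu]_x (gamma_kernel p 1 x)%:E < +oo)%E.
Proof.
move=> p1; apply/andP; split.
  have mI : measurable_fun setT (\1_(`[1, 2]%classic : set R) : R -> R).
    exact: measurable_indic.
  apply: (@lt_le_trans _ _ (\int[mu]_x ((expR (-2) * \1_(`[1, 2]%classic : set R) x)%:E))%E).
    rewrite integralZ_EFin ?expR_ge0// integral_indic//= setIT.
    have -> : mu (`[1, 2]%classic : set R) = 1%:E.
      by rewrite lebesgue_measure_itv/= lte_fin ltr1n -EFinB; congr EFin; ring.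
    by rewrite mule1 lte_fin expR_gt0.
  apply: le_integral_EFin; [exact: measurable_funM|exact: measurable_gamma_kernel|].
  move=> x; rewrite mulr_ge0 ?expR_ge0//= indicE; case: (boolP (x \in _)) => [|_]; last first.
    by rewrite mulr0 gamma_kernel_ge0.
  move/set_mem => /=; rewrite in_itv/= => /andP[x1 x2].
  have x0 : 0 < x by exact: lt_le_trans x1.
  rewrite mulr1 /gamma_kernel x0 mul1r.
  rewrite -[leLHS]mul1r ler_pM ?expR_ge0// ?ler_expR ?lerN2//.
  by rewrite -[leLHS](powRr0 x) ler_powR// subr_ge0.
pose N := (Num.truncn p).+1.
have pN : p - 1 <= N.+1%:R.
  have := truncnS_gt p; rewrite -/N -natr1 => h; lra.
(* With [y = x / 2], the power of [x] is at most 1 when [x <= 1] and at most [2 ^+ N.+1 * y ^+ N.+1]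
   otherwise; the factorial comes from the exponential series at [y]. *)
pose C : R := 1 + 2 ^+ N.+1 * (N.+1)`!%:R.
have C0 : 0 <= C by rewrite addr_ge0// mulr_ge0// exprn_ge0.
have bound x : gamma_kernel p 1 x <= C * 2 * exponential_pdf 2^-1 x.
  rewrite /gamma_kernel; case: ifPn => [x0|_]; last first.
    by rewrite !mulr_ge0// exponential_pdf_ge0.
  rewrite exponential_pdfE ?(ltW x0)// mul1r mulNr.
  set y := 2^-1 * x; have y0 : 0 <= y by rewrite mulr_ge0 ?ltW.
  have xE : x = 2 * y by rewrite /y; field.
  have -> : - x = - y + - y by rewrite xE; ring.
  have -> : C * 2 * (2^-1 * expR (- y)) = C * expR (- y) by field.
  suff h : x `^ (p - 1) <= C * expR y.
    have -> : C * expR (- y) = (C * expR y) * expR (- y + - y).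
      by rewrite -mulrA -expRD; congr (_ * expR _); ring.
    by apply: ler_wpM2r => //; exact: expR_ge0.
  have ey : 1 <= expR y by have := expR_ge1Dx y; lra.
  have eN : y ^+ N.+1 <= (N.+1)`!%:R * expR y.
    have := @expR_ge1Dxn R y N y0.
    by rewrite -ler_pdivrMl ?ltr0n ?fact_gt0// mulrC; lra.
  have [x1|x1] := leP x 1.
    apply: (@le_trans _ _ 1).
      have [->|pn1] := eqVneq p 1; first by rewrite subrr powRr0.
      rewrite -[leRHS](powRr0 x); apply: ger_powR; rewrite ?x0//.
      by rewrite subr_ge0.
    have : 0 <= 2 ^+ N.+1 * (N.+1)`!%:R * expR y.
      apply: mulr_ge0; last exact: expR_ge0.
      by apply: mulr_ge0; [exact: exprn_ge0|exact: ler0n].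
    by rewrite /C mulrDl mul1r; lra.
  apply: (@le_trans _ _ (x ^+ N.+1)).
    by rewrite -powR_mulrn ?(ltW x0)// ler_powR// ltW.
  rewrite xE exprMn /C mulrDl mul1r ler_wpDl ?expR_ge0//.
  by rewrite -mulrA ler_wpM2l ?exprn_ge0.
have me : measurable_fun setT (exponential_pdf (2^-1 : R)).
  exact: measurable_exponential_pdf.
have e0 x : 0 <= exponential_pdf (2^-1 : R) x by rewrite exponential_pdf_ge0.
apply: (@le_lt_trans _ _ (\int[mu]_x (C * 2 * exponential_pdf 2^-1 x)%:E)%E).
  apply: le_integral_EFin; [exact: measurable_gamma_kernel|exact: measurable_funM|].
  by move=> x; rewrite gamma_kernel_ge0 bound.
by rewrite integralZ_EFin ?mulr_ge0// integral_exponential_pdf ?invr_gt0// mule1 ltry.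
Qed.

(* A Dirichlet vector is a vector of independent Gamma variables divided by
   their sum [S]; [ind] is homogeneous of degree 0 and ignores [S]. *)
Lemma gamma_dirichlet bp m (ind : (nat -> R) -> R) :
  measurable_fun setT (ind : rseq R -> R) -> (forall g, 0 <= ind g) ->
  (forall (S : R) g, 0 < S -> ind (fun i => S * g i) = ind g) ->
  (forall g g' : nat -> R, (forall i, (i < m.+1)%N -> g i = g' i) -> ind g = ind g') ->
  iint m.+1 (fun g => (\prod_(i < m.+1) gamma_kernel bp 1 (g i) * ind g)%:E) =
  (\int[mu]_S (gamma_kernel (m.+1%:R * bp) 1 S)%:E *
   iint m (fun v => (dir_dens bp m.+1 v * ind (dir_full m.+1 v))%:E))%E.
Proof.
move=> mind ind0 indZ indE.
pose Phi (g : nat -> R) : R := \prod_(i < m.+1) gamma_kernel bp 1 (g i) * ind g.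
have Phi0 g : 0 <= Phi g.
  by rewrite mulr_ge0// prodr_ge0// => i _; exact: gamma_kernel_ge0.
have mPhi : measurable_fun setT (Phi : rseq R -> R).
  apply: measurable_funM => //; apply: measurable_prod => i _.
  exact: (measurableT_comp (measurable_gamma_kernel _ _) (measurable_coord i)).
(* The last variable becomes the total sum [x]: a translation for fixed [v], after which the
   integral over the sum is pulled outside. *)
pose sh (v : rseq R) (x : R) : rseq R := upd m (x - \sum_(j < m) v j) v.
have msh : measurable_fun setT (fun p : rseq R * R => sh p.1 p.2).
  apply: measurable_upd => //; apply: measurable_funB => //.
  apply: measurable_sum => j.
  exact: (measurableT_comp (measurable_coord j) (@measurable_fst _ _ _ _)).
have mPsh : measurable_fun setT (fun p : rseq R * R => (Phi (sh p.1 p.2))%:E).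
  by apply/measurable_EFinP; exact: (measurableT_comp mPhi msh).
rewrite iintS -(iint_integral_swap m (fun v x => (Phi (upd m x v))%:E)); last 2 first.
- apply/measurable_EFinP; apply: (measurableT_comp mPhi (g := fun p : rseq R * R => (upd m p.2 p.1 : rseq R))).
  exact: measurable_upd.
- by move=> v x; rewrite lee_fin.
transitivity (iint m (fun v => \int[mu]_x (Phi (sh v x))%:E)%E).
  apply: eq_iint => v.
  rewrite (ge0_integral_affine 1 (- \sum_(j < m) v j))//; last 2 first.
  - apply/measurable_EFinP; apply: (measurableT_comp mPhi (g := fun x : R => (upd m x v : rseq R))).
    exact: measurable_upd.
  - by move=> x; rewrite lee_fin.
  by rewrite mul1e; apply: eq_integral => x _; rewrite mul1r.
rewrite (iint_integral_swap m (fun v x => (Phi (sh v x))%:E))//; last first.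
  by move=> v x; rewrite lee_fin.
pose D := iint m (fun v => (dir_dens bp m.+1 v * ind (dir_full m.+1 v))%:E).
have D0 : (0 <= D)%E.
  by apply: iint_ge0 => v; rewrite lee_fin mulr_ge0// dir_dens_ge0.
have mdirI : measurable_fun setT (fun v : rseq R => ind (dir_full m.+1 v)).
  apply: (measurableT_comp mind (g := fun v : rseq R => dir_full m.+1 v : rseq R)).
  by apply: measurable_fun_rseq => i; exact: measurable_dir_full.
rewrite -/D muleC -ge0_integralZl//; last 2 first.
- by apply/measurable_EFinP; exact: measurable_gamma_kernel.
- by move=> x _; rewrite lee_fin gamma_kernel_ge0.
apply: eq_integral => S _; rewrite muleC.
have [S0|S0] := ltP 0 S; last first.
  rewrite [in RHS]/gamma_kernel ltNge S0/= mul0e -[RHS](iint0 m); apply: eq_iint => v.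
  congr EFin; rewrite /Phi.
  suff -> : \prod_(i < m.+1) gamma_kernel bp 1 (sh v S i) = 0 by rewrite mul0r.
  apply/eqP/negPn/negP => /prodf_neq0 h.
  have pos (i : 'I_m.+1) : 0 < sh v S i.
    by have := h i isT; rewrite /gamma_kernel; case: ifP => //; rewrite eqxx.
  have := pos ord_max; rewrite /sh /upd eqxx subr_gt0 => /lt_le_trans/(_ S0).
  rewrite ltNge sumr_ge0// => j _; apply/ltW.
  have := pos (widen_ord (leqnSn m) j); rewrite /sh /upd /= ltn_eqF//.
have S1 : S != 0 by rewrite gt_eqF.
(* Dividing the first [m] variables by the sum yields [S ^+ m]; together with [S] to the power
   [(m + 1) * (bp - 1)] from the kernels, the shape becomes [(m + 1) * bp]. *)
rewrite (iint_affine m S (fun=> 0))//; last 2 first.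
- apply/measurable_EFinP; apply: (measurableT_comp mPhi (g := fun v : rseq R => sh v S)).
  exact: (measurableT_comp msh (g := fun v => (v, S))).
- by move=> v; rewrite lee_fin.
have fE v : Phi (sh (fun i => S * v i + 0) S) =
    S `^ (m.+1%:R * (bp - 1)) * expR (- S) * (dir_dens bp m.+1 v * ind (dir_full m.+1 v)).
  have shE i : (i < m.+1)%N -> sh (fun i => S * v i + 0) S i = S * dir_full m.+1 v i.
    rewrite ltnS leq_eqVlt /sh /upd /dir_full /= => /orP[/eqP ->|im].
      rewrite eqxx ltnn mulrBr mulr1 mulr_sumr; congr (_ - _).
      by apply: eq_bigr => j _; rewrite addr0.
    by rewrite (ltn_eqF im) im addr0.
  rewrite /Phi (indE _ (fun i => S * dir_full m.+1 v i) shE) indZ// mulrA; congr (_ * _).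
  have sum1 : \sum_(i < m.+1) dir_full m.+1 v i = 1.
    rewrite big_ord_recr/= {2}/dir_full ltnn/= (eq_bigr (fun j : 'I_m => v j)); last first.
      by move=> j _; rewrite /dir_full /= ltn_ord.
    by rewrite addrC subrK.
  have -> : S `^ (m.+1%:R * (bp - 1)) * expR (- S) =
      \prod_(i < m.+1) (S `^ (bp - 1) * expR (- (S * dir_full m.+1 v i))).
    rewrite big_split/= prodr_const card_ord -expR_sum; congr (_ * expR _).
      by rewrite mulrC powRrM powR_mulrn ?powR_ge0.
    by rewrite sumrN -mulr_sumr sum1 mulr1.
  rewrite -big_split/=; apply: eq_bigr => i _.
  rewrite (shE _ (ltn_ord i)) /gamma_kernel pmulr_rgt0//; case: ifPn => [d0|_]; last by rewrite mulr0.
  by rewrite mul1r powRM ?ltW//; ring.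
rewrite [X in (_ * X)%E](_ : _ = iint m (fun v =>
    ((S `^ (m.+1%:R * (bp - 1)) * expR (- S))%:E *
     (dir_dens bp m.+1 v * ind (dir_full m.+1 v))%:E)%E)); last first.
  by apply: eq_iint => v; rewrite -EFinM -fE.
rewrite iintZl//; last 3 first.
- by apply/measurable_EFinP; apply: measurable_funM => //; exact: measurable_dir_dens.
- by move=> v; rewrite lee_fin mulr_ge0// dir_dens_ge0.
- by rewrite lee_fin mulr_ge0 ?powR_ge0 ?expR_ge0.
rewrite muleA -EFinM; congr (_%:E * _)%E.
rewrite /gamma_kernel S0 mul1r mulrA; congr (_ * _).
rewrite -powR_mulrn ?ltW// -powRD; last by rewrite S1 implybT.
by congr (S `^ _); rewrite -natr1; ring.
Qed.

(** The sign of the linear form is unchanged by scaling, so Gamma variables may replace the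
    Dirichlet vector. The exponential Markov inequality turns the rate 1 of the [i]-th variable into
    [1 - s * h i], which multiplies its integral by the power [- bp] of that rate. *)
Lemma dirichlet_chernoff bp m (h : nat -> R) (s : R) : 0 < bp ->
  1 <= m.+1%:R * bp -> 0 < s -> (forall i, (i < m.+1)%N -> `|s * h i| <= 2^-1) ->
  (iint m (fun v => (dir_dens bp m.+1 v *
      (0 < \sum_(i < m.+1) dir_full m.+1 v i * h i)%R%:R)%:E) <=
   (expR (bp * \sum_(i < m.+1) (s * h i + 2 * (s * h i) ^+ 2)))%:E *
     iint m (fun v => (dir_dens bp m.+1 v)%:E))%E.
Proof.
move=> bp0 nbp s0 hs.
pose ind (g : nat -> R) : R := (0 < \sum_(i < m.+1) g i * h i)%R%:R.
have mind : measurable_fun setT (ind : rseq R -> R).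
  apply: measurable_bool_natmul; apply: measurable_fun_ltr => //.
  by apply: measurable_sum => i; apply: measurable_funM => //; exact: measurable_coord.
have m1 : measurable_fun setT (fun _ : rseq R => 1 : R) by [].
have e1 := gamma_dirichlet bp m ind mind (fun=> ler0n _ _) _ _.
have e2 := gamma_dirichlet bp m (fun=> 1) m1 (fun=> ler01) (fun _ _ _ => erefl) (fun _ _ _ => erefl).
have /andP[K0 Koo] := gamma_kernel_gt0_lty _ nbp.
set K := (\int[mu]_S _)%E in e1 e2 K0 Koo.
have Kfin : K \is a fin_num by rewrite ge0_fin_numE// ltW.
(* Extended by 0 so that the rate is positive at every index, as [prodE] asks. *)
pose hh i := if (i < m.+1)%N then h i else 0.
have hhs i : `|s * hh i| <= 2^-1.
  by rewrite /hh; case: ifP => [/hs//|_]; rewrite mulr0 normr0.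
have c0 i : 0 < 1 - s * hh i by have := hhs i; rewrite ler_norml => /andP[]; lra.
have prodle : (iint m.+1 (fun g => (\prod_(i < m.+1) gamma_kernel bp 1 (g i) * ind g)%:E) <=
   iint m.+1 (fun g => (\prod_(i < m.+1) gamma_kernel bp (1 - s * hh i) (g i))%:E))%E.
  apply: le_iint.
  - apply/measurable_EFinP; apply: measurable_funM => //; apply: measurable_prod => i _.
    exact: (measurableT_comp (measurable_gamma_kernel _ _) (measurable_coord i)).
  - apply/measurable_EFinP; apply: measurable_prod => i _.
    exact: (measurableT_comp (measurable_gamma_kernel _ _) (measurable_coord i)).
  - by move=> g; rewrite lee_fin mulr_ge0 ?ler0n// prodr_ge0// => i _; exact: gamma_kernel_ge0.
  move=> g; rewrite lee_fin.
  have -> : \prod_(i < m.+1) gamma_kernel bp (1 - s * hh i) (g i) =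
      \prod_(i < m.+1) gamma_kernel bp 1 (g i) * expR (s * \sum_(i < m.+1) g i * h i).
    rewrite mulr_sumr expR_sum -big_split/=; apply: eq_bigr => i _.
    rewrite /gamma_kernel /hh ltn_ord; case: ifP => _; last by rewrite mul0r.
    by rewrite -mulrA -expRD; congr (_ * expR _); ring.
  apply: ler_wpM2l; first by apply: prodr_ge0 => i _; exact: gamma_kernel_ge0.
  rewrite /ind; case: ltP => [S0|_]; last exact: expR_ge0.
  by rewrite -[leLHS]expR0 ler_expR mulr_ge0 ?ltW.
have prodE (c : nat -> R) : (forall i, 0 < c i) ->
   iint m.+1 (fun g => (\prod_(i < m.+1) gamma_kernel bp (c i) (g i))%:E) =
   ((\prod_(i < m.+1) (c i `^ bp)^-1)%:E *
     iint m.+1 (fun g => (\prod_(i < m.+1) gamma_kernel bp 1 (g i))%:E))%E.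
  move=> cc; rewrite (iint_prod m.+1 (fun i => gamma_kernel bp (c i))); last 2 first.
  - by move=> i; exact: measurable_gamma_kernel.
  - by move=> i x; exact: gamma_kernel_ge0.
  rewrite (iint_prod m.+1 (fun i => gamma_kernel bp 1)); last 2 first.
  - by move=> i; exact: measurable_gamma_kernel.
  - by move=> i x; exact: gamma_kernel_ge0.
  rewrite -prodEFin -big_split/=; apply: eq_bigr => i _.
  rewrite (gamma_kernel_scale bp (c i))// muleA -EFinM mulVf ?mul1e//.
  by rewrite gt_eqF// powR_gt0.
(* [K], the Gamma integral of the total sum, is on both sides and cancels because it is positive and
   finite. *)
have KE : (K * iint m (fun v => (dir_dens bp m.+1 v * ind (dir_full m.+1 v))%:E) <=
  K * ((expR (bp * \sum_(i < m.+1) (s * h i + 2 * (s * h i) ^+ 2)))%:E *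
     iint m (fun v => (dir_dens bp m.+1 v)%:E)))%E.
  rewrite -e1; last 2 first.
  - move=> S g S0; rewrite /ind; congr ((nat_of_bool _)%:R).
    rewrite (eq_bigr (fun i : 'I_m.+1 => S * (g i * h i))); last by move=> i _; rewrite mulrA.
    by rewrite -mulr_sumr pmulr_rgt0.
  - move=> g g' gg; rewrite /ind; congr ((nat_of_bool (0 < _)%R)%:R).
    by apply: eq_bigr => i _; rewrite gg.
  apply: (le_trans prodle); rewrite (prodE (fun i => 1 - s * hh i))//.
  rewrite muleCA.
  have -> : iint m (fun v => (dir_dens bp m.+1 v)%:E) = iint m (fun v => (dir_dens bp m.+1 v * 1)%:E).
    by apply: eq_iint => v; rewrite mulr1.
  rewrite -e2 (eq_iint _ (fun g => (\prod_(i < m.+1) gamma_kernel bp 1 (g i) * 1)%:E)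
    (fun g => (\prod_(i < m.+1) gamma_kernel bp 1 (g i))%:E)); last by move=> g; rewrite mulr1.
  apply: lee_wpmul2r.
    by apply: iint_ge0 => g; rewrite lee_fin prodr_ge0// => i _; exact: gamma_kernel_ge0.
  rewrite lee_fin mulr_sumr expR_sum; apply: ler_prod => i _.
  rewrite invr_ge0 powR_ge0/= /hh ltn_ord -[leRHS]invrK lef_pV2 ?posrE ?invr_gt0 ?expR_gt0 ?powR_gt0//; last first.
    by have := c0 i; rewrite /hh ltn_ord.
  rewrite -expRN.
  have := powR1D_ge bp (- (s * h i)) (ltW bp0); rewrite normrN hs ?ltn_ord// => /(_ isT).
  by rewrite sqrrN; apply: le_trans; rewrite ler_expR; lra.
by rewrite -(lee_pmul2l Kfin K0).
Qed.

End dirichlet.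

(** * Weierstrass approximation by Bernstein polynomials *)

Section weierstrass.
Context {R : realType}.

(** Only [x] is confined to the segment; [y] may lie outside, as an eigenvalue near a bounded point
    does. *)
Lemma continuous_unif_segment (f : R -> R) (K e : R) : continuous f -> 0 < e ->
  exists2 h, 0 < h & forall x y, `|x| <= K -> `|x - y| < h -> `|f x - f y| < e.
Proof.
move=> cf e0.
have : \forall h \near 0^'+, forall x, `[(-K), K]%classic x ->
    forall y, `|x - y| < h -> `|f x - f y| < e.
  have /compact_near_coveringP cov := @segment_compact R (-K) K.
  apply: (cov _ (0 : R)^'+ (fun h x => forall y, `|x - y| < h -> `|f x - f y| < e)) => x xK.
  have e2 : 0 < e / 2 by rewrite divr_gt0.
  have /cvgrPdist_lt/(_ _ e2)/nbhs_ballP[r /= r0 fr] := cf x.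
  exists (ball x (r / 2), [set h | h < r / 2]) => /=.
    split; first by apply: nbhsx_ballx; rewrite divr_gt0.
    by apply: nbhs_right_lt; rewrite divr_gt0.
  move=> [u h] /= [xu hr] y uy.
  have h1 : `|f x - f u| < e / 2.
    by apply: fr; rewrite /ball/= (lt_trans xu)// ltr_pdivrMr// ltr_pMr// ltr1n.
  have h2 : `|f x - f y| < e / 2.
    apply: fr; rewrite /ball/= (_ : x - y = (x - u) + (u - y)); last by ring.
    by rewrite (splitr r) (le_lt_trans (ler_normD _ _))// ltrD// (lt_trans uy).
  rewrite (_ : f u - f y = (f x - f y) - (f x - f u)); last by ring.
  by rewrite (splitr e) (le_lt_trans (ler_normB _ _))// ltrD.
move=> H.
have [h [h0 hP]] : exists h, 0 < h /\ forall x, `[(-K), K]%classic x ->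
    forall y, `|x - y| < h -> `|f x - f y| < e.
  near (0 : R)^'+ => h; exists h; split; first by [].
  by near: h.
exists h => // x y xK; apply: hP => /=.
by rewrite in_itv/= -ler_norml.
Unshelve. all: by end_near. Qed.

(* Bernstein operator: [bern n h] at [x] is the expectation of [h] under the
   binomial law with parameters [n] and [x], here conditioned on one toss. *)
Fixpoint bern (n : nat) (h : nat -> R) : {poly R} :=
  if n is n'.+1 then 'X * bern n' (h \o succn) + (1 - 'X) * bern n' h
  else (h 0%N)%:P.

Lemma bern_cst n c (x : R) : (bern n (fun=> c)).[x] = c.
Proof.
elim: n => [|n IH] /=; first by rewrite hornerC.
have h : (bern n ((fun=> c) \o succn)).[x] = c by [].
by rewrite !hornerE /= h ?IH; ring.
Qed.

Lemma bernD n h g (x : R) :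
  (bern n (fun k => h k + g k)).[x] = (bern n h).[x] + (bern n g).[x].
Proof.
elim: n h g => [|n IH] h g /=; first by rewrite !hornerE.
have e1 : (bern n ((fun k => h k + g k) \o succn)).[x] =
  (bern n (h \o succn)).[x] + (bern n (g \o succn)).[x] by exact: IH.
rewrite !hornerE /= e1 (IH h g); ring.
Qed.

Lemma bernZ n c h (x : R) : (bern n (fun k => c * h k)).[x] = c * (bern n h).[x].
Proof.
elim: n h => [|n IH] h /=; first by rewrite !hornerE.
have e1 : (bern n ((fun k => c * h k) \o succn)).[x] =
  c * (bern n (h \o succn)).[x] by exact: IH.
rewrite !hornerE /= e1 (IH h); ring.
Qed.

Lemma bern_le n h g (x : R) : 0 <= x <= 1 -> (forall k, (k <= n)%N -> h k <= g k) ->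
  (bern n h).[x] <= (bern n g).[x].
Proof.
move=> /andP[x0 x1]; elim: n h g => [|n IH] h g hg /=.
  by rewrite !hornerE; exact: hg.
rewrite !hornerE; apply: lerD; apply: ler_wpM2l => //.
- by apply: IH => k kn; exact: hg.
- by rewrite subr_ge0.
- by apply: IH => k kn; apply: hg; exact: leqW.
Qed.

(** The centre is arbitrary because a successful toss moves it to [c - 1]; the case [c = n x] is the
    binomial variance. *)
Lemma bern_var n c (x : R) :
  (bern n (fun k => (k%:R - c) ^+ 2)).[x] = n%:R * x * (1 - x) + (n%:R * x - c) ^+ 2.
Proof.
elim: n c => [|n IH] c /=; first by rewrite !hornerE /=; ring.
have -> : (fun k => (k%:R - c) ^+ 2) \o succn = (fun k => (k%:R - (c - 1)) ^+ 2).
  by apply/funext => k /=; rewrite -natr1; ring.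
rewrite !hornerE /= (IH c) (IH (c - 1)) -natr1; ring.
Qed.

Lemma weierstrass01 (f : R -> R) (e : R) : continuous f -> 0 < e ->
  exists p : {poly R}, forall x, 0 <= x <= 1 -> `|f x - p.[x]| <= e.
Proof.
move=> cf e0.
have e2 : 0 < e / 2 by rewrite divr_gt0.
have [h h0 fh] := @continuous_unif_segment f 1 (e / 2) cf e2.
have [M M0 fM] : exists2 M, 0 < M & forall x, 0 <= x <= 1 -> `|f x| <= M.
  have cw : {within `[0, 1], continuous f} by exact: continuous_subspaceT.
  have [c _ cM] := EVT_max ler01 cw; have [c' _ cm] := EVT_min ler01 cw.
  exists (1 + (`|f c| + `|f c'|)) => [|x x01].
    by rewrite ltr_wpDr// addr_ge0.
  have x01' : x \in `[0, 1]%R by rewrite in_itv.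
  have := ler_norm (f c); have := ler_norm (- f c'); rewrite normrN.
  have := cM x x01'; have := cm x x01'; have := normr_ge0 (f c).
  have := normr_ge0 (f c'); rewrite ler_norml => *; apply/andP; split; lra.
(* Where [|x - z| >= h], the crude bound [2 M] is at most [C (x - z)^2]. The Bernstein operator
   turns this term into at most [C / n], and [n] is chosen to make that at most [e / 2]. *)
pose C := 2 * M / h ^+ 2.
have C0 : 0 <= C by rewrite divr_ge0 ?exprn_ge0 ?mulr_ge0 ?ltW.
pose n := (Num.truncn (C / (e / 2))).+1.
have n0 : (0 : R) < n%:R by rewrite ltr0n.
exists (bern n (fun k => f (k%:R / n%:R))) => x /andP[x0 x1].
have x01 : 0 <= x <= 1 by rewrite x0.
pose g k := e / 2 + C / n%:R ^+ 2 * (k%:R - n%:R * x) ^+ 2.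
have gE : (bern n g).[x] <= e.
  rewrite /g bernD bern_cst bernZ bern_var subrr expr0n/= addr0.
  rewrite [leRHS]splitr lerD2l.
  apply: (@le_trans _ _ (C / n%:R)).
    rewrite [leLHS](_ : _ = (C / n%:R) * (x * (1 - x))); last first.
      by field; rewrite gt_eqF.
    by apply: ler_piMr; [rewrite divr_ge0// ltW|nra].
  rewrite ler_pdivrMr// mulrC -ler_pdivrMr//.
  exact/ltW/truncnS_gt.
have fg k : (k <= n)%N -> `|f x - f (k%:R / n%:R)| <= g k.
  move=> kn; set z := k%:R / n%:R.
  have z01 : 0 <= z <= 1 by rewrite divr_ge0 ?(ltW n0)//= ler_pdivrMr// mul1r ler_nat.
  have zE : C / n%:R ^+ 2 * (k%:R - n%:R * x) ^+ 2 = C * (x - z) ^+ 2.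
    by rewrite /z; field; rewrite gt_eqF.
  rewrite /g zE.
  have [xz|xz] := ltP `|x - z| h.
    rewrite (le_trans (ltW (fh x z _ xz)))//; first by rewrite ger0_norm.
    by rewrite lerDl mulr_ge0 ?sqr_ge0.
  apply: (@le_trans _ _ (2 * M)).
    by rewrite (le_trans (ler_normB _ _))// mulr2n mulrDl mul1r lerD ?fM.
  rewrite ler_wpDl ?(ltW e2)// /C mulrAC ler_pdivlMr ?exprn_gt0//.
  rewrite ler_pM2l ?mulr_gt0//.
  by rewrite -[leRHS]real_normK ?num_real// lerXn2r ?nnegrE ?(ltW h0).
set B := (bern n _).[x].
have up : B <= f x + (bern n g).[x].
  rewrite -[X in _ <= X + _](bern_cst n (f x) x) -bernD; apply: bern_le => // k kn.
  by have := fg k kn; rewrite ler_norml => /andP[]; lra.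
have lo : f x <= B + (bern n g).[x].
  rewrite -[leLHS](bern_cst n (f x) x) -bernD; apply: bern_le => // k kn.
  by have := fg k kn; rewrite ler_norml => /andP[]; lra.
by rewrite ler_norml; apply/andP; split; lra.
Qed.

Lemma weierstrass (f : R -> R) (K e : R) : continuous f -> 0 < K -> 0 < e ->
  exists p : {poly R}, forall x, `|x| <= K -> `|f x - p.[x]| <= e.
Proof.
move=> cf K0 e0.
have [|p pf] := @weierstrass01 (fun t => f (2 * K * t - K)) e _ e0.
  move=> t; apply: (@continuous_comp _ _ _ (fun t => 2 * K * t - K)); last exact: cf.
  apply: cvgB; last exact: cvg_cst.
  by apply: cvgM; [exact: cvg_cst|exact: cvg_id].
exists (p \Po ((2 * K)^-1 *: ('X + K%:P))) => x.
rewrite ler_norml => /andP[x1 x2].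
have K2 : 0 < 2 * K by rewrite mulr_gt0.
rewrite horner_comp !hornerE.
set t := _ * _.
have -> : f x = f (2 * K * t - K).
  by congr f; rewrite /t; field; rewrite gt_eqF.
apply: pf; rewrite /t mulr_ge0 ?invr_ge0 ?(ltW K2)//=; last by rewrite -lerBlDr sub0r.
by rewrite mulrC ler_pdivrMr// mul1r; lra.
Qed.

End weierstrass.

(** * Chebyshev polynomials and the semicircle law *)

Section semicircle.
Context {R : realType}.
Local Notation mu := (@lebesgue_measure R).

(** Two consecutive terms are carried along to make the recursion structural. [chebU k] is the
    Chebyshev polynomial of the second kind at [x / 2]. *)
Fixpoint chebU2 (k : nat) : {poly R} * {poly R} :=
  if k is k'.+1 then let: (p, q) := chebU2 k' in (q, 'X * q - p) else (1, 'X).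
Definition chebU k := (chebU2 k).1.

Lemma chebU0 : chebU 0 = 1. Proof. by []. Qed.
Lemma chebU1 : chebU 1 = 'X. Proof. by []. Qed.
Lemma chebUSS k : chebU k.+2 = 'X * chebU k.+1 - chebU k.
Proof. by rewrite /chebU /=; case: (chebU2 k). Qed.

Lemma chebU_ind (P : nat -> Prop) :
  P 0%N -> P 1%N -> (forall k, P k -> P k.+1 -> P k.+2) -> forall k, P k.
Proof.
move=> P0 P1 PS k; suff : P k /\ P k.+1 by case.
by elim: k => [//|k [h1 h2]]; split => //; exact: PS.
Qed.

Lemma chebU_cos k (t : R) : (chebU k).[2 * cos t] * sin t = sin (k.+1%:R * t).
Proof.
elim/chebU_ind: k => [||k IH1 IH2].
- by rewrite chebU0 hornerC !mul1r.
- by rewrite chebU1 hornerX [in RHS]mulr_natl sin_mulr2n mulr2n; ring.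
rewrite chebUSS !hornerE /= mulrBl -mulrA IH2 IH1.
have -> : k.+3%:R * t = k.+2%:R * t + t by rewrite -natr1 mulrDl mul1r.
have -> : k.+1%:R * t = k.+2%:R * t - t by rewrite -[in RHS]natr1 mulrDl mul1r addrK.
rewrite sinB sinD; ring.
Qed.

Lemma derivable_oo_LRcontinuousT (F : R -> R) (a b : R) :
  (forall x, derivable F x 1) -> derivable_oo_LRcontinuous F a b.
Proof.
move=> dF.
have cF x : {for x, continuous F} by exact/differentiable_continuous/derivable1_diffP.
split => [x _//||]; first by apply: cvg_at_right_filter; exact: cF.
by apply: cvg_at_left_filter; exact: cF.
Qed.

Lemma continuous_sc_sqrt : continuous (fun x : R => Num.sqrt (4 - x ^+ 2) / (2 * pi)).
Proof.
move=> x; apply: cvgM; last exact: cvg_cst.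
apply: (@continuous_comp _ _ _ (fun x : R => 4 - x ^+ 2) Num.sqrt).
  by apply: cvgB; [exact: cvg_cst|exact: exprn_continuous].
exact: sqrt_continuous.
Qed.

Lemma integral_sc_sin (G : R -> R) : continuous G ->
  (\int[mu]_(x in `[(-2)%R, 2%R]) (G x * (Num.sqrt (4 - x ^+ 2) / (2 * pi)))%:E =
   \int[mu]_(t in `[0%R, pi]) (2 / pi * (G (2 * cos t) * sin t * sin t))%:E)%E.
Proof.
move=> cG.
pose F : R -> R := 2 *: (@cos R).
have dF t : is_derive t (1 : R) F (2 *: - sin t) by exact: is_deriveZ.
have F'E : (derive1 F) = (fun t => 2 *: - sin t).
  by apply/funext => t; rewrite derive1E derive_val.
have cF' : continuous (derive1 F).
  rewrite F'E => t; apply: (@cvgM _ _ _ _ (fun=> 2) (fun t => - sin t)).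
    exact: cvg_cst.
  by apply: cvgN; exact: continuous_sin.
have E1 : F pi = -2 by change (2 * cos pi = -2 :> R); rewrite cospi mulrN1.
have E2 : F 0 = 2 by change (2 * cos 0 = 2 :> R); rewrite cos0 mulr1.
have := @integration_by_substitution_decreasing R F
  (fun x => G x * (Num.sqrt (4 - x ^+ 2) / (2 * pi))) 0 pi (pi_ge0 R).
move=> subst; rewrite E1 E2 in subst; rewrite subst.
- apply: eq_integral => t /set_mem/=; rewrite in_itv/= => /andP[t0 tpi].
  congr EFin; rewrite F'E /F /=.
  change (G (2 * cos t) * (Num.sqrt (4 - (2 * cos t) ^+ 2) / (2 * pi)) * - (2 * - sin t) =
    2 / pi * (G (2 * cos t) * sin t * sin t)).
  have s0 : 0 <= sin t by apply: sin_ge0_pi; rewrite t0.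
  have -> : 4 - (2 * cos t) ^+ 2 = (2 * sin t) ^+ 2.
    by rewrite !exprMn sin2cos2; ring.
  rewrite sqrtr_sqr ger0_norm ?mulr_ge0//.
  by rewrite invfM; set q := pi^-1; field.
- move=> x y xI yI xy; change (2 * cos x < 2 * cos y); rewrite ltr_pM2l//.
  by rewrite ltr_cos.
- by move=> x _; exact: cF'.
- apply: cvgP; apply: cvg_at_right_filter; exact: cF'.
- apply: cvgP; apply: cvg_at_left_filter; exact: cF'.
- by apply: derivable_oo_LRcontinuousT => t; apply: ex_derive.
- apply: continuous_subspaceT => x; apply: cvgM; first exact: cG.
  exact: continuous_sc_sqrt.
Qed.

Definition SCint (f : R -> R) : R :=
  \int[mu]_(x in `[(-2), 2]) (f x * (Num.sqrt (4 - x ^+ 2) / (2 * pi))).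

(** The open and the closed interval differ at -2 and 2, where the square root vanishes. *)
Lemma SCintE (f : R -> R) : Rintegral mu setT (fun x => f x * sc_dens x) = SCint f.
Proof.
rewrite /SCint /Rintegral [in RHS]integral_mkcond; congr fine.
apply: eq_integral => x _; rewrite patchE /sc_dens mem_setE in_itv/=.
have [xl|xl] := ltP (-2) x; have [xr|xr] := ltP x 2 => /=; rewrite ?(ltW xl) ?(ltW xr)//.
- case: ifP => [x2|_]; last by rewrite mulr0.
  have -> : x = 2 by apply/eqP; rewrite eq_le xr andbT; case/andP: x2.
  by rewrite (_ : 4 - 2 ^+ 2 = 0) ?sqrtr0 ?mul0r//; ring.
- case: ifP => [/andP[x2 _]|_]; last by rewrite mulr0.
  have -> : x = -2 by apply/eqP; rewrite eq_le xl.
  by rewrite (_ : 4 - (-2) ^+ 2 = 0) ?sqrtr0 ?mul0r//; ring.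
- by exfalso; have := le_trans xr xl; lra.
Qed.

Let integrable_sc (f : R -> R) : continuous f ->
  mu.-integrable `[(-2), 2] (EFin \o (fun x => f x * (Num.sqrt (4 - x ^+ 2) / (2 * pi)))).
Proof.
move=> cf; apply: continuous_compact_integrable; first exact: segment_compact.
apply: continuous_subspaceT => x; apply: cvgM; first exact: cf.
exact: continuous_sc_sqrt.
Qed.

Lemma SCintD (f g : R -> R) : continuous f -> continuous g ->
  SCint (fun x => f x + g x) = SCint f + SCint g.
Proof.
move=> cf cg; rewrite /SCint -RintegralD//; try exact: integrable_sc.
by apply: eq_Rintegral => x _; rewrite mulrDl.
Qed.

Lemma SCintB (f g : R -> R) : continuous f -> continuous g ->
  SCint (fun x => f x - g x) = SCint f - SCint g.
Proof.
move=> cf cg; rewrite /SCint -RintegralB//; try exact: integrable_sc.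
by apply: eq_Rintegral => x _; rewrite mulrBl.
Qed.

Lemma SCintZ (c : R) (f : R -> R) : continuous f ->
  SCint (fun x => c * f x) = c * SCint f.
Proof.
move=> cf; rewrite /SCint -RintegralZl//; try exact: integrable_sc.
by apply: eq_Rintegral => x _; rewrite mulrA.
Qed.

Lemma le_SCint (f g : R -> R) : continuous f -> continuous g ->
  (forall x, -2 <= x <= 2 -> f x <= g x) -> SCint f <= SCint g.
Proof.
move=> cf cg fg; apply: le_Rintegral => //; try exact: integrable_sc.
move=> x /=; rewrite in_itv/= => /fg h.
by rewrite ler_wpM2r// divr_ge0 ?sqrtr_ge0// mulr_ge0// pi_ge0.
Qed.

Let sinm (m : R) : R -> R := (@sin R) \o (m *: (@id R)).

Let is_derive_sinm m (t : R) : is_derive t (1 : R) (sinm m) (m * cos (m * t)).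
Proof.
rewrite /sinm mulrC; have h : is_derive t (1 : R) (m *: (@id R)) m.
  by apply: is_derive_eq; rewrite /GRing.scale/= mulr1.
exact: is_derive1_comp.
Qed.

Let continuous_cosm m : continuous (fun t : R => cos (m * t)).
Proof.
move=> t; apply: (@continuous_comp _ _ _ ( *%R m) (@cos R)); last exact: continuous_cos.
exact: mulrl_continuous.
Qed.

(** With [x = 2 cos t] the integrand becomes a difference of [cos (k t)] and [cos ((k + 2) t)],
    whose primitives vanish at 0 and [pi], except for [k = 0], where the first is constant. *)
Lemma SCint_chebU k : SCint (fun x => (chebU k).[x]) = (k == 0%N)%:R.
Proof.
have cU : continuous (fun x => (chebU k).[x]) by exact: continuous_horner.
rewrite /SCint /Rintegral integral_sc_sin//.
pose f (t : R) : R := pi^-1 * (cos (k%:R * t) - cos (k.+2%:R * t)).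
transitivity (fine (\int[mu]_(t in `[0%R, pi]) (f t)%:E)).
  congr fine; apply: eq_integral => t _; congr EFin; rewrite chebU_cos /f.
  have -> : k%:R * t = k.+1%:R * t - t by rewrite -natr1 mulrDl mul1r addrK.
  have -> : k.+2%:R * t = k.+1%:R * t + t by rewrite -[in LHS]natr1 mulrDl mul1r.
  by rewrite cosB cosD; ring.
pose H : R -> R := pi^-1 *: ((if k == 0%N then @id R else k%:R^-1 *: sinm k%:R) -
  k.+2%:R^-1 *: sinm k.+2%:R).
have dS m t : m != 0 -> is_derive t (1 : R) (m^-1 *: sinm m) (cos (m * t)).
  move=> m0; have h : is_derive t (1 : R) (m^-1 *: sinm m) (m^-1 *: (m * cos (m * t))).
    by apply: is_deriveZ; exact: is_derive_sinm.
  by apply: (is_derive_eq h); rewrite /GRing.scale/= mulKf.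
have dH t : is_derive t (1 : R) H (f t).
  rewrite /f; apply: is_deriveZ; apply: is_deriveB.
    have [->|k0] := eqVneq k 0%N; first by rewrite mul0r cos0; exact: is_derive_id.
    by apply: dS; rewrite pnatr_eq0.
  by apply: dS; rewrite pnatr_eq0.
have cf : continuous f.
  move=> t; apply: cvgM; first exact: cvg_cst.
  by apply: cvgB; exact: continuous_cosm.
rewrite (@continuous_FTC2 R f H 0 pi)//; last 4 first.
- exact: pi_gt0.
- exact: continuous_subspaceT.
- by apply: derivable_oo_LRcontinuousT => t; apply: ex_derive.
- by move=> t _; rewrite derive1E derive_val.
have sinmpi m : sinm m%:R pi = 0.
  change (sin (m%:R * pi) = 0 :> R); elim: m => [|m IH]; first by rewrite mul0r sin0.
  by rewrite -natr1 mulrDl mul1r sinDpi IH oppr0.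
have sinm0 m : sinm m 0 = 0 by change (sin (m * 0) = 0 :> R); rewrite mulr0 sin0.
have HE t : H t = pi^-1 * ((if k == 0%N then t else k%:R^-1 * sinm k%:R t) - k.+2%:R^-1 * sinm k.+2%:R t).
  by rewrite /H; case: ifP.
rewrite /= !HE !sinmpi !sinm0 !mulr0 !subr0; case: ifP => _; last by rewrite mulr0 subr0.
by rewrite mulr0 subr0 mulVf// gt_eqF// pi_gt0.
Qed.

End semicircle.

(** * Moment functionals and the Catalan recursion *)

Section moment_functional.
Context {R : realType}.
Implicit Types (c d : nat -> R) (p : {poly R}).

(** The linear functional on polynomials with moment sequence [c]. *)
Definition polyL c p : R := \sum_(i < size p) p`_i * c i.

Lemma polyL_widen n c p : (size p <= n)%N -> polyL c p = \sum_(i < n) p`_i * c i.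
Proof.
move=> pn; rewrite /polyL (big_ord_widen n (fun i => p`_i * c i))// big_mkcond/=.
by apply: eq_bigr => i _; case: ltnP => // h; rewrite nth_default// mul0r.
Qed.

Lemma polyLD c p q : polyL c (p + q) = polyL c p + polyL c q.
Proof.
pose n := maxn (size p) (size q).
rewrite (@polyL_widen n _ (p + q)) ?size_polyD// (@polyL_widen n _ p) ?leq_maxl//.
rewrite (@polyL_widen n _ q) ?leq_maxr// -big_split/=.
by apply: eq_bigr => i _; rewrite coefD mulrDl.
Qed.

Lemma polyLN c p : polyL c (- p) = - polyL c p.
Proof. by rewrite /polyL size_polyN -sumrN; apply: eq_bigr => i _; rewrite coefN mulNr. Qed.

Lemma polyLXM c p : polyL c ('X * p) = polyL (c \o succn) p.
Proof.
rewrite (@polyL_widen (size p).+1).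
  rewrite big_ord_recl coefXM/= mul0r add0r; apply: eq_bigr => i _.
  by rewrite coefXM.
by rewrite mulrC (leq_trans (size_polyMleq _ _))// size_polyX addn2.
Qed.

Lemma polyLXn c k : polyL c 'X^k = c k.
Proof.
rewrite /polyL size_polyXn big_ord_recr/= coefXn eqxx mul1r big1 ?add0r// => i _.
by rewrite coefXn ltn_eqF// mul0r.
Qed.

Lemma polyL_seqD (a : R) c d p :
  polyL (fun k => a * c k + d k) p = a * polyL c p + polyL d p.
Proof.
rewrite /polyL mulr_sumr -big_split/=; apply: eq_bigr => i _; ring.
Qed.

(** The value of [c] in [x] and [d] in [y] on the divided difference [(x^k - y^k) / (x - y)]; this
    explains the shift by one and the value 0 at [k = 0]. *)
Definition conv c d k : R := \sum_(l < k) c l * d (k.-1 - l)%N.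

Lemma convS c d : conv c d \o succn =
  (fun k => c 0%N * d k + conv (c \o succn) d k).
Proof.
apply/funext => k; rewrite /= /conv big_ord_recl/= subn0; congr (_ + _).
by apply: eq_bigr => l _; rewrite /= /bump/= add1n -[k.-1]subn1 -subnDA add1n.
Qed.

Lemma polyL_chebUSS c k : polyL c (chebU k.+2) = polyL c ('X * chebU k.+1) - polyL c (chebU k).
Proof. by rewrite chebUSS polyLD polyLN. Qed.

Lemma polyL1 c : polyL c 1 = c 0%N. Proof. by rewrite -(polyLXn c 0) expr0. Qed.
Lemma polyLX c : polyL c 'X = c 1%N. Proof. by rewrite -(polyLXn c 1) expr1. Qed.

(* The divided difference of the Chebyshev polynomial U_k is the sum of the
   products U_l(x) U_(k-1-l)(y); this is its image under [polyL c] and [polyL d]. *)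
Lemma polyL_conv_chebU k c d : polyL (conv c d) (chebU k) =
  \sum_(l < k) polyL c (chebU l) * polyL d (chebU (k.-1 - l)).
Proof.
elim/chebU_ind: k c d => [||k IH0 IH1] c d.
- by rewrite chebU0 polyL1 /conv !big_ord0.
- by rewrite chebU1 polyLX /conv !big_ord1 !polyL1.
rewrite polyL_chebUSS polyLXM convS polyL_seqD IH1 IH0.
rewrite big_ord_recl [in RHS]big_ord_recl /= [X in _ = _ + X]big_ord_recl/= !subn0.
rewrite -polyLXM chebU0 mulr1 chebU1 polyL1 -addrA; congr (_ + _); rewrite -addrA; congr (_ + _).
  by rewrite /bump/= addn0 subSS subn0.
rewrite -sumrB; apply: eq_bigr => l _; rewrite /= /bump/= !add1n -polyLXM.
have -> : polyL c ('X * chebU l.+1) = polyL c (chebU l.+2) + polyL c (chebU l).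
  by rewrite polyL_chebUSS subrK.
rewrite subSS -[k.-1]subn1 -subnDA add1n mulrDl.
by rewrite addrK.
Qed.

Definition sc_moment k : R := SCint (fun x => x ^+ k).

Lemma SCint_sum (I : Type) (r : seq I) (F : I -> R -> R) :
  (forall i, continuous (F i)) ->
  SCint (fun x => \sum_(i <- r) F i x) = \sum_(i <- r) SCint (F i).
Proof.
move=> cF; have c0 : continuous (fun _ : R => 0 : R) by exact: cst_continuous.
elim: r => [|i r IH].
  rewrite big_nil -[RHS](mul0r (SCint (fun=> 0))) -SCintZ//; congr SCint.
  by apply/funext => x; rewrite big_nil mulr0.
rewrite big_cons -IH -SCintD//.
  by congr SCint; apply/funext => x; rewrite big_cons.
elim: r {IH} => [|j r IH] x.
  by rewrite /continuous_at big_nil; under eq_fun do rewrite big_nil; exact: cvg_cst.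
rewrite /continuous_at big_cons; under eq_fun do rewrite big_cons.
by apply: cvgD; [exact: cF|exact: IH].
Qed.

Lemma SCint_horner p : SCint (fun x => p.[x]) = polyL sc_moment p.
Proof.
have cX i : continuous (fun x : R => x ^+ i) by exact: exprn_continuous.
rewrite /polyL; transitivity (SCint (fun x => \sum_(i < size p) p`_i * x ^+ i)).
  by congr SCint; apply/funext => x; rewrite horner_coef.
rewrite SCint_sum.
  by apply: eq_bigr => i _; rewrite SCintZ.
by move=> i x; apply: cvgM; [exact: cvg_cst|exact: cX].
Qed.

Lemma sc_chebU k : polyL sc_moment (chebU k) = (k == 0%N)%:R.
Proof. by rewrite -SCint_horner SCint_chebU. Qed.

Lemma sc_moment0 : sc_moment 0 = 1.
Proof. by rewrite -polyL1 -chebU0 sc_chebU. Qed.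

(** Both sides are linear functionals and are compared on [chebU j], where orthogonality and
    [polyL_conv_chebU] show that each is 1 for [j = 1] and 0 otherwise. Powers follow by trading
    each factor ['X] against a shift of [j]. *)
Lemma sc_momentS k : sc_moment k.+1 = conv sc_moment sc_moment k.
Proof.
pose F p := polyL sc_moment ('X * p); pose F' p := polyL (conv sc_moment sc_moment) p.
have FU j : F (chebU j) = F' (chebU j).
  rewrite /F' polyL_conv_chebU; case: j => [|j].
    by rewrite big_ord0 /F chebU0 mulr1 -chebU1 sc_chebU.
  have -> : F (chebU j.+1) = polyL sc_moment (chebU j.+2) + polyL sc_moment (chebU j).
    by rewrite polyL_chebUSS subrK.
  rewrite !sc_chebU add0r big_ord_recl/= subn0 !sc_chebU/= mul1r.
  by rewrite big1 ?addr0// => l _; rewrite sc_chebU mul0r.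
have FD p q : F (p + q) = F p + F q by rewrite /F mulrDr polyLD.
have FXU i j : F ('X^i * chebU j) = F' ('X^i * chebU j).
  elim: i j => [|i IH] j; first by rewrite expr0 !mul1r.
  rewrite exprSr -mulrA; case: j => [|j]; first by rewrite chebU0 mulr1 -chebU1.
  have -> : 'X * chebU j.+1 = chebU j.+2 + chebU j :> {poly R}.
    by rewrite (chebUSS j) subrK.
  by rewrite mulrDr FD IH IH /F' polyLD.
by have := FXU k 0%N; rewrite chebU0 mulr1 /F /F' -exprS !polyLXn.
Qed.

Lemma sc_moment_le k : sc_moment k.*2 <= 4 ^+ k.
Proof.
have c1 : continuous (fun _ : R => 1 : R) by exact: cst_continuous.
have e := @SCintZ R (4 ^+ k) (fun=> 1) c1.
have -> : 4 ^+ k = SCint (fun _ : R => 4 ^+ k * 1 : R).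
  rewrite [RHS]e (_ : SCint _ = 1) ?mulr1//.
  exact: sc_moment0.
apply: le_SCint; first exact: exprn_continuous.
  exact: cst_continuous.
move=> x /andP[x1 x2]; rewrite mulr1 -muln2 mulnC exprM lerXn2r ?nnegrE ?sqr_ge0//.
nra.
Qed.

End moment_functional.

(** * Passing to the limit in the moment recursion *)

Section moment_limit.
Context {R : realType}.

Lemma cvgn_sum (I : Type) (r : seq I) (F : I -> nat -> R) (L : I -> R) :
  (forall i, F i n @[n --> \oo] --> L i) ->
  (\sum_(i <- r) F i n) @[n --> \oo] --> \sum_(i <- r) L i.
Proof.
move=> cF; elim: r => [|i r IH].
  by rewrite big_nil; under eq_fun do rewrite big_nil; exact: cvg_cst.
rewrite big_cons; under eq_fun do rewrite big_cons.
by apply: cvgD; [exact: cF|exact: IH].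
Qed.

(** The divided differences of the [k]-th power averaged over pairs of indices; the diagonal, which
    contributes derivatives, is taken out. *)
Definition loop_sum (m : nat -> R) (n k : nat) : R :=
  conv m m k - k%:R / n%:R * m k.-1.

(** Strong induction on [k]. The right-hand side still contains [m n k.+1], inside [loop_sum] at
    [k.+2], but with a coefficient tending to 0. Collected on the left it gives the factor [den n],
    which tends to 1; [S' n] is what is left of the convolution. *)
Lemma moments_cvg (m : nat -> nat -> R) (del kap r q : nat -> R) :
  del n @[n --> \oo] --> 0 -> kap n @[n --> \oo] --> (1 : R) ->
  r n @[n --> \oo] --> 0 -> q n @[n --> \oo] --> 0 ->
  (\forall n \near \oo, m n 0%N = 1 /\ forall k, m n k.+1 = del n * m n k +
     kap n * (loop_sum (m n) n k + r n * loop_sum (m n) n k.+1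
              - q n * loop_sum (m n) n k.+2)) ->
  forall k, m n k @[n --> \oo] --> sc_moment k.
Proof.
move=> cd ck cr cq mrec.
have invn j : (j%:R / n%:R : R) @[n --> \oo] --> 0.
  rewrite -[X in _ --> X](mulr0 j%:R); apply: cvgM; first exact: cvg_cst.
  by rewrite -cvg_shiftS; exact: cvg_harmonic.
have strong k : (forall j, (j <= k)%N -> m n j @[n --> \oo] --> sc_moment j).
  elim: k => [|k IH] j.
    rewrite leqn0 => /eqP ->; rewrite sc_moment0.
    by apply: cvg_near_cst; apply: filterS mrec => n [-> _].
  rewrite leq_eqVlt => /orP[/eqP->|]; last by rewrite ltnS; exact: IH.
  have cconv i : (i <= k.+1)%N -> conv (m n) (m n) i @[n --> \oo] --> conv sc_moment sc_moment i.
    move=> ik; rewrite /conv.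
    apply: (@cvgn_sum _ _ (fun (l : 'I_i) n => m n l * m n (i.-1 - l)%N)) => l.
    apply: cvgM; apply: IH; first by rewrite -ltnS (leq_trans (ltn_ord l)).
    by rewrite (leq_trans (leq_subr _ _))// -ltnS prednK// (leq_ltn_trans _ (ltn_ord l)).
  have cloop i : (i <= k.+1)%N -> loop_sum (m n) n i @[n --> \oo] --> conv sc_moment sc_moment i.
    move=> ik; rewrite -[X in _ --> X]subr0; apply: cvgB; first exact: cconv.
    rewrite -(mul0r (sc_moment i.-1)); apply: cvgM; first exact: invn.
    by apply: IH; rewrite -ltnS; case: i ik.
  pose S' n := \sum_(l < k) m n l.+1 * m n (k - l)%N.
  have cS' : S' n @[n --> \oo] --> \sum_(l < k) sc_moment l.+1 * sc_moment (k - l)%N.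
    apply: (@cvgn_sum _ _ (fun (l : 'I_k) n => m n l.+1 * m n (k - l)%N)) => l.
    by apply: cvgM; apply: IH; [exact: ltn_ord|exact: leq_subr].
  pose num n := del n * m n k + kap n * (loop_sum (m n) n k
     + r n * loop_sum (m n) n k.+1 - q n * S' n).
  pose den n := 1 + q n * kap n * (2 - k.+2%:R / n%:R).
  have cnum : num n @[n --> \oo] --> conv sc_moment sc_moment k.
    have -> : conv sc_moment sc_moment k = (0 : R) * sc_moment k + 1 * (conv sc_moment sc_moment k
       + 0 * conv sc_moment sc_moment k.+1 - 0 * \sum_(l < k) sc_moment l.+1 * sc_moment (k - l)%N).
      by ring.
    apply: cvgD; first by apply: cvgM => //; exact: IH.
    apply: cvgM => //; apply: cvgB; last exact: cvgM.
    by apply: cvgD; [apply: cloop; exact: leqnSn|apply: cvgM => //; exact: cloop].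
  have cden : den n @[n --> \oo] --> (1 : R).
    have -> : (1 : R) = 1 + 0 * 1 * (2 - 0) by ring.
    apply: cvgD; first exact: cvg_cst.
    apply: cvgM; first exact: cvgM.
    by apply: cvgB; [exact: cvg_cst|exact: invn].
  have cq' : num n / den n @[n --> \oo] --> sc_moment k.+1.
    rewrite sc_momentS -[X in _ --> X](divr1 (conv _ _ k)); apply: cvgM => //.
    by apply: cvgV => //; exact: oner_neq0.
  have dpos : \forall n \near \oo, 0 < den n.
    have /cvgrPdist_lt/(_ 1 ltr01) := cden; apply: filterS => n.
    by rewrite ltr_norml => /andP[_]; lra.
  apply: cvg_trans cq'; apply: near_eq_cvg; near=> n.
  have den0 : 0 < den n by near: n; exact: dpos.
  have [m0 rec] : m n 0%N = 1 /\ forall k, m n k.+1 = del n * m n k +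
     kap n * (loop_sum (m n) n k + r n * loop_sum (m n) n k.+1
              - q n * loop_sum (m n) n k.+2) by near: n; exact: mrec.
  have SE : loop_sum (m n) n k.+2 = 2 * m n k.+1 + S' n - k.+2%:R / n%:R * m n k.+1.
    rewrite /loop_sum /conv big_ord_recr big_ord_recl/= subn0 subnn m0 mul1r mulr1.
    rewrite [X in m n k.+1 + X + _](_ : _ = S' n); first by ring.
    by apply: eq_bigr => l _; rewrite /= /bump/= add1n subSS.
  have E : m n k.+1 * den n = num n.
    have := rec k; rewrite SE /num /den => h.
    rewrite mulrDr mulr1 {1}h; ring.
  have den1 : den n != 0 by rewrite gt_eqF.
  first [by rewrite -E mulfK|by apply/esym; rewrite -E mulfK].
by move=> k; exact: (strong k k (leqnn _)).
Unshelve. all: by end_near. Qed.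

End moment_limit.

(** * The exact moment recursion at a stationary point *)

Section stieltjes_relation.
Context {R : realType}.

Definition emp_moment n (x : nat -> R) k : R := n%:R^-1 * \sum_(i < n) x i ^+ k.

Lemma sum_divided_powers n (x : nat -> R) k : (0 < n)%N ->
  (forall i j : 'I_n, i != j -> x i != x j) ->
  2 * (\sum_(i < n) \sum_(j < n | (i < j)%N) (x i ^+ k - x j ^+ k) / (x i - x j)) =
  n%:R ^+ 2 * loop_sum (emp_moment n x) n k.
Proof.
move=> n0 xt.
have nn0 : n%:R != 0 :> R by rewrite pnatr_eq0 -lt0n.
pose F (i j : 'I_n) : R := (x i ^+ k - x j ^+ k) / (x i - x j).
have := @big_lt_sym R 0 +%R n F; rewrite /= => symF.
rewrite mulr2n mulrDl mul1r symF; last first.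
  by move=> i j; rewrite /F -[x i - x j]opprB invrN mulrN -mulNr opprB.
pose G (i j : 'I_n) : R := \sum_(l < k) x i ^+ (k.-1 - l) * x j ^+ l.
transitivity (\sum_(i < n) (\sum_(j < n) G i j - k%:R * x i ^+ k.-1)).
  apply: eq_bigr => i _; rewrite [in RHS](bigD1 i)//= addrAC.
  have -> : G i i = k%:R * x i ^+ k.-1.
    rewrite /G (eq_bigr (fun=> x i ^+ k.-1)); last first.
      by move=> l _; rewrite -exprD subnK// -ltnS (ltn_predK (ltn_ord l)).
    by rewrite sumr_const card_ord mulr_natl.
  rewrite subrr add0r; apply: eq_bigr => j ji.
  have xij : x i - x j != 0 by rewrite subr_eq0 xt// eq_sym.
  by rewrite /F subrXX mulrAC divff// mul1r.
rewrite sumrB -mulr_sumr /loop_sum mulrBr; congr (_ - _); last first.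
  by rewrite /emp_moment; field.
rewrite /conv mulr_sumr.
under eq_bigr do rewrite exchange_big/=.
rewrite exchange_big/=; apply: eq_bigr => l _.
transitivity ((\sum_(i < n) x i ^+ (k.-1 - l)) * (\sum_(j < n) x j ^+ l)).
  by rewrite mulr_suml; apply: eq_bigr => i _; rewrite mulr_sumr.
by rewrite /emp_moment; field.
Qed.

(** The test direction is [x ^ k * y * (1 - y)]: the last factors cancel the poles of the potential.
    In terms of [x] they form the quadratic [p (1 - p) + (1 - 2 p) x / c - x^2 / c^2], the origin of
    the three loop sums. *)
Lemma moment_rec beta n (A B c p : R) (y : nat -> R) : (0 < n)%N -> 0 < c ->
  0 < p < 1 -> 0 < A + B -> (forall i : 'I_n, 0 < y i < 1) ->
  (forall i j : 'I_n, i != j -> y i != y j) ->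
  (forall g, crit_sum beta A B n y g = 0) ->
  let m := emp_moment n (fun i => c * (y i - p)) in
  forall k, m k.+1 = c * (A - (A + B) * p) / (A + B) * m k +
    beta / 2 * c ^+ 2 * n%:R * (p * (1 - p)) / (A + B) *
     (loop_sum m n k + (1 - p - p) / (p * (1 - p) * c) * loop_sum m n k.+1
       - (p * (1 - p) * c ^+ 2)^-1 * loop_sum m n k.+2).
Proof.
move=> n0 c0 /andP[p0 p1] AB y01 yt crit m k.
pose x i := c * (y i - p).
have xt (i j : 'I_n) : i != j -> x i != x j.
  by move=> /yt; apply: contra => /eqP /(mulfI (lt0r_neq0 c0)) /addIr ->.
have nn0 : n%:R != 0 :> R by rewrite pnatr_eq0 -lt0n.
have c1 : c != 0 by rewrite gt_eqF.
have p2 : p != 0 by rewrite gt_eqF.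
have p3 : 1 - p != 0 by rewrite gt_eqF// subr_gt0.
have AB1 : A + B != 0 by rewrite gt_eqF.
pose T j := \sum_(i < n) \sum_(l < n | (i < l)%N) (x i ^+ j - x l ^+ j) / (x i - x l).
have TE j : T j = n%:R ^+ 2 / 2 * loop_sum m n j.
  have /= := sum_divided_powers n x j n0 xt; rewrite -/(T j) -[emp_moment n x]/m => h.
  have -> : T j = 2^-1 * (2 * T j) by field.
  by rewrite h; field.
have Ms j : \sum_(i < n) x i ^+ j = n%:R * m j.
  by rewrite /m /emp_moment mulrA divff// mul1r.
have := crit (fun i => x i ^+ k * (y i * (1 - y i))); rewrite /crit_sum.
have -> : \sum_(i < n) \sum_(j < n | (i < j)%N)
    (x i ^+ k * (y i * (1 - y i)) - x j ^+ k * (y j * (1 - y j))) / (y i - y j) =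
  c * (p * (1 - p)) * T k + (1 - p - p) * T k.+1 - c^-1 * T k.+2.
  rewrite /T !mulr_sumr -!big_split/= -sumrB; apply: eq_bigr => i _.
  rewrite !mulr_sumr -!big_split/= -sumrB; apply: eq_bigr => j ij.
  have /xt : i != j by apply/eqP => ji; rewrite ji ltnn in ij.
  rewrite -subr_eq0 => xij.
  have yE l : y l = p + x l / c by rewrite /x; field.
  have -> : y i - y j = (x i - x j) / c by rewrite !yE; field.
  by rewrite !yE !exprS; field; rewrite xij.
have -> : \sum_(i < n) x i ^+ k * (y i * (1 - y i)) * (A / y i - B / (1 - y i)) =
   n%:R * ((A - (A + B) * p) * m k - (A + B) / c * m k.+1).
  transitivity ((A - (A + B) * p) * (n%:R * m k) - (A + B) / c * (n%:R * m k.+1)); last by ring.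
  rewrite -!Ms !mulr_sumr -sumrB; apply: eq_bigr => i _.
  have /andP[yi0 yi1] := y01 i.
  have yi2 : y i != 0 by rewrite gt_eqF.
  have yi3 : 1 - y i != 0 by rewrite gt_eqF// subr_gt0.
  have -> : x i ^+ k * (y i * (1 - y i)) * (A / y i - B / (1 - y i)) =
     x i ^+ k * (A - (A + B) * y i) by field; rewrite ?yi2 ?yi3.
  have -> : y i = p + x i / c by rewrite /x; field.
  by rewrite exprS; field.
rewrite !TE => h.
have -> : m k.+1 = m k.+1 + c / (n%:R * (A + B)) * 0 by rewrite mulr0 addr0.
rewrite -h; field.
by rewrite c1 nn0 AB1 p2 p3.
Qed.

End stieltjes_relation.

(** * Concentration of the Jacobi weight around the maximiser *)

Section jacobi_concentration.
Context {R : realType}.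

(** The space is cut into cells according to the order pattern [s] of the coordinates. In a cell the
    maximiser is relabelled to have the same pattern, so the midpoint map sends the cell into
    itself. The cells being disjoint, their integrals add up to the total mass and no factor [n!]
    arises. *)
Lemma jacobi_concentration beta n a b (y : nat -> R) (del : R) : 0 < beta ->
  0 <= a - e_beta beta n -> 0 <= b - e_beta beta n ->
  0 < jacobi_dens beta n a b y ->
  (forall v, jacobi_dens beta n a b v <= jacobi_dens beta n a b y) ->
  (iint n (fun v => (jacobi_dens beta n a b v *
     ([forall p : {perm 'I_n}, del < \sum_(i < n) (v i - y (p i)) ^+ 2])%:R)%:E) <=
   (2 ^+ n * expR (- ((a + b - 2 * e_beta beta n) / 8 * del)))%:E *
    iint n (fun v => (jacobi_dens beta n a b v)%:E))%E.
Proof.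
move=> beta0 A0 B0 wy ymax.
pose w := jacobi_dens beta n a b.
pose bad (v : nat -> R) := [forall p : {perm 'I_n}, del < \sum_(i < n) (v i - y (p i)) ^+ 2].
pose cmp (s : {ffun 'I_n * 'I_n -> bool}) (v : nat -> R) :=
  [forall ij : 'I_n * 'I_n, (v ij.1 < v ij.2) == s ij].
pose cmpy (s : {ffun 'I_n * 'I_n -> bool}) (p : {perm 'I_n}) :=
  [forall ij : 'I_n * 'I_n, (y (p ij.1) < y (p ij.2)) == s ij].
(* The default is used only for patterns that no relabelling of [y] realises; the density then
   vanishes on the whole cell. *)
pose ps s : {perm 'I_n} := odflt 1%g [pick p | cmpy s p].
pose z s := emb (fun i : 'I_n => y (ps s i)).
pose mid s (v : nat -> R) : nat -> R := fun i => 2^-1 * v i + 2^-1 * z s i.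
pose kc := (a + b - 2 * e_beta beta n) / 8.
pose E := expR (- (kc * del)).
have w0 v : 0 <= w v by exact: jacobi_dens_ge0.
have mw : measurable_fun setT (w : rseq R -> R) by exact: measurable_jacobi_dens.
have mbad : measurable_fun setT (bad : rseq R -> bool).
  apply: measurable_forallb => p; apply: measurable_fun_ltr => //.
  apply: measurable_sum => i; apply: measurable_funX.
  by apply: measurable_funB => //; exact: measurable_coord.
have mcmp s : measurable_fun setT (cmp s : rseq R -> bool).
  apply: measurable_forallb => -[i j]/=.
  have m1 : measurable_fun setT (fun v : rseq R => v i < v j).
    by apply: measurable_fun_ltr; exact: measurable_coord.
  case: (s (i, j)) => /=; first by under eq_fun do rewrite eqb_id.
  by under eq_fun do rewrite eqbF_neg; exact: measurable_neg.
have mR (f : rseq R -> bool) : measurable_fun setT f ->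
   measurable_fun setT (fun v => (f v)%:R : R).
  exact: measurable_bool_natmul.
have sum_cmp v : \sum_s (cmp s v)%:R = 1 :> R.
  pose s0 := [ffun ij : 'I_n * 'I_n => v ij.1 < v ij.2].
  have cmpE s : cmp s v = (s == s0).
    apply/forallP/eqP => [h|-> ij]; last by rewrite ffunE.
    by apply/ffunP => ij; rewrite ffunE; apply/esym/eqP.
  rewrite (bigD1 s0)//= cmpE eqxx big1 ?addr0// => s /negbTE ss0.
  by rewrite cmpE ss0.
have kc0 : 0 <= kc by rewrite /kc; lra.
have [_ yt] := jacobi_dens_neq0 _ _ _ _ _ beta0 (lt0r_neq0 wy).
have pt s v : w v * (bad v)%:R * (cmp s v)%:R <= E * (w (mid s v) * (cmp s (mid s v))%:R).
  have rhs0 : 0 <= E * (w (mid s v) * (cmp s (mid s v))%:R).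
    by apply: mulr_ge0; [exact: expR_ge0|apply: mulr_ge0 => //; exact: ler0n].
  have [wv|wv] := eqVneq (w v) 0; first by rewrite wv !mul0r.
  have [bv|] := boolP (bad v); last by rewrite mulr0 mul0r.
  have [/forallP cv|] := boolP (cmp s v); last by rewrite mulr0.
  rewrite !mulr1.
  have [_ vt] := jacobi_dens_neq0 _ _ _ _ _ beta0 wv.
  have psP : cmpy s (ps s).
    have [p pv] := same_order_perm n v y vt yt.
    have hp : cmpy s p by apply/forallP => ij; rewrite -pv; exact: cv.
    by rewrite /ps; case: pickP => [q hq|/(_ p)]; [exact: hq|rewrite hp].
  have vz (i j : 'I_n) : (v i < v j) = (z s i < z s j).
    rewrite /z !emb_ord; have /eqP /= -> := cv (i, j).
    by have /forallP/(_ (i, j))/eqP /= -> := psP.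
  have wz : w (z s) = w y.
    by apply: (jacobi_dens_perm _ _ _ _ _ (ps s)) => i; rewrite /z emb_ord.
  have vwz : w v <= w (z s) by rewrite wz; exact: ymax.
  have := jacobi_dens_mid _ _ _ _ v (z s) beta0 A0 B0 vz wv vwz.
  rewrite -/w -/kc -/(mid s v) => hmid.
  have -> : cmp s (mid s v).
    apply/forallP => -[i j] /=; rewrite -(eqP (cv (i, j))) /=; apply/eqP.
    rewrite /mid; case: (ltP (v i) (v j)) => [vij|vji].
      by have zij := vij; rewrite vz in zij; lra.
    have zji : z s j <= z s i by rewrite leNgt -vz -leNgt.
    by apply/negbTE; rewrite -leNgt; lra.
  rewrite mulr1 /E expRN mulrC ler_pdivlMr ?expR_gt0//.
  apply: le_trans hmid; rewrite ler_wpM2l// ler_expR ler_wpM2l//.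
  have /forallP/(_ (ps s))/ltW := bv; move=> /le_trans; apply.
  by apply: ler_sum => i _; rewrite /z emb_ord.
pose F s (v : rseq R) : \bar R := (w v * (cmp s v)%:R)%:E.
have mF s : measurable_fun setT (F s).
  by apply/measurable_EFinP; apply: measurable_funM => //; exact: mR.
have F0 s v : (0 <= F s v)%E by rewrite lee_fin mulr_ge0.
have mmid s : measurable_fun setT (mid s : rseq R -> rseq R).
  apply: measurable_fun_rseq => i; apply: measurable_funD => //.
  by apply: measurable_funM => //; exact: measurable_coord.
(* The Jacobian of the midpoint map, and the only source of the factor [2 ^+ n]. *)
have Fmid s : iint n (fun v => F s (mid s v)) = ((2 ^+ n)%:E * iint n (F s))%E.
  have z0 i : (n <= i)%N -> 2^-1 * z s i = 0 by move=> ni; rewrite /z emb_ge// mulr0.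
  have h2 : 0 < 2^-1 :> R by rewrite invr_gt0.
  rewrite [in RHS](iint_affine n 2^-1 (fun i => 2^-1 * z s i) (F s) h2 z0 (mF s) (F0 s)).
  by rewrite muleA -EFinM -exprMn mulfV// expr1n mul1e.
apply: (@le_trans _ _ (iint n (fun v => \sum_s E%:E * F s (mid s v)))%E).
  apply: le_iint.
  - by apply/measurable_EFinP; apply: measurable_funM => //; exact: mR.
  - apply: emeasurable_sum => s; apply: emeasurable_funM => //.
    exact: (measurableT_comp (mF s) (mmid s)).
  - by move=> v; rewrite lee_fin mulr_ge0.
  move=> v; rewrite -[leLHS]mule1 -EFinM.
  have -> : (w v * (bad v)%:R * 1)%:E = (\sum_s (w v * (bad v)%:R * (cmp s v)%:R)%:E)%E.
    by rewrite sumEFin -mulr_sumr sum_cmp.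
  by apply: lee_sum => s _; rewrite -EFinM lee_fin; exact: pt.
rewrite iint_sum; last 2 first.
- move=> s; apply: emeasurable_funM => //.
  exact: (measurableT_comp (mF s) (mmid s)).
- by move=> s v; rewrite mule_ge0// lee_fin expR_ge0.
have -> : (\sum_s iint n (fun v => E%:E * F s (mid s v)) =
   \sum_s (2 ^+ n * E)%:E * iint n (F s))%E.
  apply: eq_bigr => s _; rewrite iintZl//; last 2 first.
  - exact: (measurableT_comp (mF s) (mmid s)).
  - by rewrite lee_fin expR_ge0.
  by rewrite Fmid muleA -EFinM mulrC.
rewrite -ge0_sume_distrr; last by move=> s _; exact: iint_ge0.
rewrite -/kc -/E lee_wpmul2l ?lee_fin ?mulr_ge0 ?exprn_ge0 ?expR_ge0//.
rewrite -iint_sum//; apply: le_iint => //.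
- exact: emeasurable_sum.
- exact/measurable_EFinP.
- by move=> v; apply: sume_ge0.
- by move=> v; rewrite sumEFin -mulr_sumr sum_cmp mulr1.
Qed.

End jacobi_concentration.

(** * The joint law of eigenvalues and weights on all measurable sets *)

Section joint_law.
Context {R : realType} d (Om : measurableType d) (P : probability Om R).

Definition truncs n (v : rseq R) : rseq R := fun i => if (i < n)%N then v i else 0.

Lemma measurable_truncs n : measurable_fun setT (truncs n).
Proof.
apply: measurable_fun_rseq => i; rewrite /truncs; case: (i < n)%N => //.
exact: measurable_coord.
Qed.

Definition jac_prob (beta : R) n a b (A : set (rseq R)) : \bar R :=
  ((fine (iint n (fun v => (jacobi_dens beta n a b v)%:E)))^-1%:E *
   iint n (fun v => (jacobi_dens beta n a b v)%:E * (\1_A (truncs n v))%:E))%E.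

Definition dir_prob (bp : R) n (B : set (rseq R)) : \bar R :=
  ((fine (iint n.-1 (fun v => (dir_dens bp n v)%:E)))^-1%:E *
   iint n.-1 (fun v => (dir_dens bp n v)%:E * (\1_B (dirT n v))%:E))%E.

Variables (beta a b : R) (n : nat) (lam w : Om -> 'I_n -> R).
Hypothesis n0 : (0 < n)%N.
Hypothesis mlam : forall i, measurable_fun setT (fun om => lam om i).
Hypothesis mw : forall i, measurable_fun setT (fun om => w om i).
Hypothesis law : forall x y : 'I_n -> R,
  P [set om | forall i : 'I_n, lam om i <= x i /\ w om i <= y i] =
  (jacobi_box beta a b x * dir_box (beta / 2) y)%:E.

Let ZJ := iint n (fun v => (jacobi_dens beta n a b v)%:E).
Let ZD := iint n.-1 (fun v => (dir_dens (beta / 2) n v)%:E).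

(** Since [fine] sends infinity to 0 and division by 0 gives 0, a bad normalising integral would
    make every box null by [law], whereas countably many boxes cover the probability space. *)
Let Z_neq0 : fine ZJ != 0 /\ fine ZD != 0.
Proof.
apply: contrapT => Z0.
have box0 (x y : 'I_n -> R) :
    P [set om | forall i : 'I_n, lam om i <= x i /\ w om i <= y i] = 0%E.
  rewrite law; congr EFin; rewrite /jacobi_box /dir_box -/ZJ -/ZD.
  have [->|zj] := eqVneq (fine ZJ) 0; first by rewrite invr0 mulr0 mul0r.
  have [->|zd] := eqVneq (fine ZD) 0; first by rewrite invr0 !mulr0.
  by exfalso; exact: Z0.
pose F (k : nat) := [set om | forall i : 'I_n, lam om i <= k%:R /\ w om i <= k%:R].
have mF k : measurable (F k).
  rewrite [X in measurable X](_ : _ = \bigcap_(i in [set: 'I_n])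
      ([set om | lam om i <= k%:R] `&` [set om | w om i <= k%:R])).
    apply: fin_bigcap_measurable => // i _; apply: measurableI.
      by apply: (@measurable_set_bool _ _ (fun om => lam om i <= k%:R)); apply: measurable_fun_ler.
    by apply: (@measurable_set_bool _ _ (fun om => w om i <= k%:R)); apply: measurable_fun_ler.
  by apply/seteqP; split => om /= h i; [move=> _; exact: h|exact: (h i Logic.I)].
have cover : \bigcup_k F k = setT.
  apply/seteqP; split => // om _.
  exists (Num.truncn (\sum_(i < n) (`|lam om i| + `|w om i|))).+1 => //= i.
  have le1 : `|lam om i| + `|w om i| <= \sum_(i < n) (`|lam om i| + `|w om i|).
    by rewrite (bigD1 i)//= lerDl sumr_ge0// => j _; rewrite addr_ge0.
  have le2 := le_trans le1 (ltW (truncnS_gt _)).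
  split; apply: le_trans le2; rewrite (le_trans (ler_norm _))//.
    by rewrite lerDl.
  by rewrite lerDr.
have : (P (\bigcup_k F k) <= \sum_(k <oo) P (F k))%E.
  by apply: generalized_Boole_inequality => //; exact: bigcupT_measurable.
rewrite cover (eq_eseriesr (g := fun=> 0%E)); last by move=> k _; exact: box0.
rewrite eseries0//.
by rewrite probability_setT lee_fin ler10.
Qed.

Let ZJ_ge0 : (0 <= ZJ)%E.
Proof. by apply: iint_ge0 => v; rewrite lee_fin jacobi_dens_ge0. Qed.

Let ZD_ge0 : (0 <= ZD)%E.
Proof. by apply: iint_ge0 => v; rewrite lee_fin dir_dens_ge0. Qed.

Let fin_of (Z : \bar R) : (0 <= Z)%E -> fine Z != 0 -> Z \is a fin_num /\ 0 < fine Z.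
Proof.
case: Z => [r||] //=; rewrite ?eqxx// lee_fin => r0 rn; split => //.
by rewrite lt_neqAle eq_sym rn.
Qed.

Lemma ZJ_fin : iint n (fun v => (jacobi_dens beta n a b v)%:E) \is a fin_num /\
  0 < fine (iint n (fun v => (jacobi_dens beta n a b v)%:E)).
Proof. exact: fin_of ZJ_ge0 Z_neq0.1. Qed.

Lemma ZD_fin : iint n.-1 (fun v => (dir_dens (beta / 2) n v)%:E) \is a fin_num /\
  0 < fine (iint n.-1 (fun v => (dir_dens (beta / 2) n v)%:E)).
Proof. exact: fin_of ZD_ge0 Z_neq0.2. Qed.

Let mX m (X : Om -> 'I_m -> R) (A : set (rseq R)) :
  (forall i, measurable_fun setT (fun om => X om i)) -> measurable A ->
  measurable [set om | A (emb (X om))].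
Proof.
move=> mX mA; have := measurable_emb _ _ _ X mX.
by move=> /(_ measurableT A mA); rewrite setTI.
Qed.

Let mbox (X : Om -> 'I_n -> R) (x : 'I_n -> R) :
  (forall i, measurable_fun setT (fun om => X om i)) ->
  measurable [set om | forall i, X om i <= x i].
Proof.
move=> mX'; rewrite [X in measurable X](_ : _ = \bigcap_(i in [set: 'I_n]) [set om | X om i <= x i]).
  apply: fin_bigcap_measurable => // i _.
  by apply: (@measurable_set_bool _ _ (fun om => X om i <= x i)); apply: measurable_fun_ler.
by apply/seteqP; split => om /= h i; [move=> _; exact: h|exact: (h i Logic.I)].
Qed.

Let fine_scale k (f g : rseq R -> R) (c : R) : 0 <= c ->
  measurable_fun setT f -> measurable_fun setT g ->
  (forall v, 0 <= f v) -> (forall v, 0 <= g v <= 1) ->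
  iint k (fun v => (f v)%:E) \is a fin_num ->
  (c * fine (iint k (fun v => (f v * g v)%:E)))%:E =
  iint k (fun v => ((c * f v)%:E * (g v)%:E)%E).
Proof.
move=> c0 mf mg f0 g01 fin.
have m1 : measurable_fun setT (fun v => (f v * g v)%:E).
  by apply/measurable_EFinP; exact: measurable_funM.
have fin2 : iint k (fun v => (f v * g v)%:E) \is a fin_num.
  rewrite ge0_fin_numE; last first.
    by apply: iint_ge0 => v; rewrite lee_fin mulr_ge0//; have /andP[] := g01 v.
  apply: (@le_lt_trans _ _ (iint k (fun v => (f v)%:E))); last by rewrite ltey_eq fin.
  apply: le_iint => //; first exact/measurable_EFinP.
    by move=> v; rewrite lee_fin mulr_ge0//; have /andP[] := g01 v.
  by move=> v; rewrite lee_fin ler_piMr//; have /andP[] := g01 v.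
rewrite EFinM fineK// -iintZl//; last first.
  by move=> v; rewrite lee_fin mulr_ge0//; have /andP[] := g01 v.
by apply: eq_iint => v; rewrite -!EFinM mulrA.
Qed.

(** The extension from boxes is done one vector at a time: here the eigenvalues stay in a box, and
    restricting [P] to that event gives a finite measure for [law_unique]. [joint_law] repeats this
    with the roles exchanged. *)
Let half_law (x : 'I_n -> R) (B : set (rseq R)) : measurable B ->
  P ([set om | forall i, lam om i <= x i] `&` [set om | B (emb (w om))]) =
  ((jacobi_box beta a b x)%:E * dir_prob (beta / 2) n B)%E.
Proof.
move=> mB; have [zd1 zd2] := ZD_fin.
have mL := mbox lam x mlam.
have J0 : 0 <= jacobi_box beta a b x.
  rewrite divr_ge0// fine_ge0//; apply: iint_ge0 => v.
  by rewrite lee_fin mulr_ge0// jacobi_dens_ge0.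
pose c := jacobi_box beta a b x / fine ZD.
have c0 : 0 <= c by apply: divr_ge0 => //; exact: ltW.
have mdir := @measurable_dir_dens R (beta / 2) n.
have := @law_unique R n n.-1 (fun v => c * dir_dens (beta / 2) n v) (dirT n) d Om
  (mrestr P mL) w _ _ _ _ mw _ _ B mB.
move=> E; transitivity (mrestr P mL [set om | B (emb (w om))]).
  by rewrite /mrestr setIC.
rewrite E.
- rewrite /dir_prob muleA -EFinM -/ZD -/c -iintZl ?lee_fin//.
  + by apply: eq_iint => v; rewrite EFinM muleA.
  + apply: measurable_dens_integrand => //; exact: measurable_dirT.
  + by move=> v; rewrite mule_ge0 ?lee_fin ?dir_dens_ge0.
- exact: measurable_funM.
- by move=> v; rewrite mulr_ge0 ?dir_dens_ge0.
- exact: measurable_dirT.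
- by move=> v i ni; rewrite /dirT ltnNge ni.
- by rewrite (le_lt_trans (probability_le1 _ _)) ?ltry//; exact: measurableI.
- move=> y; rewrite /= /mrestr (_ : _ `&` _ = [set om | forall i : 'I_n, lam om i <= x i /\ w om i <= y i]); last first.
    by apply/seteqP; split => om /= => [[h1 h2] i|h]; [split; [exact: h2|exact: h1]|split => i; have [] := h i].
  rewrite law /dir_box -/ZD; set I := fine (iint _ _).
  have -> : jacobi_box beta a b x * (I / fine ZD) = c * I.
    by rewrite /c [RHS]mulrAC -mulrA.
  rewrite {}/I.
  pose g (v : rseq R) : R := ([forall i : 'I_n, dir_full n v i <= y i])%:R.
  have mg : measurable_fun setT g.
    apply: measurable_bool_natmul; apply: measurable_forallb => i.
    by apply: measurable_fun_ler => //; exact: measurable_dir_full.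
  rewrite (fine_scale n.-1 (dir_dens (beta / 2) n) g c)//.
  + apply: eq_iint => v; congr (_ * _%:E)%E; rewrite /g; congr ((nat_of_bool _)%:R).
    by apply: eq_forallb => i; rewrite /dirT ltn_ord.
  + by move=> v; exact: dir_dens_ge0.
  + by move=> v; rewrite /g; case: [forall _, _]; rewrite ?ler01 ?lexx.
Qed.

Lemma joint_law (A B : set (rseq R)) : measurable A -> measurable B ->
  P ([set om | A (emb (lam om))] `&` [set om | B (emb (w om))]) =
  (jac_prob beta n a b A * dir_prob (beta / 2) n B)%E.
Proof.
move=> mA mB; have [zj1 zj2] := ZJ_fin.
have mW := mX n w B mw mB.
have mjac := @measurable_jacobi_dens R beta n a b.
pose q := fine (dir_prob (beta / 2) n B).
have dB0 : (0 <= dir_prob (beta / 2) n B)%E.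
  rewrite mule_ge0 ?lee_fin ?invr_ge0 ?(ltW ZD_fin.2)//; apply: iint_ge0 => v.
  by rewrite mule_ge0 ?lee_fin ?dir_dens_ge0.
have [zd1 zd2] := ZD_fin.
have mdir := @measurable_dir_dens R (beta / 2) n.
have qE : dir_prob (beta / 2) n B = q%:E.
  rewrite fineK// ge0_fin_numE// /dir_prob lte_mul_pinfty ?lee_fin ?invr_ge0 ?ltW//.
  apply: (@le_lt_trans _ _ ZD); last by rewrite ltey_eq zd1.
  apply: le_iint.
  - apply: measurable_dens_integrand => //; exact: measurable_dirT.
  - exact/measurable_EFinP.
  - by move=> v; rewrite mule_ge0 ?lee_fin ?dir_dens_ge0.
  - by move=> v; rewrite -EFinM lee_fin ler_piMr ?dir_dens_ge0// indicE lern1 leq_b1.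
have q0 : 0 <= q by rewrite fine_ge0.
pose c := q / fine ZJ.
have c0 : 0 <= c by apply: divr_ge0 => //; exact: ltW.
have := @law_unique R n n (fun v => c * jacobi_dens beta n a b v) (truncs n) d Om
  (mrestr P mW) lam _ _ _ _ mlam _ _ A mA.
move=> E; transitivity (mrestr P mW [set om | A (emb (lam om))]); first by [].
rewrite E.
- rewrite qE /jac_prob muleC muleA -EFinM -/ZJ -/c -iintZl ?lee_fin//.
  + by apply: eq_iint => v; rewrite EFinM muleA.
  + apply: measurable_dens_integrand => //; exact: measurable_truncs.
  + by move=> v; rewrite mule_ge0 ?lee_fin ?jacobi_dens_ge0.
- exact: measurable_funM.
- by move=> v; rewrite mulr_ge0 ?jacobi_dens_ge0.
- exact: measurable_truncs.
- by move=> v i ni; rewrite /truncs ltnNge ni.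
- by rewrite (le_lt_trans (probability_le1 _ _)) ?ltry//; exact: measurableI.
- move=> x; rewrite /= /mrestr half_law// qE -EFinM /jacobi_box -/ZJ.
  set I := fine (iint _ _).
  have -> : I / fine ZJ * q = c * I by rewrite /c [LHS]mulrC [RHS]mulrAC -mulrA.
  rewrite {}/I.
  pose g (v : rseq R) : R := ([forall i : 'I_n, v i <= x i])%:R.
  have mg : measurable_fun setT g.
    apply: measurable_bool_natmul; apply: measurable_forallb => i.
    by apply: measurable_fun_ler => //; exact: measurable_coord.
  rewrite (fine_scale n (jacobi_dens beta n a b) g c)//.
  + apply: eq_iint => v; congr (_ * _%:E)%E; rewrite /g; congr ((nat_of_bool _)%:R).
    by apply: eq_forallb => i; rewrite /truncs ltn_ord.
  + by move=> v; exact: jacobi_dens_ge0.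
  + by move=> v; rewrite /g; case: [forall _, _]; rewrite ?ler01 ?lexx.
Qed.

Lemma jac_probT : jac_prob beta n a b setT = 1%E.
Proof.
have [z1 z2] := ZJ_fin; rewrite /jac_prob.
rewrite (eq_iint n _ (fun v => (jacobi_dens beta n a b v)%:E)); last first.
  by move=> v; rewrite indicE in_setT mule1.
by rewrite -[X in (_ * X)%E](fineK z1) -EFinM mulVf// gt_eqF.
Qed.

Lemma dir_probT : dir_prob (beta / 2) n setT = 1%E.
Proof.
have [z1 z2] := ZD_fin; rewrite /dir_prob.
rewrite (eq_iint n.-1 _ (fun v => (dir_dens (beta / 2) n v)%:E)); last first.
  by move=> v; rewrite indicE in_setT mule1.
by rewrite -[X in (_ * X)%E](fineK z1) -EFinM mulVf// gt_eqF.
Qed.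

Lemma lam_law (A : set (rseq R)) : measurable A ->
  P [set om | A (emb (lam om))] = jac_prob beta n a b A.
Proof.
move=> mA; have := joint_law A setT mA (@measurableT _ _).
by rewrite dir_probT mule1 => <-; congr (P _); apply/seteqP; split => om //= [].
Qed.

Lemma w_law (B : set (rseq R)) : measurable B ->
  P [set om | B (emb (w om))] = dir_prob (beta / 2) n B.
Proof.
move=> mB; have := joint_law setT B (@measurableT _ _) mB.
by rewrite jac_probT mul1e => <-; congr (P _); apply/seteqP; split => om //= [].
Qed.

End joint_law.

(** * Deterministic criteria for weak convergence *)

Section deterministic.
Context {R : realType}.

(** The cut-off 3 lies beyond the edge 2 of the semicircle. Where [|x| > 3], raising the exponent by
    [2 N] gains [9 ^ N], while the limiting moments grow by at most [4 ^ N]. *)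
Lemma emp_tail (x : nat -> nat -> R) (dg : nat) (e : R) : 0 < e ->
  (forall k, emp_moment n (x n) k @[n --> \oo] --> sc_moment k) ->
  \forall n \near \oo,
    n%:R^-1 * \sum_(i < n) ((3 < `|x n i|)%R%:R * (x n i) ^+ dg.*2) <= e.
Proof.
move=> e0 cm.
have [N hN] : exists N, 2 * 4 ^+ dg * (4 / 9) ^+ N <= e.
  have q1 : `|4 / 9 : R| < 1 by rewrite ger0_norm; lra.
  have /cvgrPdist_le/(_ e e0) := @cvg_geometric R (2 * 4 ^+ dg) (4 / 9) q1.
  move=> [N _ /(_ N (leqnn _))]; rewrite /= sub0r normrN => h.
  by exists N; apply: le_trans h; exact: ler_norm.
have /cvgrPdist_le/(_ 1 ltr01) := cm (dg + N).*2.
apply: filterS => n; rewrite ler_norml => /andP[h1 _].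
have m1 : emp_moment n (x n) (dg + N).*2 <= 2 * 4 ^+ (dg + N).
  have := @sc_moment_le R (dg + N).
  have : 1 <= 4 ^+ (dg + N) :> R by rewrite exprn_ege1//; lra.
  lra.
apply: le_trans hN.
have -> : 2 * 4 ^+ dg * (4 / 9) ^+ N = (9 ^+ N)^-1 * (2 * 4 ^+ (dg + N)) :> R.
  rewrite exprD expr_div_n; ring.
have n9 : 0 < (9 ^+ N)^-1 :> R by rewrite invr_gt0 exprn_gt0.
apply: (@le_trans _ _ ((9 ^+ N)^-1 * emp_moment n (x n) (dg + N).*2)); last first.
  by rewrite ler_pM2l.
rewrite /emp_moment mulrCA ler_wpM2l ?invr_ge0//.
rewrite mulr_sumr; apply: ler_sum => i _.
have x0 : 0 <= x n i ^+ 2 by exact: sqr_ge0.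
have E j : x n i ^+ j.*2 = (x n i ^+ 2) ^+ j by rewrite -exprM mul2n.
rewrite (E dg) (E (dg + N)%N); case: ltP => [x3|_]; last first.
  by rewrite mul0r mulr_ge0 ?(ltW n9)// exprn_ge0.
have X9 : 9 <= x n i ^+ 2 by rewrite -[x n i ^+ 2]real_normK ?num_real//; nra.
move: X9 x0; set X := x n i ^+ 2 => X9 x0.
rewrite mul1r exprD mulrCA; apply: ler_peMr; first exact: exprn_ge0.
rewrite mulrC ler_pdivlMr ?exprn_gt0// mul1r.
by rewrite lerXn2r ?nnegrE.
Qed.

Lemma emp_horner n (x : nat -> R) (p : {poly R}) :
  n%:R^-1 * \sum_(i < n) p.[x i] = polyL (emp_moment n x) p.
Proof.
rewrite /polyL /emp_moment; under eq_bigr do rewrite horner_coef.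
rewrite exchange_big mulr_sumr; apply: eq_bigr => k _.
by rewrite -mulr_sumr mulrCA.
Qed.

Lemma emp_affine n (e M : R) (u : nat -> R) : (0 < n)%N ->
  n%:R^-1 * \sum_(i < n) (e + M * u i) = e + M * (n%:R^-1 * \sum_(i < n) u i).
Proof.
move=> n0; rewrite big_split/= sumr_const card_ord -mulr_sumr mulrDr.
congr (_ + _); last by rewrite mulrCA.
by rewrite -[e *+ n]mulr_natl mulKf// pnatr_eq0 -lt0n.
Qed.

Lemma norm_emp_le n (u v : nat -> R) : (forall i, `|u i| <= v i) ->
  `|n%:R^-1 * \sum_(i < n) u i| <= n%:R^-1 * \sum_(i < n) v i.
Proof.
move=> uv; rewrite normrM ger0_norm ?invr_ge0// ler_wpM2l ?invr_ge0//.
by rewrite (le_trans (ler_norm_sum _ _ _))// ler_sum.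
Qed.

(** The points have no common bound. A polynomial [p] is close to [f] on [[-3, 3]]; elsewhere
    [f - p] is at most [C] times an even power of [x], whose average [emp_tail] makes small. *)
Lemma moments_weak (x : nat -> nat -> R) (f : R -> R) (M : R) :
  (forall k, emp_moment n (x n) k @[n --> \oo] --> sc_moment k) ->
  continuous f -> (forall t, `|f t| <= M) ->
  n%:R^-1 * \sum_(i < n) f (x n i) @[n --> \oo] --> SCint f.
Proof.
move=> cm cf fM; apply/cvgrPdist_le => e e0.
pose e4 := e / 4; have e40 : 0 < e4 by rewrite /e4; lra.
have [p pf] := @weierstrass R f 3 e4 cf (ltr0Sn R 2) e40.
have M0 : 0 <= M by exact: le_trans (normr_ge0 _) (fM 0).
pose C := M + \sum_(i < size p) `|p`_i|.
have C0 : 0 <= C by rewrite addr_ge0// sumr_ge0.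
have C1 : 0 < C + 1 by lra.
have cp : continuous (fun t => p.[t]) by exact: continuous_horner.
have SCp : `|SCint f - polyL sc_moment p| <= e4.
  rewrite -SCint_horner -SCintB//.
  have c1 : continuous (fun _ : R => 1 : R) by exact: cst_continuous.
  have cc (c : R) : SCint (fun _ : R => c * 1) = c.
    have := @SCintZ R c (fun=> 1) c1; rewrite -[SCint (fun=> 1)]/(sc_moment 0).
    by rewrite sc_moment0 mulr1.
  have cfp : continuous (fun t => f t - p.[t]).
    by move=> t; apply: cvgB; [exact: cf|exact: cp].
  have x3 t : -2 <= t <= 2 -> `|f t - p.[t]| <= e4.
    by move=> /andP[t1 t2]; apply: pf; rewrite ler_norml; apply/andP; split; lra.
  rewrite ler_norml; apply/andP; split.
    rewrite -(cc (- e4)); apply: le_SCint => //; first exact: cst_continuous.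
    by move=> t /x3; rewrite ler_norml mulr1 => /andP[].
  rewrite -[leRHS]cc; apply: le_SCint => //; first exact: cst_continuous.
  by move=> t /x3; rewrite ler_norml mulr1 => /andP[].
have cL : polyL (emp_moment n (x n)) p @[n --> \oo] --> polyL sc_moment p.
  apply: (@cvgn_sum _ _ _ (fun (i : 'I_(size p)) n => p`_i * emp_moment n (x n) i)) => i.
  by apply: cvgM; [exact: cvg_cst|exact: cm].
have /cvgrPdist_le/(_ e4 e40) hL := cL.
have eC : 0 < e4 / (C + 1) by rewrite divr_gt0.
have hT := emp_tail x (size p) _ eC cm.
near=> n.
have n0 : (0 < n)%N by near: n; exists 1%N.
have nL : `|polyL sc_moment p - polyL (emp_moment n (x n)) p| <= e4 by near: n.
have nT : n%:R^-1 * \sum_(i < n) ((3 < `|x n i|)%R%:R * (x n i) ^+ (size p).*2) <= e4 / (C + 1).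
  by near: n.
have nD : `|n%:R^-1 * \sum_(i < n) (f (x n i) - p.[x n i])| <= e4 + e4.
  apply: (@le_trans _ _ (n%:R^-1 * \sum_(i < n)
     (e4 + C * ((3 < `|x n i|)%R%:R * (x n i) ^+ (size p).*2)))).
    apply: (norm_emp_le n (fun i => f (x n i) - p.[x n i])
      (fun i => e4 + C * ((3 < `|x n i|)%R%:R * (x n i) ^+ (size p).*2))) => i.
    case: ltP => [x3|x3]; last by rewrite mul0r mulr0 addr0; exact: pf.
    rewrite mul1r ler_wpDl ?(ltW e40)//.
    have x1 : 1 <= `|x n i| by lra.
    have E : x n i ^+ (size p).*2 = `|x n i| ^+ (size p).*2.
      by rewrite -mul2n !exprM real_normK ?num_real.
    have X1 : 1 <= `|x n i| ^+ (size p).*2 by exact: exprn_ege1.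
    rewrite E (le_trans (ler_normB _ _))// /C mulrDl lerD//.
      by rewrite (le_trans (fM _))// ler_peMr.
    rewrite horner_coef (le_trans (ler_norm_sum _ _ _))// mulr_suml ler_sum// => k _.
    rewrite normrM ler_wpM2l// normrX ler_weXn2l//.
    by rewrite (leq_trans (ltnW (ltn_ord k)))// -addnn leq_addr.
  rewrite (emp_affine n e4 C (fun i => (3 < `|x n i|)%R%:R * (x n i) ^+ (size p).*2))//.
  rewrite lerD2l.
  apply: (@le_trans _ _ (C * (e4 / (C + 1)))); first by rewrite ler_wpM2l.
  by rewrite mulrCA ler_piMr ?(ltW e40)// ler_pdivrMr//; lra.
rewrite sumrB mulrBr emp_horner in nD.
move: SCp nL nD; rewrite /e4 !ler_norml => /andP[a1 a2] /andP[b1 b2] /andP[d1 d2].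
by apply/andP; split; lra.
Unshelve. all: by end_near. Qed.

(** Each difference of values is small by uniform continuity, unless the reference point is outside
    [[-3, 3]], which is rare, or the two points are at least [h] apart; then [2 M] is at most
    [2 M (x - y)^2 / h^2]. *)
Lemma close_weak (x y : nat -> nat -> R) (pp : forall n, {perm 'I_n}) (f : R -> R) (M : R) :
  (forall k, emp_moment n (y n) k @[n --> \oo] --> sc_moment k) ->
  n%:R^-1 * \sum_(i < n) (x n i - y n (pp n i)) ^+ 2 @[n --> \oo] --> 0 ->
  continuous f -> (forall t, `|f t| <= M) ->
  n%:R^-1 * \sum_(i < n) f (x n i) @[n --> \oo] --> SCint f.
Proof.
move=> cm cxy cf fM; apply/cvgrPdist_le => e e0.
pose e4 := e / 4; have e40 : 0 < e4 by rewrite /e4; lra.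
have M0 : 0 <= M by exact: le_trans (normr_ge0 _) (fM 0).
have M1 : 0 < 2 * M + 1 by lra.
have [h h0 fh] := @continuous_unif_segment R f 3 e4 cf e40.
have /cvgrPdist_le/(_ e4 e40) hw := moments_weak y f M cm cf fM.
have eM : 0 < e4 / (2 * M + 1) by rewrite divr_gt0.
have hT := emp_tail y 0 _ eM cm.
have eh : 0 < h ^+ 2 * (e4 / (2 * M + 1)) by rewrite mulr_gt0// exprn_gt0.
have /cvgrPdist_le/(_ _ eh) hd := cxy.
near=> n.
have n0 : (0 < n)%N by near: n; exists 1%N.
have nw : `|SCint f - n%:R^-1 * \sum_(i < n) f (y n i)| <= e4 by near: n.
have nT : n%:R^-1 * \sum_(i < n) ((3 < `|y n i|)%R%:R * (y n i) ^+ 0.*2) <= e4 / (2 * M + 1).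
  by near: n.
have nd : `|0 - n%:R^-1 * \sum_(i < n) (x n i - y n (pp n i)) ^+ 2| <= h ^+ 2 * (e4 / (2 * M + 1)).
  by near: n.
have ri (g : R -> R) : \sum_(i < n) g (y n i) = \sum_(i < n) g (y n (pp n i)).
  by rewrite (reindex_inj (@perm_inj _ (pp n))).
rewrite (ri f) in nw.
rewrite (ri (fun t => (3 < `|t|)%R%:R * t ^+ 0.*2)) in nT.
set u := n%:R^-1 * \sum_(i < n) f (y n (pp n i)) in nw.
have nD : `|n%:R^-1 * \sum_(i < n) (f (x n i) - f (y n (pp n i)))| <= e4 + e4 + e4.
  rewrite normrM ger0_norm ?invr_ge0//.
  apply: (@le_trans _ _ (n%:R^-1 * \sum_(i < n) (e4 + 2 * M * ((3 < `|y n (pp n i)|)%R%:R * (y n (pp n i)) ^+ 0.*2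
      + (h ^+ 2)^-1 * (x n i - y n (pp n i)) ^+ 2)))).
    rewrite ler_wpM2l ?invr_ge0// (le_trans (ler_norm_sum _ _ _))// ler_sum// => i _.
    set t := y n (pp n i); rewrite double0 expr0 mulr1.
    have s0 : 0 <= (h ^+ 2)^-1 * (x n i - t) ^+ 2 by rewrite mulr_ge0 ?invr_ge0 ?sqr_ge0.
    have F2 : `|f (x n i) - f t| <= 2 * M.
      by rewrite (le_trans (ler_normB _ _))// mulr2n mulrDl mul1r lerD.
    case: ltP => [t3|t3].
      rewrite (le_trans F2)// ler_wpDl ?(ltW e40)// ler_peMr ?mulr_ge0//.
      by suff : 1 <= 1 + (h ^+ 2)^-1 * (x n i - t) ^+ 2 by []; rewrite lerDl.
    rewrite add0r; have [xt|xt] := ltP `|t - x n i| h.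
      have hft := fh t (x n i) t3 xt.
      rewrite distrC; apply: ler_wpDr; last exact: ltW.
      by apply: mulr_ge0 => //; exact: mulr_ge0.
    rewrite (le_trans F2)// ler_wpDl ?(ltW e40)// ler_peMr ?mulr_ge0//.
    rewrite mulrC ler_pdivlMr ?exprn_gt0// mul1r -[leRHS]real_normK ?num_real// distrC.
    by rewrite lerXn2r ?nnegrE ?(ltW h0).
  rewrite big_split/= sumr_const card_ord -mulr_sumr big_split/= -mulr_sumr.
  rewrite mulrDr -[e4 *+ n]mulr_natl mulrA mulVf ?mul1r ?pnatr_eq0 -?lt0n//.
  rewrite -addrA lerD2l mulrCA mulrDr mulrDr; apply: lerD.
    apply: (@le_trans _ _ (2 * M * (e4 / (2 * M + 1)))); first by rewrite ler_wpM2l ?mulr_ge0.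
    by rewrite mulrCA ler_piMr ?(ltW e40)// ler_pdivrMr//; lra.
  move: nd; rewrite sub0r normrN ger0_norm; last first.
    by rewrite mulr_ge0 ?invr_ge0// sumr_ge0// => i _; exact: sqr_ge0.
  move=> nd; apply: (@le_trans _ _ (2 * M * (e4 / (2 * M + 1)))).
    rewrite ler_wpM2l ?mulr_ge0// mulrCA -ler_pdivlMl ?invr_gt0 ?exprn_gt0//.
    by rewrite invrK.
  by rewrite mulrCA ler_piMr ?(ltW e40)// ler_pdivrMr//; lra.
rewrite sumrB mulrBr -/u in nD.
move: nw nD; rewrite /e4 !ler_norml => /andP[a1 a2] /andP[b1 b2].
by apply/andP; split; lra.
Unshelve. all: by end_near. Qed.

(** If [|x| >= 4], then the matching point exceeds 3 in absolute value or is at distance at least 1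
    from [x]. *)
Lemma close_tail (x y : nat -> nat -> R) (pp : forall n, {perm 'I_n}) :
  (forall k, emp_moment n (y n) k @[n --> \oo] --> sc_moment k) ->
  n%:R^-1 * \sum_(i < n) (x n i - y n (pp n i)) ^+ 2 @[n --> \oo] --> 0 ->
  n%:R^-1 * \sum_(i < n) (4 <= `|x n i|)%R%:R @[n --> \oo] --> (0 : R).
Proof.
move=> cm cxy; apply/cvgrPdist_le => e e0.
pose e2 := e / 2; have e20 : 0 < e2 by rewrite /e2; lra.
have hT := emp_tail y 0 _ e20 cm.
have /cvgrPdist_le/(_ _ e20) hd := cxy.
near=> n.
have nT : n%:R^-1 * \sum_(i < n) ((3 < `|y n i|)%R%:R * (y n i) ^+ 0.*2) <= e2 by near: n.
have nd : `|0 - n%:R^-1 * \sum_(i < n) (x n i - y n (pp n i)) ^+ 2| <= e2 by near: n.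
rewrite (reindex_inj (@perm_inj _ (pp n)))/= in nT.
rewrite sub0r normrN ger0_norm; last first.
  by rewrite mulr_ge0 ?invr_ge0// sumr_ge0.
move: nd; rewrite sub0r normrN => /(le_trans (ler_norm _)) nd.
rewrite -(_ : e2 + e2 = e); last by rewrite /e2; lra.
apply: le_trans (lerD nT nd); rewrite -mulrDr -big_split/= ler_wpM2l ?invr_ge0//.
apply: ler_sum => i _; set t := y n (pp n i); rewrite double0 expr0 mulr1.
have s0 := sqr_ge0 (x n i - t).
case: (leP 4 `|x n i|) => [x4|_]; last first.
  by suff : 0 <= (3 < `|t|)%R%:R + (x n i - t) ^+ 2 by []; rewrite addr_ge0 ?ler0n.
case: (ltP 3 `|t|) => [t3|t3]; first by rewrite lerDl.
rewrite add0r -[leRHS]real_normK ?num_real//.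
have : `|x n i| - `|t| <= `|x n i - t| by exact: lerB_dist.
by move=> h; rewrite exprn_ege1//; lra.
Unshelve. all: by end_near. Qed.

(** The points that cut [[-4, 4]] into [N.+1] equal intervals. Over all meshes they are countably
    many, so almost sure statements hold at all of them together. *)
Definition grid (N j : nat) : R := -4 + 8 * j%:R / N.+1%:R.

(** Replacing [f] by a step function on the grid makes the difference of the two integrals a finite
    combination of half-line discrepancies. *)
Lemma spectral_weak (x w : forall n, 'I_n -> R) (f : R -> R) (M l : R) :
  (\forall n \near \oo, (forall i, 0 <= w n i) /\ \sum_(i < n) w n i = 1) ->
  (forall N j, \sum_(i < n) (w n i - n%:R^-1) * (x n i <= grid N j)%R%:R
     @[n --> \oo] --> 0) ->
  n%:R^-1 * \sum_(i < n) (4 <= `|x n i|)%R%:R @[n --> \oo] --> (0 : R) ->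
  continuous f -> (forall t, `|f t| <= M) ->
  n%:R^-1 * \sum_(i < n) f (x n i) @[n --> \oo] --> l ->
  \sum_(i < n) w n i * f (x n i) @[n --> \oo] --> l.
Proof.
move=> wP cD ctail cf fM cemp.
suff cdiff : \sum_(i < n) (w n i - n%:R^-1) * f (x n i) @[n --> \oo] --> 0.
  have h : \sum_(i < n) (w n i - n%:R^-1) * f (x n i) + n%:R^-1 * \sum_(i < n) f (x n i)
      @[n --> \oo] --> 0 + l by exact: cvgD.
  rewrite add0r in h; apply: cvg_trans h; apply: near_eq_cvg.
  apply: nearW => n /=; rewrite mulr_sumr -big_split/=; apply: eq_bigr => i _.
  by rewrite mulrBl subrK.
apply/cvgr0Pnorm_le => e e0.
(* Seven of the eight parts are spent: one on [A1], four on the weighted error [B1], two on the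
   unweighted error [B2]. *)
pose e8 := e / 8; have e80 : 0 < e8 by rewrite /e8; lra.
have M0 : 0 <= M by exact: le_trans (normr_ge0 _) (fM 0).
have [h h0 fh] := @continuous_unif_segment R f 4 e8 cf e80.
pose N := Num.truncn (8 / h); have Nh : 8 / N.+1%:R < h.
  by rewrite ltr_pdivrMr// mulrC -ltr_pdivrMr//; exact: truncnS_gt.
have N0 : 0 < N.+1%:R :> R by [].
pose t j := grid N j.
have tS j : t j.+1 = t j + 8 / N.+1%:R.
  by rewrite /t /grid -natr1; field; rewrite gt_eqF.
have t0 : t 0%N = -4 by rewrite /t /grid mulr0 mul0r addr0.
have tN : t N.+1 = 4 by rewrite /t /grid; field; rewrite gt_eqF.
have tle j : t j <= t j.+1 by rewrite tS lerDl divr_ge0.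
pose le_ (s : R) j : R := (s <= t j)%R%:R.
(* The step function takes on each mesh interval the value of [f] at the right end; [o] is the
   indicator of the complement of []-4, 4]], where [S] vanishes. *)
pose S s := \sum_(j < N.+1) f (t j.+1) * (le_ s j.+1 - le_ s j).
pose o s : R := 1 - (le_ s N.+1 - le_ s 0%N).
have tele s : \sum_(j < N.+1) (le_ s j.+1 - le_ s j) = le_ s N.+1 - le_ s 0%N.
  by rewrite -(big_mkord xpredT (fun j => le_ s j.+1 - le_ s j)) telescope_sumr.
have b01 s j : 0 <= le_ s j.+1 - le_ s j.
  rewrite subr_ge0 /le_ ler_nat; case: leP => // h1.
  by rewrite (le_trans h1 (tle j)).
have oE s : o s = ((s <= -4) || (4 < s))%R%:R.
  rewrite /o /le_ t0 tN; case: (leP s (-4)) => s1; case: (leP s 4) => s2 /=; lra.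
have tge j : -4 <= t j by rewrite /t /grid lerDl divr_ge0// mulr_ge0.
have tle4 j : (j <= N.+1)%N -> t j <= 4.
  move=> jN; rewrite -tN /t /grid lerD2l ler_pdivrMr// divfK ?gt_eqF// ler_pM2l//.
  by rewrite ler_nat.
have o_tail s : o s <= (4 <= `|s|)%R%:R.
  rewrite oE; case: (boolP (_ || _)) => [hs|_]; last exact: ler0n.
  suff -> : 4 <= `|s| by [].
  case/orP: hs => hs; first by rewrite ler0_norm; lra.
  by rewrite ger0_norm; lra.
have fS s : `|f s - S s| <= e8 + M * o s.
  have [os|os] := eqVneq (o s) 0.
    rewrite os mulr0 addr0.
    have one : \sum_(j < N.+1) (le_ s j.+1 - le_ s j) = 1.
      by rewrite tele; move: os; rewrite /o; lra.
    rewrite -[f s]mulr1 -one mulr_sumr /S -sumrB.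
    rewrite (le_trans (ler_norm_sum _ _ _))//.
    rewrite -[leRHS]mulr1 -one mulr_sumr ler_sum// => j _.
    rewrite -mulrBl normrM (ger0_norm (b01 s j)).
    rewrite /le_; case: (leP s (t j.+1)) => h1; last first.
      by case: (leP s (t j)) => h2; rewrite ?subrr ?mulr0//; have := tle j; lra.
    case: (leP s (t j)) => h2; first by rewrite subrr !mulr0.
    rewrite subr0 !mulr1 distrC; apply/ltW/fh.
      by rewrite ler_norml tge tle4// ltn_ord.
    by rewrite ger0_norm ?subr_ge0//; apply: le_lt_trans Nh; move: h2; rewrite tS; move: (t j) (8 / N.+1%:R) => T X; lra.
  have os1 : (s <= -4) || (4 < s) by move: os; rewrite oE; case: (_ || _); rewrite ?eqxx.
  have S0 : S s = 0.
    rewrite /S big1// => j _; suff -> : le_ s j.+1 - le_ s j = 0 by rewrite mulr0.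
    case/orP: os1 => hs; rewrite /le_.
      by rewrite !(le_trans hs (tge _)) subrr.
    by rewrite !leNgt !(le_lt_trans (tle4 _ _) hs)// ?subrr// ltnW.
  by rewrite S0 subr0 oE os1 mulr1 (le_trans (fM s))// ler_wpDl// ltW.
pose D j n := \sum_(i < n) (w n i - n%:R^-1) * le_ (x n i) j.
have cDj j : D j n @[n --> \oo] --> 0 by exact: cD.
pose A1 n := \sum_(j < N.+1) f (t j.+1) * (D j.+1 n - D j n).
have cA1 : A1 n @[n --> \oo] --> 0.
  have -> : 0 = \sum_(j < N.+1) f (t j.+1) * (0 - 0) :> R.
    by rewrite big1// => j _; rewrite subrr mulr0.
  apply: (@cvgn_sum _ _ _ (fun (j : 'I_N.+1) n => f (t j.+1) * (D j.+1 n - D j n))) => j.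
  by apply: cvgM; [exact: cvg_cst|apply: cvgB; exact: cDj].
have M1 : 0 < M + 1 by lra.
have eM : 0 < e8 / (M + 1) by rewrite divr_gt0.
have /cvgr0Pnorm_le/(_ _ e80) hA := cA1.
have /cvgr0Pnorm_le/(_ _ eM) h1 := cDj N.+1.
have /cvgr0Pnorm_le/(_ _ eM) h2 := cDj 0%N.
have /cvgr0Pnorm_le/(_ _ eM) h3 := ctail.
near=> n.
have n0 : (0 < n)%N by near: n; exists 1%N.
have nn0 : n%:R != 0 :> R by rewrite pnatr_eq0 -lt0n.
have [w0 w1] : (forall i, 0 <= w n i) /\ \sum_(i < n) w n i = 1 by near: n.
have nA : `|A1 n| <= e8 by near: n.
have n1 : `|D N.+1 n| <= e8 / (M + 1) by near: n.
have n2 : `|D 0%N n| <= e8 / (M + 1) by near: n.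
have n3 : `|n%:R^-1 * \sum_(i < n) (4 <= `|x n i|)%R%:R| <= e8 / (M + 1) by near: n.
have A1E : A1 n = \sum_(i < n) (w n i - n%:R^-1) * S (x n i).
  rewrite /A1 /D /S; under [RHS]eq_bigr do rewrite mulr_sumr.
  rewrite exchange_big/=; apply: eq_bigr => j _.
  by rewrite -sumrB mulr_sumr; apply: eq_bigr => i _; ring.
pose O := n%:R^-1 * \sum_(i < n) o (x n i).
(* Both total masses are 1, so the weighted tail is the unweighted one up to the discrepancies at -4
   and 4. No tail hypothesis on the weights is required. *)
have WO : \sum_(i < n) w n i * o (x n i) = O - (D N.+1 n - D 0%N n).
  have sn : \sum_(i < n) n%:R^-1 = 1 :> R.
    by rewrite sumr_const card_ord -[LHS]mulr_natl mulfV.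
  have : \sum_(i < n) (w n i - n%:R^-1) * o (x n i) = - (D N.+1 n - D 0%N n).
    transitivity (\sum_(i < n) ((w n i - n%:R^-1) - ((w n i - n%:R^-1) * le_ (x n i) N.+1
       - (w n i - n%:R^-1) * le_ (x n i) 0%N))).
      by apply: eq_bigr => i _; rewrite /o; ring.
    by rewrite !sumrB w1 sn subrr sub0r.
  rewrite /O mulr_sumr => <-; rewrite -big_split/=; apply: eq_bigr => i _; ring.
have O1 : O <= e8 / (M + 1).
  apply: le_trans (le_trans (ler_norm _) n3); rewrite ler_wpM2l ?invr_ge0//.
  by apply: ler_sum => i _.
have B1 : `|\sum_(i < n) w n i * (f (x n i) - S (x n i))| <= e8 + M * (\sum_(i < n) w n i * o (x n i)).
  rewrite (le_trans (ler_norm_sum _ _ _))//.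
  have -> : e8 + M * (\sum_(i < n) w n i * o (x n i)) = \sum_(i < n) w n i * (e8 + M * o (x n i)).
    rewrite -[e8 in LHS]mul1r -w1 mulr_suml mulr_sumr -big_split/=.
    by apply: eq_bigr => i _; ring.
  by apply: ler_sum => i _; rewrite normrM (ger0_norm (w0 i)) ler_wpM2l.
have B2 : `|n%:R^-1 * \sum_(i < n) (f (x n i) - S (x n i))| <= e8 + M * O.
  rewrite normrM ger0_norm ?invr_ge0//.
  have -> : e8 + M * O = n%:R^-1 * \sum_(i < n) (e8 + M * o (x n i)).
    rewrite big_split/= sumr_const card_ord -mulr_sumr mulrDr -[e8 *+ n]mulr_natl mulKf//.
    by rewrite /O mulrCA.
  rewrite ler_wpM2l ?invr_ge0// (le_trans (ler_norm_sum _ _ _))//.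
  by apply: ler_sum => i _.
have -> : \sum_(i < n) (w n i - n%:R^-1) * f (x n i) =
    A1 n + \sum_(i < n) w n i * (f (x n i) - S (x n i)) -
    n%:R^-1 * \sum_(i < n) (f (x n i) - S (x n i)).
  rewrite A1E mulr_sumr -big_split/= -sumrB; apply: eq_bigr => i _; ring.
rewrite WO in B1.
have MM : M * (e8 / (M + 1)) <= e8.
  by rewrite mulrCA ler_piMr ?(ltW e80)// ler_pdivrMr//; lra.
have MO : M * O <= e8 by apply: le_trans MM; rewrite ler_wpM2l.
have MD1 : M * `|D N.+1 n| <= e8 by apply: le_trans MM; rewrite ler_wpM2l.
have MD2 : M * `|D 0%N n| <= e8 by apply: le_trans MM; rewrite ler_wpM2l.
have MD : M * (O - (D N.+1 n - D 0%N n)) <= e8 + e8 + e8.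
  apply: (@le_trans _ _ (M * O + M * `|D N.+1 n| + M * `|D 0%N n|)); last by lra.
  rewrite -!mulrDr ler_wpM2l//.
  have := ler_norm (D 0%N n); have := ler_norm (- D N.+1 n); rewrite normrN; lra.
rewrite (le_trans (ler_normB _ _))//.
have := ler_normD (A1 n) (\sum_(i < n) w n i * (f (x n i) - S (x n i))).
move: nA B1 B2; rewrite /e8 in MO MD *; lra.
Unshelve. all: by end_near. Qed.

End deterministic.

(** * Borel-Cantelli with geometric bounds, and conditioning on a partition *)

Section borel_cantelli_geometric.
Context {R : realType} d (Om : measurableType d) (P : probability Om R).

Lemma ae_eventually_not (F : nat -> set Om) (r : R) :
  (forall n, measurable (F n)) -> 0 < r < 1 ->
  (\forall n \near \oo, (P (F n) <= (r ^+ n)%:E)%E) ->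
  \forall om \ae P, \forall n \near \oo, ~ F n om.
Proof.
move=> mF /andP[r0 r1] [N _ hN].
(* With this factor the bound also covers the indices below [N], because probabilities are at most
   1. *)
pose C := (r ^+ N)^-1.
have rN : 0 < r ^+ N by rewrite exprn_gt0.
have C1 : 1 <= C by rewrite invf_ge1// exprn_ile1 ?ltW.
have bnd n : (P (F n) <= (C * r ^+ n)%:E)%E.
  have [nN|nN] := leqP N n.
    rewrite (le_trans (hN n nN))// lee_fin ler_peMl// exprn_ge0// ltW//.
  rewrite (le_trans (probability_le1 P (mF n)))// lee_fin.
  rewrite mulrC ler_pdivlMr// mul1r; apply: ler_wiXn2l; rewrite ?ltW//.
  exact: ltnW.
have sumF : (\sum_(n <oo) P (F n) < +oo)%E.
  apply: (@le_lt_trans _ _ (\sum_(n <oo) (C * r ^+ n)%:E)%E).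
    by apply: lee_nneseries => n.
  apply: (@le_lt_trans _ _ (C * (1 - r)^-1)%:E); last exact: ltry.
  apply: lime_le.
    by apply: is_cvg_nneseries => n _ _; rewrite lee_fin mulr_ge0 ?exprn_ge0 ?(ltW r0)// (le_trans ler01).
  apply: nearW => n; rewrite sumEFin lee_fin.
  apply: (@geometric_le_lim R n C r); first exact: le_trans ler01 C1.
    exact: r0.
  by rewrite gtr0_norm.
have lim0 := lim_sup_set_cvg0 mF sumF.
have mlim : measurable (lim_sup_set F).
  by apply: bigcapT_measurable => k; apply: bigcup_measurable => j _.
have neg : P.-negligible (lim_sup_set F) by apply/negligibleP.
apply: negligibleS neg => om /= nQ n _.
apply: contrapT => nU; apply: nQ; exists n => // m /= nm Fm.
by apply: nU; exists m.
Qed.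

Lemma prob_le_partition (I : finType) (A : I -> set Om) (G : set Om) (rho : R) :
  0 <= rho -> measurable G -> (forall i, measurable (A i)) ->
  (forall i j, i != j -> A i `&` A j = set0) -> (forall om, exists i, A i om) ->
  (forall i, (P (A i `&` G) <= rho%:E * P (A i))%E) -> (P G <= rho%:E)%E.
Proof.
move=> rho0 mG mA dA cA hA.
have key (s : seq I) : uniq s ->
   (P (\big[setU/set0]_(i <- s) A i `&` G) <= rho%:E * P (\big[setU/set0]_(i <- s) A i))%E.
  elim: s => [_|i s IH /= /andP[nis us]]; first by rewrite big_nil set0I measure0 mule0.
  have mU : measurable (\big[setU/set0]_(i <- s) A i) by exact: bigsetU_measurable.
  have dU : A i `&` \big[setU/set0]_(i <- s) A i = set0.
    apply/seteqP; split => // om []; rewrite -bigcup_seq => Ai [j /= js Aj].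
    have : (A i `&` A j) om by [].
    by rewrite dA//; apply: contraNneq nis => ->.
  rewrite big_cons setIUl [X in (_ <= _ * X)%E]measureU//.
  rewrite (le_trans (measureU2 _ _ _))//; try exact: measurableI.
  by rewrite ge0_muleDr//; apply: leeD; [exact: hA|exact: IH].
have -> : G = \big[setU/set0]_(i <- enum I) A i `&` G.
  apply/seteqP; split => [om Gom|om []//]; split => //.
  have [i Ai] := cA om; rewrite (bigD1_seq i)/= ?enum_uniq ?mem_enum//.
  by left.
rewrite (le_trans (key _ (enum_uniq _)))// -[leRHS]mule1 lee_wpmul2l ?lee_fin//.
by apply: probability_le1; exact: bigsetU_measurable.
Qed.

End borel_cantelli_geometric.

(** * Asymptotics of the coefficients of the recursion *)

Section parameters.
Context {R : realType}.
Variables (beta sigma : R) (a b : nat -> R).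
Hypothesis beta0 : 0 < beta.
Hypothesis b0 : forall n, 0 < b n.
Hypothesis an : a n / n%:R @[n --> \oo] --> +oo.
Hypothesis sigma0 : 0 < sigma.
Hypothesis ab : a n / b n @[n --> \oo] --> sigma.
Hypothesis abr : Num.sqrt (b n / n%:R) * (sigma - a n / b n) @[n --> \oo] --> 0.

(* [jrescale beta sigma (b n) n l] is [scal n * (l - sigma / (sigma + 1))]. *)
Definition scal n : R :=
  (sigma + 1) * Num.sqrt (b n * (1 + sigma) / (sigma * n%:R * (beta / 2))).
(** Everything is written with convergent ratios: the scale is [gam / sv n], with [sv n] the square
    root of [n / b n], and the sum of the two exponents is [b n * den n]. *)
Let p := sigma / (sigma + 1).
Let e n := e_beta beta n.
Let A n := a n - e n.
Let B n := b n - e n.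
Let v n := n%:R / b n.
Let sv n := Num.sqrt (v n).
Let eb n := e n / b n.
Let u n := a n / b n.
Let den n := u n + 1 - 2 * eb n.
Let gam := (sigma + 1) * Num.sqrt ((1 + sigma) / (sigma * (beta / 2))).

Let s1 : 0 < 1 + sigma.
Proof. by rewrite addr_gt0. Qed.
Let s2 : 0 < sigma + 1.
Proof. by rewrite addr_gt0. Qed.

Let gam0 : 0 < gam.
Proof. by rewrite mulr_gt0// sqrtr_gt0 divr_gt0// mulr_gt0// divr_gt0. Qed.

(** [n / b] is the product of [n / a], which tends to 0, and [a / b], which stays bounded. *)
Let cv : v n @[n --> \oo] --> 0.
Proof.
apply/cvgr0Pnorm_le => ep ep0.
have /cvgryPge/(_ ((sigma + 1) / ep)) h1 := an.
have /cvgrPdist_le/(_ _ ltr01) h2 := ab.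
near=> n.
have n0 : (0 < n)%N by near: n; exists 1%N.
have nn0 : 0 < n%:R :> R by rewrite ltr0n.
have k1 : (sigma + 1) / ep <= a n / n%:R by near: n; exact: h1.
have k2 : `|sigma - a n / b n| <= 1 by near: n; exact: h2.
have bn := b0 n.
rewrite ger0_norm ?divr_ge0 ?(ltW bn)// ler_pdivrMr//.
have k3 : a n <= (sigma + 1) * b n.
  by rewrite -ler_pdivrMr//; move: k2; rewrite ler_norml => /andP[]; lra.
have k4 : (sigma + 1) * n%:R <= a n * ep.
  by move: k1; rewrite ler_pdivrMr// mulrAC ler_pdivlMr.
have k5 : a n * ep <= (sigma + 1) * (ep * b n) by rewrite mulrCA mulrC ler_wpM2l// ltW.
by rewrite -(ler_pM2l s2); exact: le_trans k4 k5.
Unshelve. all: by end_near. Qed.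

Let csv : sv n @[n --> \oo] --> 0.
Proof.
rewrite -[X in _ --> X]sqrtr0.
by apply: (@cvg_comp _ _ _ v Num.sqrt _ _ _ cv); exact: sqrt_continuous.
Qed.

Let cinv : n%:R^-1 @[n --> \oo] --> (0 : R).
Proof. by rewrite -cvg_shiftS; exact: cvg_harmonic. Qed.

Let ebE n : (0 < n)%N -> eb n = v n * (beta / 2 + (1 - beta / 2) * n%:R^-1).
Proof.
move=> n0; have nn0 : n%:R != 0 :> R by rewrite pnatr_eq0 -lt0n.
have bn : b n != 0 by rewrite gt_eqF.
by rewrite /eb /v /e /e_beta; field; rewrite nn0 bn.
Qed.

Let near_pos : \forall n \near \oo, (0 < n)%N.
Proof. by exists 1%N. Qed.

Let ceb : eb n @[n --> \oo] --> 0.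
Proof.
have h : v n * (beta / 2 + (1 - beta / 2) * n%:R^-1) @[n --> \oo] --> 0 * (beta / 2 + (1 - beta / 2) * 0).
  apply: cvgM => //; apply: cvgD; first exact: cvg_cst.
  by apply: cvgM => //; exact: cvg_cst.
rewrite mul0r in h; apply: cvg_trans h; apply: near_eq_cvg.
by apply: filterS near_pos => n n0; first [by rewrite ebE|by rewrite -ebE].
Qed.

Let cden : den n @[n --> \oo] --> sigma + 1.
Proof.
rewrite -[X in _ --> X]subr0 -[X in _ - X](mulr0 2); apply: cvgB.
  by apply: cvgD => //; exact: cvg_cst.
by apply: cvgM => //; exact: cvg_cst.
Qed.

Let near_den : \forall n \near \oo, 0 < den n.
Proof.
have /cvgrPdist_lt/(_ _ s2) := cden; apply: filterS => n.
by rewrite ltr_norml => /andP[_]; lra.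
Qed.

Lemma near_exponents : \forall n \near \oo,
  [/\ (0 < n)%N, 0 < a n - e_beta beta n, 0 < b n - e_beta beta n & 0 < scal n].
Proof.
have c1 : u n - eb n @[n --> \oo] --> sigma - 0 by apply: cvgB.
rewrite subr0 in c1.
have /cvgrPdist_lt/(_ _ sigma0) h1 := c1.
have /cvgr0Pnorm_lt/(_ _ ltr01) h2 := ceb.
near=> n.
have n0 : (0 < n)%N by near: n; exact: near_pos.
have k1 : `|sigma - (u n - eb n)| < sigma by near: n; exact: h1.
have k2 : `|eb n| < 1 by near: n; exact: h2.
have bn := b0 n; have bn' : b n != 0 by rewrite gt_eqF.
split => //.
- have -> : a n - e_beta beta n = b n * (u n - eb n) by rewrite /u /eb /e; field.
  by rewrite mulr_gt0//; move: k1; rewrite ltr_norml => /andP[_]; lra.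
- have -> : b n - e_beta beta n = b n * (1 - eb n) by rewrite /eb /e; field.
  by rewrite mulr_gt0//; move: k2; rewrite ltr_norml => /andP[_]; lra.
- rewrite /scal mulr_gt0// sqrtr_gt0 divr_gt0 ?mulr_gt0 ?divr_gt0// ltr0n//.
Unshelve. all: by end_near. Qed.

Let scalE n : (0 < n)%N -> scal n = gam / sv n /\ 0 < sv n /\ Num.sqrt (b n / n%:R) = (sv n)^-1.
Proof.
move=> n0; have nn0 : 0 < n%:R :> R by rewrite ltr0n.
have bn := b0 n.
have sv0 : 0 < sv n by rewrite sqrtr_gt0 divr_gt0.
have sq : Num.sqrt (b n / n%:R) = (sv n)^-1.
  by rewrite -[b n / n%:R]invrK invf_div sqrtrV ?divr_ge0 ?ltW.
split => //; rewrite -sq /scal /gam -[RHS]mulrA -sqrtrM; last first.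
  by rewrite divr_ge0 ?mulr_ge0 ?divr_ge0 ?ltW.
by congr (_ * Num.sqrt _); field; rewrite !gt_eqF.
Qed.

Let p01 : p * (1 - p) = sigma / (sigma + 1) ^+ 2.
Proof. by rewrite /p; field; rewrite gt_eqF. Qed.

Let pp0 : 0 < p * (1 - p).
Proof. by rewrite p01 divr_gt0// exprn_gt0. Qed.

Let sumE n : A n + B n = b n * den n.
Proof.
have bn : b n != 0 by rewrite gt_eqF.
by rewrite /A /B /den /u /eb; field.
Qed.

(** This coefficient becomes the variance in the limiting recursion; the constants of the rescaling
    are those that make it tend to 1. *)
Lemma kap_cvg : beta / 2 * scal n ^+ 2 * n%:R * (p * (1 - p)) /
    (a n - e_beta beta n + (b n - e_beta beta n)) @[n --> \oo] --> (1 : R).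
Proof.
have h : (1 + sigma) / den n @[n --> \oo] --> (1 + sigma) / (sigma + 1).
  by apply: cvgM; [exact: cvg_cst|apply: cvgV => //; rewrite gt_eqF].
rewrite (addrC 1) divff ?gt_eqF// in h; apply: cvg_trans h; apply: near_eq_cvg.
near=> n.
have n0 : (0 < n)%N by near: n; exact: near_pos.
have dn : 0 < den n by near: n; exact: near_den.
have bn := b0 n; have nn0 : 0 < n%:R :> R by rewrite ltr0n.
rewrite -/(e n) -/(A n) -/(B n) sumE /scal exprMn sqr_sqrtr; last first.
  by rewrite divr_ge0 ?mulr_ge0 ?divr_ge0 ?ltW.
rewrite p01.
have d1 : den n != 0 by rewrite gt_eqF.
have h1 : b n != 0 by rewrite gt_eqF.
have h2 : n%:R != 0 :> R by rewrite gt_eqF.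
have h3 : beta != 0 by rewrite gt_eqF.
have h4 : sigma != 0 by rewrite gt_eqF.
have h5 : sigma + 1 != 0 by rewrite gt_eqF.
move: d1; move: (den n) => D d1.
by first [field|apply/esym; field]; rewrite ?d1 ?h1 ?h2 ?h3 ?h4 ?h5.
Unshelve. all: by end_near. Qed.

(** The drift of the recursion, magnified by the scale; the rate hypothesis [abr] on [a / b] enters
    here. *)
Lemma del_cvg : scal n * (a n - e_beta beta n - (a n - e_beta beta n + (b n - e_beta beta n)) * p) /
    (a n - e_beta beta n + (b n - e_beta beta n)) @[n --> \oo] --> (0 : R).
Proof.
pose q n := beta / 2 + (1 - beta / 2) * n%:R^-1.
have cq : q n @[n --> \oo] --> beta / 2 + (1 - beta / 2) * 0.
  apply: cvgD; first exact: cvg_cst.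
  by apply: cvgM => //; exact: cvg_cst.
pose t n := gam / (1 + sigma) * (- (Num.sqrt (b n / n%:R) * (sigma - a n / b n))
   - (1 - sigma) * (sv n * q n)) / den n.
have h : t n @[n --> \oo] --> gam / (1 + sigma) * (- 0 - (1 - sigma) * (0 * (beta / 2 + (1 - beta / 2) * 0))) / (sigma + 1).
  apply: cvgM; last by apply: cvgV => //; rewrite gt_eqF.
  apply: cvgM; first exact: cvg_cst.
  apply: cvgB; first exact: cvgN.
  by apply: cvgM; [exact: cvg_cst|exact: cvgM].
rewrite mul0r mulr0 subr0 oppr0 mulr0 mul0r in h.
apply: cvg_trans h; apply: near_eq_cvg; near=> n.
have n0 : (0 < n)%N by near: n; exact: near_pos.
have dn : 0 < den n by near: n; exact: near_den.
have [sE [sv0 sq]] := scalE n n0.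
have bn : b n != 0 by rewrite gt_eqF.
rewrite /t -/(e n) -/(A n) -/(B n) sumE sE sq.
have svE : sv n ^+ 2 = v n by rewrite sqr_sqrtr// divr_ge0// ltW.
(* After the division by [sv n] that comes from the scale, the first term is controlled by [abr];
   the contribution of [e_beta] has the factor [sv n ^+ 2] and still tends to 0. *)
have AE : A n - b n * den n * p = b n * ((u n - sigma) - (1 - sigma) * (sv n ^+ 2 * q n)) / (1 + sigma).
  rewrite svE -/(q n) -[v n * q n]ebE// /A /den /p /eb /u; field.
  by rewrite bn !gt_eqF.
rewrite AE -/(u n).
have d1 : den n != 0 by rewrite gt_eqF.
have d2 : sv n != 0 by rewrite gt_eqF.
have d3 : 1 + sigma != 0 by rewrite gt_eqF.
move: d1 d2; move: (den n) (sv n) (q n) (u n) => D S Q U d1 d2.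
by first [field|apply/esym; field]; rewrite ?d1 ?d2 ?d3 ?bn.
Unshelve. all: by end_near. Qed.

Lemma r_cvg : (1 - p - p) / (p * (1 - p) * scal n) @[n --> \oo] --> (0 : R).
Proof.
have h : (1 - p - p) / (p * (1 - p) * gam) * sv n @[n --> \oo] --> (1 - p - p) / (p * (1 - p) * gam) * 0.
  by apply: cvgM => //; exact: cvg_cst.
rewrite mulr0 in h; apply: cvg_trans h; apply: near_eq_cvg.
apply: filterS near_pos => n n0; have [sE [sv0 _]] := scalE n n0; rewrite sE.
have d1 : gam != 0 by rewrite gt_eqF.
have d2 : sv n != 0 by rewrite gt_eqF.
have d3 : p * (1 - p) != 0 by rewrite gt_eqF.
have -> : (p * (1 - p) * (gam / sv n))^-1 = (p * (1 - p) * gam)^-1 * sv n.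
  by rewrite mulrA invf_div mulrC.
by rewrite -[LHS]mulrA.
Qed.

Lemma q_cvg : (p * (1 - p) * scal n ^+ 2)^-1 @[n --> \oo] --> (0 : R).
Proof.
have h : (p * (1 - p) * gam ^+ 2)^-1 * (sv n * sv n) @[n --> \oo] --> (p * (1 - p) * gam ^+ 2)^-1 * (0 * 0).
  by apply: cvgM; [exact: cvg_cst|exact: cvgM].
rewrite mulr0 mulr0 in h; apply: cvg_trans h; apply: near_eq_cvg.
apply: filterS near_pos => n n0; have [sE [sv0 _]] := scalE n n0; rewrite sE.
have E : (p * (1 - p) * (gam / sv n) ^+ 2)^-1 = (p * (1 - p) * gam ^+ 2)^-1 * (sv n * sv n).
  by rewrite expr_div_n mulrA invf_div mulrC expr2.
by first [rewrite E|rewrite -E].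
Qed.

End parameters.

(** * From unnormalised integrals to probabilities *)

Section normalisation.
Context {R : realType}.

Lemma normalise_le (Z X : \bar R) (C : R) : Z \is a fin_num -> 0 < fine Z ->
  (X <= C%:E * Z)%E -> ((fine Z)^-1%:E * X <= C%:E)%E.
Proof.
case: Z => // z _ /= z0 h.
have zi : (0 <= (z^-1)%:E :> \bar R)%E by rewrite lee_fin invr_ge0 ltW.
apply: le_trans (lee_wpmul2l zi h) _.
by rewrite -!EFinM lee_fin mulrCA mulVf ?mulr1// gt_eqF.
Qed.

Lemma indic_bool (T : Type) (f : T -> bool) (v : T) :
  \1_([set v | f v]) v = (f v)%:R :> R.
Proof.
rewrite indicE; congr ((nat_of_bool _)%:R).
by apply/idP/idP; rewrite in_setE.
Qed.

Lemma measurable_linear_pos n (h : nat -> R) :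
  measurable [set v : rseq R | (0 < \sum_(i < n) v i * h i)%R].
Proof.
apply: (@measurable_set_bool _ _ (fun v : rseq R => (0 < \sum_(i < n) v i * h i)%R)).
apply: measurable_fun_ltr; first exact: measurable_cst.
apply: measurable_sum => i; apply: measurable_funM; last exact: measurable_cst.
exact: measurable_coord.
Qed.

Lemma dir_prob_dev (bp : R) m (h : nat -> R) (s : R) : 0 < bp -> 1 <= m.+1%:R * bp -> 0 < s ->
  (forall i, (i < m.+1)%N -> `|s * h i| <= 2^-1) ->
  iint m.+1.-1 (fun v => (dir_dens bp m.+1 v)%:E) \is a fin_num ->
  0 < fine (iint m.+1.-1 (fun v => (dir_dens bp m.+1 v)%:E)) ->
  (dir_prob bp m.+1 [set v : rseq R | (0 < \sum_(i < m.+1) v i * h i)%R] <=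
   (expR (bp * \sum_(i < m.+1) (s * h i + 2 * (s * h i) ^+ 2)))%:E)%E.
Proof.
move=> bp0 mbp s0 hs z1 z2; rewrite /dir_prob; apply: normalise_le => //.
apply: le_trans (dirichlet_chernoff bp m h s bp0 mbp s0 hs).
rewrite le_eqVlt; apply/orP; left; apply/eqP; apply: eq_iint => v.
rewrite indic_bool EFinM; congr (_ * (nat_of_bool _)%:R%:E)%E; congr (_ < _).
by apply: eq_bigr => i _; rewrite /dirT ltn_ord.
Qed.

End normalisation.

(** * Probability bounds in fixed dimension *)

Section fixed_dimension.
Context {R : realType} d (Om : measurableType d) (P : probability Om R).
Variables (beta a b : R) (n : nat) (lam w : Om -> 'I_n -> R).
Hypothesis beta0 : 0 < beta.
Hypothesis mlam : forall i, measurable_fun setT (fun om => lam om i).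
Hypothesis mw : forall i, measurable_fun setT (fun om => w om i).

Definition far_event (y : nat -> R) (del : R) : set Om :=
  [set om | [forall p : {perm 'I_n}, (del < \sum_(i < n) (lam om i - y (p i)) ^+ 2)%R]].

(** For weights of sum 1: [sg] times the excess of spectral over empirical mass on the half-line is
    more than [eps]. Putting [eps] under the sum makes the condition homogeneous in the weights, as
    the Chernoff bound demands. *)
Definition dev_event (c p t sg eps : R) : set Om :=
  [set om | (0 < \sum_(i < n) w om i * (sg * ((c * (lam om i - p) <= t)%R%:R
     - n%:R^-1 * \sum_(j < n) (c * (lam om j - p) <= t)%R%:R) - eps))%R].

Lemma measurable_far_event y del : measurable (far_event y del).
Proof.
apply: measurable_set_bool; apply: measurable_forallb => p.
apply: measurable_fun_ltr; first exact: measurable_cst.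
apply: measurable_sum => i; apply: measurable_funX.
by apply: measurable_funB => //; exact: measurable_cst.
Qed.

Lemma measurable_below (c p t : R) i : measurable_fun setT (fun om => (c * (lam om i - p) <= t)%R).
Proof.
apply: measurable_fun_ler; last exact: measurable_cst.
apply: measurable_funM; first exact: measurable_cst.
by apply: measurable_funB => //; exact: measurable_cst.
Qed.

Lemma measurable_dev_event c p t sg eps : measurable (dev_event c p t sg eps).
Proof.
have me i : measurable_fun setT (fun om => (c * (lam om i - p) <= t)%R%:R : R).
  by apply: measurable_bool_natmul; exact: measurable_below.
apply: measurable_set_bool.
apply: measurable_fun_ltr; first exact: measurable_cst.
apply: measurable_sum => i; apply: measurable_funM => //.
apply: measurable_funB; last exact: measurable_cst.
apply: measurable_funM; first exact: measurable_cst.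
apply: measurable_funB; first exact: me.
apply: measurable_funM; first exact: measurable_cst.
by apply: measurable_sum => j; exact: me.
Qed.

Hypothesis law : forall x y : 'I_n -> R,
  P [set om | forall i : 'I_n, lam om i <= x i /\ w om i <= y i] =
  (jacobi_box beta a b x * dir_box (beta / 2) y)%:E.

Lemma far_event_prob (y : nat -> R) (del : R) :
  0 <= a - e_beta beta n -> 0 <= b - e_beta beta n ->
  0 < jacobi_dens beta n a b y ->
  (forall v, jacobi_dens beta n a b v <= jacobi_dens beta n a b y) ->
  (P (far_event y del) <=
   (2 ^+ n * expR (- ((a + b - 2 * e_beta beta n) / 8 * del)))%:E)%E.
Proof.
move=> A0 B0 y0 ymax.
pose F (v : rseq R) := [forall p : {perm 'I_n}, (del < \sum_(i < n) (v i - y (p i)) ^+ 2)%R].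
have mF : measurable [set v | F v].
  apply: measurable_set_bool; apply: measurable_forallb => p.
  apply: measurable_fun_ltr; first exact: measurable_cst.
  apply: measurable_sum => i; apply: measurable_funX.
  by apply: measurable_funB; [exact: measurable_coord|exact: measurable_cst].
have -> : far_event y del = [set om | [set v | F v] (emb (lam om))].
  have E om : F (emb (lam om)) =
      [forall p : {perm 'I_n}, (del < \sum_(i < n) (lam om i - y (p i)) ^+ 2)%R].
    by apply: eq_forallb => p; congr (_ < _); apply: eq_bigr => i _; rewrite emb_ord.
  by rewrite /far_event; apply/seteqP; split => om /=; rewrite E.
rewrite (lam_law d Om P beta a b n lam w mlam mw law _ mF) /jac_prob.
have [z1 z2] := ZJ_fin d Om P beta a b n lam w mlam mw law.
apply: normalise_le => //.
apply: le_trans (jacobi_concentration beta n a b y del beta0 A0 B0 y0 ymax).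
rewrite le_eqVlt; apply/orP; left; apply/eqP; apply: eq_iint => v.
rewrite indic_bool EFinM; congr (_ * (nat_of_bool _)%:R%:E)%E.
apply: eq_forallb => p; congr (_ < _); apply: eq_bigr => i _.
by rewrite /truncs ltn_ord.
Qed.

Hypothesis n0 : (0 < n)%N.

Lemma sum_dir_full (v : nat -> R) : \sum_(i < n) dir_full n v i = 1.
Proof.
rewrite /dir_full -(big_mkord xpredT (fun i => if (i < n.-1)%N then v i else 1 - \sum_(j < n.-1) v j)).
rewrite -[X in index_iota 0 X](prednK n0) big_nat_recr//= ltnn big_mkord.
rewrite [X in X + _](eq_bigr (fun i : 'I_n.-1 => v i)); last by move=> i _; rewrite ltn_ord.
by rewrite addrC subrK.
Qed.

(** The Dirichlet density vanishes unless all coordinates are positive, and [dir_full] has sum 1 by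
    construction. *)
Lemma weights_simplex_ae :
  \forall om \ae P, (forall i, 0 <= w om i) /\ \sum_(i < n) w om i = 1.
Proof.
pose good := [set v : rseq R | [forall i : 'I_n, 0 <= v i]] `&`
  ([set v : rseq R | 1 <= \sum_(i < n) v i] `&` [set v : rseq R | \sum_(i < n) v i <= 1]).
have mS : measurable_fun setT (fun v : rseq R => \sum_(i < n) v i).
  by apply: measurable_sum => i; exact: measurable_coord.
have mgood : measurable good.
  apply: measurableI; last apply: measurableI.
  - apply: measurable_set_bool; apply: measurable_forallb => i.
    by apply: measurable_fun_ler; [exact: measurable_cst|exact: measurable_coord].
  - apply: (@measurable_set_bool _ _ (fun v : rseq R => 1 <= \sum_(i < n) v i)).
    by apply: measurable_fun_ler; [exact: measurable_cst|exact: mS].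
  - apply: (@measurable_set_bool _ _ (fun v : rseq R => \sum_(i < n) v i <= 1)).
    by apply: measurable_fun_ler; [exact: mS|exact: measurable_cst].
have mbad := measurableC mgood.
have P0 : P [set om | (~` good) (emb (w om))] = 0%E.
  rewrite (w_law d Om P beta a b n lam w mlam mw law _ mbad) /dir_prob.
  suff -> : iint n.-1 (fun v =>
      ((dir_dens (beta / 2) n v)%:E * (\1_(~` good) (dirT n v))%:E)%E) = 0%E by rewrite mule0.
  transitivity (iint n.-1 (fun=> 0%E) : \bar R); last exact: iint0.
  apply: eq_iint => v.
  have [->|dv] := eqVneq (dir_dens (beta / 2) n v) 0; first by rewrite mul0e.
  suff g : good (dirT n v).
    by rewrite indicE memNset ?mule0// => ng; exact: ng.
  have pos (i : 'I_n) : 0 < dir_full n v i.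
    move: dv => /prodf_neq0/(_ i isT).
    by case: (0 < dir_full n v i) => //; rewrite eqxx.
  have S1 : \sum_(i < n) dirT n v i = 1.
    rewrite -[RHS](sum_dir_full v); apply: eq_bigr => i _.
    by rewrite /dirT ltn_ord.
  split => /=; last by rewrite S1.
  by apply/forallP => i; rewrite /dirT ltn_ord ltW.
have mE : measurable [set om | (~` good) (emb (w om))].
  have := measurable_emb d Om n w mw measurableT _ mbad.
  by rewrite setTI.
have neg : P.-negligible [set om | (~` good) (emb (w om))] by apply/negligibleP.
apply: negligibleS neg => om /= nQ [/forallP g1 [/= g2 g3]]; apply: nQ; split.
  by move=> i; have := g1 i; rewrite emb_ord.
have E : \sum_(i < n) emb (w om) i = \sum_(i < n) w om i.
  by apply: eq_bigr => i _; rewrite emb_ord.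
by apply/eqP; rewrite eq_le -E g2 g3.
Qed.

(* The law of the weights is independent of the eigenvalues, so the bound is
   proved conditionally on the set of indices with rescaled eigenvalue below t. *)
Lemma dev_event_prob (c p t sg eps : R) : 1 <= n%:R * (beta / 2) ->
  `|sg| = 1 -> 0 < eps <= 1 ->
  (P (dev_event c p t sg eps) <= (expR (- (beta / 2 * eps ^+ 2 / 32)) ^+ n)%:E)%E.
Proof.
move=> nb sg1 /andP[e0 e1].
have nn0 : 0 < n%:R :> R by rewrite ltr0n.
set rho := expR _ ^+ n.
have rho0 : 0 <= rho by rewrite exprn_ge0// expR_ge0.
pose A (J : {ffun 'I_n -> bool}) := [set om | [forall i, (c * (lam om i - p) <= t)%R == J i]].
have mA J : measurable (A J).
  apply: measurable_set_bool; apply: measurable_forallb => i.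
  have := measurable_below c p t i; case: (J i) => h.
    by rewrite (_ : (fun _ => _) = (fun om => (c * (lam om i - p) <= t)%R))//; apply/funext => om; rewrite eqb_id.
  rewrite (_ : (fun _ => _) = (fun om => ~~ (c * (lam om i - p) <= t)%R)); first exact: measurable_neg.
  by apply/funext => om; rewrite eqbF_neg.
apply: (prob_le_partition d Om P {ffun 'I_n -> bool} A) => //.
- exact: measurable_dev_event.
- move=> I J IJ; apply/seteqP; split => // om [/= /forallP hI /forallP hJ].
  move/eqP: IJ; apply; apply/ffunP => i.
  by rewrite -(eqP (hI i)) (eqP (hJ i)).
- move=> om; exists [ffun i => (c * (lam om i - p) <= t)%R]; apply/forallP => i.
  by rewrite ffunE.
move=> J.
pose K := n%:R^-1 * \sum_(j < n) (J j)%:R : R.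
pose h (i : nat) := sg * (emb (fun i : 'I_n => (J i)%:R) i - K) - eps.
pose F (v : rseq R) := [forall i : 'I_n, (c * (v i - p) <= t)%R == J i].
have AE : A J = [set om | [set v | F v] (emb (lam om))].
  have E om : F (emb (lam om)) = [forall i, (c * (lam om i - p) <= t)%R == J i].
    by apply: eq_forallb => i; rewrite emb_ord.
  by apply/seteqP; split => om /=; rewrite E.
have mF : measurable [set v | F v].
  apply: measurable_set_bool; apply: measurable_forallb => i.
  have h0 : measurable_fun setT (fun v : rseq R => (c * (v i - p) <= t)%R).
    apply: measurable_fun_ler; last exact: measurable_cst.
    apply: measurable_funM; first exact: measurable_cst.
    by apply: measurable_funB; [exact: measurable_coord|exact: measurable_cst].
  case: (J i).
    by rewrite (_ : (fun _ => _) = (fun v : rseq R => (c * (v i - p) <= t)%R))//; apply/funext => om; rewrite eqb_id.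
  rewrite (_ : (fun _ => _) = (fun v : rseq R => ~~ (c * (v i - p) <= t)%R)); first exact: measurable_neg.
  by apply/funext => om; rewrite eqbF_neg.
have mB := measurable_linear_pos n h.
have -> : A J `&` dev_event c p t sg eps =
    [set om | [set v | F v] (emb (lam om))] `&`
    [set om | [set v : rseq R | (0 < \sum_(i < n) v i * h i)%R] (emb (w om))].
  rewrite -AE; apply/seteqP; split => om [/= /forallP hA].
    rewrite /dev_event /= => hG; split; first exact/forallP.
    move: hG; congr (is_true (_ < _)); apply: eq_bigr => i _.
    rewrite !emb_ord /h emb_ord (eqP (hA i)) /K; congr (_ * (_ * (_ - _ * _) - _)).
    by apply: eq_bigr => j _; rewrite (eqP (hA j)).
  move=> hG; split; first exact/forallP.
  move: hG; rewrite /dev_event /=; congr (is_true (_ < _)); apply: eq_bigr => i _.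
  rewrite !emb_ord /h emb_ord (eqP (hA i)) /K; congr (_ * (_ * (_ - _ * _) - _)).
  by apply: eq_bigr => j _; rewrite (eqP (hA j)).
rewrite (joint_law d Om P beta a b n lam w mlam mw law _ _ mF mB).
have jE : P (A J) = jac_prob beta n a b [set v | F v].
  by rewrite AE (lam_law d Om P beta a b n lam w mlam mw law _ mF).
rewrite jE muleC; apply: lee_wpmul2r; first by rewrite -jE.
have J01 (i : 'I_n) : 0 <= ((J i)%:R : R) <= 1 by case: (J i); rewrite ?lexx ?ler01.
have SC (z : R) : \sum_(i < n) z = n%:R * z.
  by rewrite sumr_const card_ord -[LHS]mulr_natl.
have SJ : \sum_(i < n) (1 : R) = n%:R by rewrite SC mulr1.
have K01 : 0 <= K <= 1.
  rewrite /K mulr_ge0 ?invr_ge0 ?sumr_ge0//= mulrC ler_pdivrMr// mul1r -SJ.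
  by apply: ler_sum => i _; case/andP: (J01 i).
have hh (i : nat) : (i < n)%N -> `|h i| <= 2.
  move=> lti; have -> : i = Ordinal lti by [].
  rewrite /h emb_ord; set q : R := _%:R.
  have /andP[q0 q1] : 0 <= q <= 1 := J01 _.
  case/andP: K01 => K0 K1.
  rewrite (le_trans (ler_normB _ _))// normrM sg1 mul1r (ger0_norm (ltW e0)).
  have : `|q - K| <= 1 by rewrite ler_norml; lra.
  by move: (`|q - K|) => z; lra.
(* As [|h i| <= 2], this gives [|s * h i| <= eps / 8]. Since the [h i] sum to [- n eps], the linear
   part is [- n eps^2 / 16] and the quadratic part at most [n eps^2 / 32], half of it. *)
pose s := eps / 16.
have s0 : 0 < s by rewrite /s; lra.
have hs i : (i < n)%N -> `|s * h i| <= eps / 8.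
  move=> lti; rewrite normrM (ger0_norm (ltW s0)).
  have := ler_wpM2l (ltW s0) (hh i lti); rewrite /s; lra.
have hs' i : (i < n)%N -> `|s * h i| <= 2^-1.
  by move=> lti; rewrite (le_trans (hs i lti))//; lra.
have bp0 : 0 < beta / 2 by rewrite divr_gt0.
have [z1 z2] := ZD_fin d Om P beta a b n lam w mlam mw law.
have := dir_prob_dev (beta / 2) n.-1 h s bp0.
rewrite (prednK n0) => /(_ nb s0 hs' z1 z2) => hD.
apply: le_trans hD _; rewrite lee_fin /rho -expRM_natl ler_expR.
have Sh : \sum_(i < n) h i = - (n%:R * eps).
  have -> : \sum_(i < n) h i = sg * (\sum_(i < n) (J i)%:R - \sum_(i < n) K) - \sum_(i < n) eps.
    rewrite -sumrB mulr_sumr -sumrB; apply: eq_bigr => i _.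
    by rewrite /h emb_ord.
  rewrite !SC /K mulrA mulfV ?gt_eqF// mul1r subrr mulr0.
  by rewrite sub0r.
have : \sum_(i < n) (s * h i + 2 * (s * h i) ^+ 2) <= - (n%:R * (eps ^+ 2 / 32)).
  rewrite big_split/= -mulr_sumr Sh.
  have : \sum_(i < n) 2 * (s * h i) ^+ 2 <= \sum_(i < n) 2 * (eps / 8) ^+ 2.
    apply: ler_sum => i _; rewrite ler_pM2l//.
    rewrite -[leLHS]real_normK ?num_real// lerXn2r ?nnegrE ?normr_ge0 ?hs//.
    by rewrite divr_ge0 ?(ltW e0).
  rewrite SC.
  move: (\sum_(i < n) _) => S.
  have -> : n%:R * (2 * (eps / 8) ^+ 2) = n%:R * eps ^+ 2 / 32 :> R by field.
  have -> : s * - (n%:R * eps) = - (n%:R * eps ^+ 2) / 16 by rewrite /s; field.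
  by rewrite mulrA; move: (n%:R * eps ^+ 2) => z; lra.
move=> hS; apply: le_trans (ler_wpM2l (ltW bp0) hS) _.
by rewrite le_eqVlt; apply/orP; left; apply/eqP; field.
Qed.

End fixed_dimension.

(** * Almost sure limits *)

Section limits.
Context {R : realType} d (Om : measurableType d) (P : probability Om R).
Variables (beta sigma : R) (a b : nat -> R) (lam w : forall n : nat, Om -> 'I_n -> R).
Hypothesis beta0 : 0 < beta.
Hypothesis b0 : forall n, 0 < b n.
Hypothesis an : a n / n%:R @[n --> \oo] --> +oo.
Hypothesis sigma0 : 0 < sigma.
Hypothesis ab : a n / b n @[n --> \oo] --> sigma.
Hypothesis abr : Num.sqrt (b n / n%:R) * (sigma - a n / b n) @[n --> \oo] --> 0.
Hypothesis mlam : forall (n : nat) (i : 'I_n), measurable_fun setT (fun om => lam n om i).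
Hypothesis mw : forall (n : nat) (i : 'I_n), measurable_fun setT (fun om => w n om i).
Hypothesis law : forall n : nat, (0 < n)%N -> forall x y : 'I_n -> R,
  P [set om | forall i : 'I_n, lam n om i <= x i /\ w n om i <= y i] =
  (jacobi_box beta (a n) (b n) x * dir_box (beta / 2) y)%:E.

Let p := sigma / (sigma + 1).
Let c n := scal beta sigma b n.

Let p01 : 0 < p < 1.
Proof. by rewrite /p divr_gt0 ?addr_gt0//= ltr_pdivrMr ?addr_gt0// mul1r ltrDl. Qed.

Definition maximiser n (y : nat -> R) :=
  0 < jacobi_dens beta n (a n) (b n) y /\
  forall v, jacobi_dens beta n (a n) (b n) v <= jacobi_dens beta n (a n) (b n) y.

(** For small [n] the exponents may be negative, without any maximiser; the value chosen there is
    arbitrary. *)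
Lemma maximisers_exist : exists y : nat -> nat -> R, \forall n \near \oo, maximiser n (y n).
Proof.
have h n : exists yn, 0 < a n - e_beta beta n -> 0 < b n - e_beta beta n -> maximiser n yn.
  have [A0|A0] := boolP (0 < a n - e_beta beta n); last by exists (fun=> 0).
  have [B0|B0] := boolP (0 < b n - e_beta beta n); last by exists (fun=> 0).
  by have [y y0 ym] := jacobi_dens_max beta n (a n) (b n) beta0 A0 B0; exists y.
have [y hy] := choice h; exists y.
apply: filterS (near_exponents beta sigma a b beta0 b0 an sigma0 ab) => n [n0 A0 B0 _].
exact: hy.
Qed.

Lemma maximiser_moments (y : nat -> nat -> R) : (\forall n \near \oo, maximiser n (y n)) ->
  forall k, emp_moment n (fun i => c n * (y n i - p)) k @[n --> \oo] --> sc_moment k.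
Proof.
move=> ymax.
have := moments_cvg (fun n => emp_moment n (fun i => c n * (y n i - p))) _ _ _ _
  (del_cvg beta sigma a b beta0 b0 an sigma0 ab abr)
  (kap_cvg beta sigma a b beta0 b0 an sigma0 ab)
  (r_cvg beta sigma a b beta0 b0 an sigma0 ab)
  (q_cvg beta sigma a b beta0 b0 an sigma0 ab).
apply; near=> n.
have [n0 A0 B0 c0] : [/\ (0 < n)%N, 0 < a n - e_beta beta n, 0 < b n - e_beta beta n & 0 < c n].
  by near: n; exact: (near_exponents beta sigma a b beta0 b0 an sigma0 ab).
have [y0 ym] : maximiser n (y n) by near: n.
have [y01 yne] := jacobi_dens_neq0 beta n (a n) (b n) (y n) beta0 (lt0r_neq0 y0).
split.
  rewrite /emp_moment (eq_bigr (fun=> 1)); last by move=> i _; rewrite expr0.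
  by rewrite sumr_const card_ord mulVf// pnatr_eq0 -lt0n.
apply: (moment_rec beta n (a n - e_beta beta n) (b n - e_beta beta n) (c n) p (y n)) => //.
  by rewrite addr_gt0.
by move=> g; apply: crit_sum_eq0 => //; exact: ltW.
Unshelve. all: by end_near. Qed.

(** A squared distance [eps * n / c n ^+ 2] is [eps * n] after rescaling. By [kap_cvg] the sum of
    the exponents over [c n ^+ 2] is at least of order [n], so the exponent in the concentration
    bound is at least of order [n ^ 2]. *)
Lemma not_far_ae (y : nat -> nat -> R) (eps : R) : 0 < eps ->
  (\forall n \near \oo, maximiser n (y n)) ->
  \forall om \ae P, \forall n \near \oo,
    ~ far_event d Om n (lam n) (y n) (eps * n%:R / c n ^+ 2) om.
Proof.
move=> e0 ymax.
apply: (ae_eventually_not d Om P (fun n => far_event d Om n (lam n) (y n) (eps * n%:R / c n ^+ 2)) 2^-1).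
- by move=> n; apply: measurable_far_event; exact: mlam.
- by apply/andP; split; lra.
have pp0 : 0 < p * (1 - p) by case/andP: p01 => p0 p1; rewrite mulr_gt0// subr_gt0.
have cc0 : 0 < eps * beta * (p * (1 - p)) / 32 by rewrite divr_gt0// mulr_gt0// mulr_gt0.
have /cvgrPdist_le/(_ _ ltr01) hk := kap_cvg beta sigma a b beta0 b0 an sigma0 ab.
near=> n.
have [n0 A0 B0 c0] : [/\ (0 < n)%N, 0 < a n - e_beta beta n, 0 < b n - e_beta beta n & 0 < c n].
  by near: n; exact: (near_exponents beta sigma a b beta0 b0 an sigma0 ab).
have [y0 ym] : maximiser n (y n) by near: n.
have k2 : `|1 - beta / 2 * c n ^+ 2 * n%:R * (p * (1 - p)) /
    (a n - e_beta beta n + (b n - e_beta beta n))| <= 1 by near: n; exact: hk.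
(* The threshold beyond which the exponent is at least [4 n]; then [2 ^ n exp (- 4 n)] is at most
   [2^-1 ^+ n]. *)
have n4 : 4 / (eps * beta * (p * (1 - p)) / 32) <= n%:R by near: n; exact: nbhs_infty_ger.
have nn0 : 0 < n%:R :> R by rewrite ltr0n.
have hP := far_event_prob d Om P beta (a n) (b n) n (lam n) (w n) beta0 (mlam n) (mw n)
  (law n n0) (y n) (eps * n%:R / c n ^+ 2) (ltW A0) (ltW B0) y0 ym.
apply: (le_trans hP); rewrite lee_fin.
pose S := a n - e_beta beta n + (b n - e_beta beta n).
have S0 : 0 < S by rewrite addr_gt0.
have -> : a n + b n - 2 * e_beta beta n = S by rewrite /S; ring.
have c20 : 0 < c n ^+ 2 by rewrite exprn_gt0.
have kS : beta / 2 * c n ^+ 2 * n%:R * (p * (1 - p)) <= 2 * S.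
  by rewrite -ler_pdivrMr//; move: k2; rewrite ler_norml => /andP[]; rewrite -/S; lra.
have X4 : n%:R * 4 <= S / 8 * (eps * n%:R / c n ^+ 2).
  have h1 : beta * n%:R * (p * (1 - p)) / 4 <= S / c n ^+ 2.
    rewrite ler_pdivlMr//; apply: le_trans (_ : (2 * S) / 2 <= _); last by rewrite mulrAC divff// mul1r.
    apply: le_trans (ler_wpM2r _ kS); last by rewrite invr_ge0.
    by rewrite le_eqVlt; apply/orP; left; apply/eqP; field.
  have -> : S / 8 * (eps * n%:R / c n ^+ 2) = (eps * n%:R / 8) * (S / c n ^+ 2).
    by field; rewrite gt_eqF.
  have en0 : 0 <= eps * n%:R / 8 by rewrite divr_ge0// mulr_ge0// ltW.
  apply: le_trans (ler_wpM2l en0 h1).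
  rewrite ler_pdivrMr// in n4.
  apply: le_trans (ler_wpM2l (ltW nn0) n4) _.
  by rewrite le_eqVlt; apply/orP; left; apply/eqP; field.
have e4 : expR (- (S / 8 * (eps * n%:R / c n ^+ 2))) <= (4^-1) ^+ n.
  apply: (@le_trans _ _ (expR (n%:R * - 4))); first by rewrite ler_expR mulrN lerN2.
  rewrite expRM_natl lerXn2r ?nnegrE ?expR_ge0 ?invr_ge0// expRN lef_pV2 ?posrE ?expR_gt0//.
  by apply: le_trans (expR_ge1Dx 4); lra.
have p2 : 0 <= 2 ^+ n :> R by rewrite exprn_ge0.
apply: le_trans (ler_wpM2l p2 e4) _.
rewrite -exprMn (_ : 2 * 4^-1 = 2^-1 :> R)//; lra.
Unshelve. all: by end_near. Qed.

(** The permutation provided by [not_far_ae] depends on [eps]. Taking for each [n] one that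
    minimises the distance yields a single choice, good for all [eps = k.+1%:R^-1] at once. *)
Lemma eigenvalues_close_ae (y : nat -> nat -> R) :
  (\forall n \near \oo, maximiser n (y n)) ->
  \forall om \ae P, exists pp : forall n, {perm 'I_n},
    n%:R^-1 * \sum_(i < n) (emb (fun i : 'I_n => c n * (lam n om i - p)) i
       - c n * (y n (pp n i) - p)) ^+ 2 @[n --> \oo] --> 0.
Proof.
move=> ymax.
have h k : \forall om \ae P, \forall n \near \oo,
    ~ far_event d Om n (lam n) (y n) (k.+1%:R^-1 * n%:R / c n ^+ 2) om.
  by apply: not_far_ae => //; rewrite invr_gt0.
apply: filterS (ae_foralln h) => om hom.
pose S n (q : {perm 'I_n}) : R := \sum_(i < n) (lam n om i - y n (q i)) ^+ 2.
have hmin n : exists q : {perm 'I_n}, forall q', S n q <= S n q'.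
  case: (@arg_minP _ R _ (1%g : {perm 'I_n}) xpredT (S n) isT) => q _ hq.
  by exists q => q'; exact: hq.
exists (fun n => projT1 (cid (hmin n))).
apply/cvgr0Pnorm_le => e e0.
pose k := Num.truncn e^-1.
have ke : k.+1%:R^-1 <= e.
  rewrite -[leRHS]invrK lef_pV2 ?posrE ?invr_gt0//.
  by apply/ltW; exact: truncnS_gt.
have hk := hom k.
near=> n.
have [n0 A0 B0 c0] : [/\ (0 < n)%N, 0 < a n - e_beta beta n, 0 < b n - e_beta beta n & 0 < c n].
  by near: n; exact: (near_exponents beta sigma a b beta0 b0 an sigma0 ab).
have nF : ~ far_event d Om n (lam n) (y n) (k.+1%:R^-1 * n%:R / c n ^+ 2) om by near: n; exact: hk.
have nn0 : 0 < n%:R :> R by rewrite ltr0n.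
case: (cid (hmin n)) => q hq /=.
have Sq : S n q <= k.+1%:R^-1 * n%:R / c n ^+ 2.
  move/negP: nF; rewrite negb_forall => /existsP[q']; rewrite -leNgt.
  exact: le_trans (hq q').
have -> : \sum_(i < n) (emb (fun i : 'I_n => c n * (lam n om i - p)) i
       - c n * (y n (q i) - p)) ^+ 2 = c n ^+ 2 * S n q.
  by rewrite /S mulr_sumr; apply: eq_bigr => i _; rewrite emb_ord; ring.
have S0 : 0 <= S n q by apply: sumr_ge0 => i _; exact: sqr_ge0.
rewrite ger0_norm; last first.
  by rewrite mulr_ge0 ?invr_ge0// mulr_ge0// exprn_ge0// ltW.
apply: le_trans ke; rewrite mulrC ler_pdivrMr//.
by move: Sq; rewrite ler_pdivlMr ?exprn_gt0// mulrC.
Unshelve. all: by end_near. Qed.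

Lemma weights_ae : \forall om \ae P, \forall n \near \oo,
  (forall i, 0 <= w n om i) /\ \sum_(i < n) w n om i = 1.
Proof.
have h n : \forall om \ae P, (forall i, 0 <= w n.+1 om i) /\ \sum_(i < n.+1) w n.+1 om i = 1.
  exact: (weights_simplex_ae d Om P beta (a n.+1) (b n.+1) n.+1 (lam n.+1) (w n.+1)
    (mlam n.+1) (mw n.+1) (law n.+1 isT) isT).
apply: filterS (ae_foralln h) => om hom.
by exists 1%N => // -[//|n] _; exact: hom.
Qed.

Lemma not_dev_ae (t sg eps : R) : `|sg| = 1 -> 0 < eps <= 1 ->
  \forall om \ae P, \forall n \near \oo, ~ dev_event d Om n (lam n) (w n) (c n) p t sg eps om.
Proof.
move=> sg1 e01; have /andP[e0 e1] := e01.
apply: (ae_eventually_not d Om P (fun n => dev_event d Om n (lam n) (w n) (c n) p t sg eps)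
  (expR (- (beta / 2 * eps ^+ 2 / 32)))).
- by move=> n; apply: measurable_dev_event; [exact: mlam|exact: mw].
- rewrite expR_gt0/= expR_lt1 oppr_lt0 divr_gt0// mulr_gt0 ?exprn_gt0// divr_gt0//.
near=> n.
have n0 : (0 < n)%N by near: n; exists 1%N.
apply: (dev_event_prob d Om P beta (a n) (b n) n (lam n) (w n) beta0 (mlam n) (mw n)
  (law n n0) n0) => //.
have : (beta / 2)^-1 <= n%:R by near: n; exact: nbhs_infty_ger.
by rewrite -[leLHS]mul1r ler_pdivrMr// divr_gt0.
Unshelve. all: by end_near. Qed.

(** The two signs [sg] bound the discrepancy from both sides, and [N], [j], [k] range over countable
    sets, so one null set suffices. *)
Lemma weights_equidistributed_ae : \forall om \ae P, forall N j,
  \sum_(i < n) (w n om i - n%:R^-1) * (c n * (lam n om i - p) <= grid N j)%R%:R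
    @[n --> \oo] --> (0 : R).
Proof.
have h sg : `|sg| = 1 -> \forall om \ae P, forall N j k, \forall n \near \oo,
    ~ dev_event d Om n (lam n) (w n) (c n) p (grid N j) sg k.+1%:R^-1 om.
  move=> sg1; apply: ae_foralln => N; apply: ae_foralln => j; apply: ae_foralln => k.
  by apply: not_dev_ae => //; rewrite invr_gt0 ltr0n/= invf_le1// ler1n.
apply: filterS3 (h 1 (normr1 _)) (h (-1) (normrN1 _)) weights_ae => om hp hm hw N j.
apply/cvgr0Pnorm_le => e e0.
pose k := Num.truncn e^-1.
have ke : k.+1%:R^-1 <= e.
  rewrite -[leRHS]invrK lef_pV2 ?posrE ?invr_gt0//.
  by apply/ltW; exact: truncnS_gt.
have hp' := hp N j k; have hm' := hm N j k.
near=> n.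
have [w0 w1] : (forall i, 0 <= w n om i) /\ \sum_(i < n) w n om i = 1 by near: n; exact: hw.
have Np : ~ dev_event d Om n (lam n) (w n) (c n) p (grid N j) 1 k.+1%:R^-1 om by near: n; exact: hp'.
have Nm : ~ dev_event d Om n (lam n) (w n) (c n) p (grid N j) (-1) k.+1%:R^-1 om by near: n; exact: hm'.
move: Np Nm; rewrite /dev_event /=.
pose E (i : 'I_n) : R := (c n * (lam n om i - p) <= grid N j)%R%:R.
pose K := n%:R^-1 * \sum_(i < n) E i.
have DE : \sum_(i < n) (w n om i - n%:R^-1) * E i = \sum_(i < n) w n om i * E i - K.
  by rewrite /K mulr_sumr -sumrB; apply: eq_bigr => i _; rewrite mulrBl.
have GE sg ep : \sum_(i < n) w n om i * (sg * (E i - K) - ep) =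
    sg * (\sum_(i < n) w n om i * E i - K) - ep.
  transitivity (\sum_(i < n) (sg * (w n om i * E i) - w n om i * (sg * K + ep))).
    by apply: eq_bigr => i _; ring.
  by rewrite sumrB -mulr_sumr -mulr_suml w1; ring.
rewrite -!/(E _) -!/K !GE -!DE => /negP Np /negP Nm.
rewrite -!leNgt in Np Nm; apply: le_trans ke.
rewrite ler_norml; move: Np Nm.
by move: (\sum_(i < n) _) (k.+1%:R^-1) => D K'; lra.
Unshelve. all: by end_near. Qed.

Lemma jacobi_semicircle_ae :
  (\forall om \ae P, weak_conv_SC (fun n f =>
      spectral_int (fun i => jrescale beta sigma (b n) n (lam n om i)) (w n om) f)) /\
  (\forall om \ae P, weak_conv_SC (fun n f =>
      empirical_int (fun i => jrescale beta sigma (b n) n (lam n om i)) f)).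
Proof.
have [y ymax] := maximisers_exist.
have my := maximiser_moments y ymax.
have emp : \forall om \ae P, (forall (f : R -> R) (M : R), continuous f -> (forall t, `|f t| <= M) ->
     n%:R^-1 * \sum_(i < n) f (c n * (lam n om i - p)) @[n --> \oo] --> SCint f) /\
     n%:R^-1 * \sum_(i < n) (4 <= `|c n * (lam n om i - p)|)%R%:R @[n --> \oo] --> (0 : R).
  apply: filterS (eigenvalues_close_ae y ymax) => om [pp hpp].
  pose x n := emb (fun i : 'I_n => c n * (lam n om i - p)).
  split=> [f M cf fM|].
    have h := close_weak x (fun n i => c n * (y n i - p)) pp f M my hpp cf fM.
    apply: cvg_trans h; apply: near_eq_cvg; apply: nearW => n /=.
    by congr (_ * _); apply: eq_bigr => i _; rewrite /x emb_ord.
  have h := close_tail x (fun n i => c n * (y n i - p)) pp my hpp.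
  apply: cvg_trans h; apply: near_eq_cvg; apply: nearW => n /=.
  by congr (_ * _); apply: eq_bigr => i _; rewrite /x emb_ord.
split.
  apply: filterS3 emp weights_ae weights_equidistributed_ae => om [hf ht] hw hD f cf [M fM].
  rewrite SCintE.
  exact: (spectral_weak (fun n i => c n * (lam n om i - p)) (fun n => w n om) f M _
    hw hD ht cf fM (hf f M cf fM)).
apply: filterS emp => om [hf _] f cf [M fM]; rewrite SCintE.
exact: hf f M cf fM.
Qed.

End limits.

Theorem theorem2p1 (R : realType) (d : measure_display) (Omega : measurableType d)
  (P : probability Omega R) (beta sigma : R) (a b : nat -> R)
  (lam w : forall n : nat, Omega -> 'I_n -> R) :
  0 < beta ->
  (forall n, 0 < a n) -> (forall n, 0 < b n) ->
  (forall n : nat, (0 < n)%N ->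
     beta / 2 * (n%:R - 1) < a n /\ beta / 2 * (n%:R - 1) < b n) ->
  a n / n%:R @[n --> \oo] --> +oo ->
  0 < sigma ->
  a n / b n @[n --> \oo] --> sigma ->
  Num.sqrt (b n / n%:R) * (sigma - a n / b n) @[n --> \oo] --> 0 ->
  (forall (n : nat) (i : 'I_n), measurable_fun setT (fun om => lam n om i)) ->
  (forall (n : nat) (i : 'I_n), measurable_fun setT (fun om => w n om i)) ->
  (forall n : nat, (0 < n)%N -> forall x y : 'I_n -> R,
     P [set om | forall i : 'I_n, lam n om i <= x i /\ w n om i <= y i] =
     (jacobi_box beta (a n) (b n) x * dir_box (beta / 2) y)%:E) ->
  (\forall om \ae P, weak_conv_SC (fun n f =>
      spectral_int (fun i => jrescale beta sigma (b n) n (lam n om i)) (w n om) f)) /\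
  (\forall om \ae P, weak_conv_SC (fun n f =>
      empirical_int (fun i => jrescale beta sigma (b n) n (lam n om i)) f)).
Proof.
move=> beta0 a0 b0 _ an sigma0 ab abr mlam mw law.
exact: (jacobi_semicircle_ae d Omega P beta sigma a b lam w).
Qed.
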